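(* Let $m, s, n$ be positive integers with $s \geq 2$ and $n \geq 3$, and let $r \in \mathbb{Z}_n^*$ be such that $r^{ms} = 1$ or $r^{ms} = -1$ in $\mathbb{Z}_n$. Then the graph $\Gamma = \mathrm{CPM}(m,s,n;r)$ is $2$-arc-transitive if and only if $s = 2$ and one of the following holds: (i) $n = 4$ and $m = 1$, in which case $\Gamma \cong \mathrm{CPM}(1,2,4;1) \cong \mathrm{CPM}(2,2,4;1)$; (ii) $n = m$, $n$ is odd, and $r^2 = 1$ or $r^2 = -1$ in $\mathbb{Z}_n$; (iii) $n = 2m$, $m \equiv 2 \pmod 4$ and $1 + r^2 \equiv m \pmod n$.
   Context: For positive integers $m,s,n$ with $n\ge 3$ and $r\in\mathbb{Z}_n^*$ (the group of units of $\mathbb{Z}_n$) with $r^{ms}=1$ or $r^{ms}=-1$ in $\mathbb{Z}_n$, let $\overline{\mathrm{CPM}}(m,s,n;r)$ be the simple undirected graph with vertices $\langle i;\mathbf v\rangle$, $i\in\mathbb{Z}_{ms}$, $\mathbf v=(v_0,\dots,v_{s-1})\in\mathbb{Z}_n^s$, where $\langle i;\mathbf v\rangle$ is adjacent to the two vertices $\langle i+1;\mathbf v\pm r^i\mathbf e_\ell\rangle$; here $\ell\in\{0,\dots,s-1\}$ is the residue of $i$ modulo $s$ and $\mathbf e_0,\dots,\mathbf e_{s-1}$ are the standard vectors of $\mathbb{Z}_n^s$ (well defined, as $r^i$ is determined up to sign). $\mathrm{CPM}(m,s,n;r)$ is the connected component containing $\langle 0;\mathbf 0\rangle$. A $2$-arc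 of a graph is a sequence $(v_0,v_1,v_2)$ of vertices with $v_0\sim v_1\sim v_2$ and $v_0\neq v_2$. A graph is $2$-arc-transitive if its automorphism group is transitive on the set of $2$-arcs. *)

(* Defs.v *)
From HB Require Import structures.
From mathcomp Require Import all_boot all_order all_algebra all_fingroup.

Set Implicit Arguments.
Unset Strict Implicit.
Unset Printing Implicit Defensive.

Import GRing.Theory.
Local Open Scope ring_scope.

Record sgraph := SGraph {
  vertex :> finType;
  adj : rel vertex;
  adj_sym : symmetric adj;
  adj_irr : irreflexive adj }.

Definition isomorphic (G H : sgraph) : Prop :=
  exists2 f : G -> H, bijective f & forall x y, adj (f x) (f y) = adj x y.

Definition automorphism (G : sgraph) (f : {perm G}) : Prop :=
  forall x y, adj (f x) (f y) = adj x y.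

Definition two_arc (G : sgraph) (v0 v1 v2 : G) : bool :=
  [&& adj v0 v1, adj v1 v2 & v0 != v2].

Definition two_arc_transitive (G : sgraph) : Prop :=
  forall u0 u1 u2 v0 v1 v2 : G,
    two_arc u0 u1 u2 -> two_arc v0 v1 v2 ->
    exists f : {perm G},
      automorphism f /\ [/\ f u0 = v0, f u1 = v1 & f u2 = v2].

Section Component.
Variables (G : sgraph) (x0 : G).

Definition component_vertex : finType := {x : G | connect (@adj G) x0 x}.

Definition component_adj : rel component_vertex :=
  [rel x y | adj (val x) (val y)].

Lemma component_adj_sym : symmetric component_adj.
Proof. by move=> x y; exact: adj_sym. Qed.

Lemma component_adj_irr : irreflexive component_adj.
Proof. by move=> x; exact: adj_irr. Qed.

Definition component : sgraph := SGraph component_adj_sym component_adj_irr.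

End Component.

Section CPM.
(* 'Z_k denotes Z/kZ only for 1 < k: the graphs below are the intended ones   *)
(* when 2 <= n and 2 <= m * s.                                                *)
Variables (m s n : nat) (r : 'Z_n).

Definition cpm_vertex : finType := ('Z_(m * s) * 'rV['Z_n]_s)%type.

(* r ^+ i * e_l with l = i mod s. Here i is read as its representative in     *)
(* {0, ..., ms - 1}; if r ^+ (m * s) = 1 or -1, any other representative      *)
(* gives the same vector up to sign.                                          *)
Definition cpm_step (i : 'Z_(m * s)) : 'rV['Z_n]_s :=
  \row_(l < s) (if l == (i %% s)%N :> nat then r ^+ i else 0).

Definition cpm_arc : rel cpm_vertex :=
  [rel x y | (y.1 == x.1 + 1) &&
    ((y.2 == x.2 + cpm_step x.1) || (y.2 == x.2 - cpm_step x.1))].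

Definition cpm_adj : rel cpm_vertex := [rel x y | cpm_arc x y || cpm_arc y x].

Lemma cpm_adj_sym : symmetric cpm_adj.
Proof. by move=> x y; exact: orbC. Qed.

Lemma cpm_adj_irr : irreflexive cpm_adj.
Proof.
move=> x; rewrite /cpm_adj [LHS]orbb; apply/negbTE/nandP; left.
by rewrite -{1}[x.1]addr0 (inj_eq (addrI _)) eq_sym oner_eq0.
Qed.

Definition CPMbar : sgraph := SGraph cpm_adj_sym cpm_adj_irr.

Definition CPM : sgraph := component ((0, 0) : CPMbar).

End CPM.

(* Main.v *)
Require Import Defs.
From HB Require Import structures.
From mathcomp Require Import all_boot all_order all_algebra all_fingroup.
From mathcomp Require Import zify ring lra.
From Stdlib Require Import Classical.

Set Implicit Arguments.
Unset Strict Implicit.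
Unset Printing Implicit Defensive.

Import GRing.Theory Num.Theory.
Local Open Scope ring_scope.

(* Vertices are lifted to Z x (Z_n)^s and walks become words over four letters.  *)
(* A 3-arc is alternating if it goes up-down-up or down-up-down. If the graph is *)
(* 2-arc-transitive, then every 2-arc extends to an image of an alternating      *)
(* 3-arc. Either such an image turns exactly once; a reflection of a coordinate  *)
(* then makes all 3-arcs equivalent, and comparing short closed walks through    *)
(* different 3-arcs (all walks of length at most 8 are enumerated) leaves only   *)
(* n = m = 3 if n <> 4; if n = 4 and s = 2, closed 4-walks already give m <= 2.  *)
(* Or every 2-arc extends to exactly one such image; this forces s = 2 and gives *)
(* the edges four labels, alternating along the images of up-down walks, which   *)
(* every automorphism fixing the base vertex permutes. A word in the labels      *)
(* closes up according to its position in Z^4 (letters counted with alternating  *)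
(* signs), and permuting the closed words                                        *)
(* [0 1]^N and [0 2]^a [3 1]^c determines n and r^2 in terms of m. Conversely,   *)
(* for these parameters two words in the labels lead to the same vertex iff      *)
(* their lengths have the same parity and their positions are congruent modulo   *)
(* a fixed N, a condition that is invariant under all permutations of the labels *)
(* and depends on N only.                                                        *)

(** * Automorphisms of a connected component *)

(** Every vertex has two upward and two downward edges, and reflecting one coordinate exchanges the
    two edges of a level that lies in this coordinate. Suppose that the 2-arcs form one orbit. If
    some automorphism takes an alternating 3-arc to one that turns and then goes straight, the
    reflections merge the three extensions of a 2-arc, so that all 3-arcs form one orbit
    ([three_arc_or_zigzag]). Closed walks of a given length through one 3-arc then correspond to
    those through any other. The octagon [commutator_cwalk] exists for all parameters; carried to
    other 3-arcs it forces a small integer, or a short polynomial in r^s with small coefficients, to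
    vanish modulo n. These relations contradict each other ([three_arc_large_s_False],
    [three_arc_small_s_False]), except that [three_arc_n6] leaves n = m = 3, an instance of the case
    of odd n = m.

    Otherwise every 2-arc has exactly one extension that is an image of an alternating 3-arc
    ([zig_ext], [zig_unique]). This forces s = 2 ([zig_s_eq2]) and lets the edges be labelled by
    four labels so that these extensions read a b a ([zig_label]). Automorphisms fixing the base
    vertex act on label words by permuting labels ([label_perm]), and 2-arc-transitivity moves any
    ordered pair of labels to any other ([two_arc_labels]). Permuting a commutator gives 2 (tau - 1)
    = 0 for a suitable tau = +-r^2 ([rigid_tau2]). The end of a label word then depends only on its
    length modulo 2 and its position in Z^4 ([lmvs_formula]), and two families of words determine m,
    n and tau ([closedw_perm_cases]). The value n = 4 is treated apart in [two_arc_transitive_n4].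

    Conversely, for the listed parameters the graph is the quotient of the tree of label words by
    parity and position modulo some N ([pv_cover_odd], [pv_cover_2mod4]). This quotient admits all
    permutations of the labels at every vertex, hence is 2-arc-transitive
    ([pv_cover_two_arc_transitive]). It depends on N only, which gives the isomorphisms for n =
    4. *)

Section ComponentAut.
Variables (G : sgraph) (x0 : G).
Local Notation C := (connect (@adj G) x0).

(* An automorphism of the component, as a map on the vertices of the whole graph. *)
Definition caut (F : G -> G) : Prop :=
  exists2 f : {perm component x0}, automorphism f & forall z, F (val z) = val (f z).

Lemma caut_adj F x y : caut F -> C x -> C y -> adj (F x) (F y) = adj x y.
Proof.
case=> f fA fE Cx Cy.
by rewrite -[x]/(val (Sub x Cx : component x0)) -[y]/(val (Sub y Cy : component x0)) !fE; apply: fA.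
Qed.

Lemma caut_inj F x y : caut F -> C x -> C y -> F x = F y -> x = y.
Proof.
case=> f fA fE Cx Cy.
rewrite -[x]/(val (Sub x Cx : component x0)) -[y]/(val (Sub y Cy : component x0)) !fE.
by move/val_inj/perm_inj->.
Qed.

Lemma caut_comp F F' : caut F -> caut F' -> caut (F' \o F).
Proof.
case=> f fA fE [f' fA' fE']; exists (f * f')%g; first by move=> x y; rewrite !permM fA' fA.
by move=> z /=; rewrite fE fE' permM.
Qed.

Lemma caut_id : caut id.
Proof. by exists 1%g => [x y|z]; rewrite ?perm1. Qed.

Lemma caut_inv F : caut F ->
  exists2 F', caut F' & forall x, C x -> F' (F x) = x.
Proof.
case=> f fA fE.
pose F' x := if insub x is Some z then val ((f^-1)%g (z : component x0)) else x.
exists F'; last first.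
  move=> x Cx; rewrite -[x]/(val (Sub x Cx : component x0)) fE /F' valK.
  by rewrite permK.
exists (f^-1)%g; last by move=> z; rewrite /F' valK.
by move=> x y; rewrite -[LHS]fA !permKV.
Qed.

Lemma connect_adj x y : C x -> adj x y -> C y.
Proof. by move=> Cx /connect1; apply: connect_trans. Qed.

(** Paths go to paths, so once one vertex of the component stays in it, the whole component does. *)
Lemma caut_restrict (h : G -> G) (x : G) :
    injective h -> (forall y z, adj (h y) (h z) = adj y z) ->
  C x -> C (h x) -> caut h.
Proof.
move=> h_inj hA Cx Chx.
have sC := sym_connect_sym (@adj_sym G).
have hC y : C y -> C (h y).
  move=> Cy; apply: connect_trans Chx _; have: connect (@adj G) x y.
    by apply: connect_trans Cy; rewrite sC.
  case/connectP=> p; elim: p x {Cx} => [|z p IH] x /=; first by move=> _ ->.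
  case/andP=> xz pz lz; apply: connect_trans (IH _ pz lz).
  by apply: connect1; rewrite hA.
pose g (z : component x0) : component x0 := Sub (h (val z)) (hC _ (valP z)).
have g_inj : injective g by move=> y z /(congr1 val) /h_inj /val_inj.
exists (perm g_inj) => [y z|z]; rewrite !permE //; exact: hA.
Qed.

Lemma two_arc_transitive_caut (u0 u1 u2 v0 v1 v2 : G) :
    two_arc_transitive (component x0) -> C u1 -> C v1 ->
    two_arc u0 u1 u2 -> two_arc v0 v1 v2 ->
  exists2 F, caut F & [/\ F u0 = v0, F u1 = v1 & F u2 = v2].
Proof.
move=> tG Cu1 Cv1 /and3P[u01 u12 u02] /and3P[v01 v12 v02].
have Cu0 : C u0 by apply: connect_adj Cu1 _; rewrite adj_sym.
have Cu2 : C u2 by apply: connect_adj Cu1 _.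
have Cv0 : C v0 by apply: connect_adj Cv1 _; rewrite adj_sym.
have Cv2 : C v2 by apply: connect_adj Cv1 _.
pose u := fun x (Cx : C x) => Sub x Cx : component x0.
have uarc : two_arc (u _ Cu0) (u _ Cu1) (u _ Cu2) by apply/and3P.
have varc : two_arc (u _ Cv0) (u _ Cv1) (u _ Cv2) by apply/and3P.
have [f [fA [f0 f1 f2]]] := tG _ _ _ _ _ _ uarc varc.
pose F x := if insub x is Some z then val (f (z : component x0)) else x.
have FE z : F (val z) = val (f z) by rewrite /F valK.
exists F; first by exists f.
by split; [rewrite -[u0]/(val (u _ Cu0)) FE f0 | rewrite -[u1]/(val (u _ Cu1)) FE f1
  | rewrite -[u2]/(val (u _ Cu2)) FE f2].
Qed.

End ComponentAut.

(** * Words and the enumeration of short closed walks *)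

Lemma intr_Zp_eq0 (n : nat) (c : int) : (1 < n)%N -> (c%:~R == 0 :> 'Z_n) = (n %| `|c|)%N.
Proof.
move=> n_gt1; have natE (k : nat) : (k%:R == 0 :> 'Z_n) = (n %| k)%N.
  by rewrite -val_eqE /= val_Zp_nat.
by case: c => k; rewrite ?NegzE ?mulrNz ?oppr_eq0 /= -?pmulrn natE // abszN.
Qed.

Definition sg (e : bool) : int := if e then 1 else -1.

Lemma sgN e : sg (~~ e) = - sg e. Proof. by case: e. Qed.

(* A letter (up, plus): one step along an edge, in the direction of increasing *)
(* level iff [up], adding the step vector iff [plus].                         *)
Notation letter := (bool * bool)%type.

(** Crossing the same edge backwards reverses both the direction and the sign. *)
Definition linv (a : letter) : letter := (~~ a.1, ~~ a.2).

(** An edge between levels k and k + 1 has level k, from whichever end it is read. *)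
Definition elev (k : int) (up : bool) : int := k - (~~ up)%:Z.

Lemma exprz_pm1 (R : unitRingType) (x : R) (q : int) :
  x = 1 \/ x = -1 -> x ^ q = 1 \/ x ^ q = -1.
Proof.
case=> ->; first by rewrite exp1rz; left.
case: q => q; rewrite ?NegzE -?exprz_inv ?invrN1 -exprnP -signr_odd;
  by case: odd; rewrite ?expr0 ?expr1; [right|left].
Qed.

Definition nb (a b : letter) := b != linv a.
Definition redw (w : seq letter) := sorted nb w.
(** The other edge in the same direction, which a reflection of the coordinate of the edge exchanges
    with it. *)
Definition lbar (a : letter) : letter := (a.1, ~~ a.2).

Fixpoint levels (k : int) (w : seq letter) : seq int :=
  if w is a :: w' then elev k a.1 :: levels (k + sg a.1) w' else [::].

Definition net (w : seq letter) : int := foldr (fun a z => sg a.1 + z) 0 w.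

Lemma redw2 a b : nb a b -> redw [:: a; b].
Proof. by rewrite /redw /= andbT. Qed.

Lemma redw3 a b c : nb a b -> nb b c -> redw [:: a; b; c].
Proof. by rewrite /redw /= andbT => -> ->. Qed.

Lemma linvK : involutive linv.
Proof. by case=> [[] []]. Qed.

Fixpoint words (k : nat) : seq (seq letter) :=
  if k is k'.+1 then
    flatten [seq [seq a :: w | w <- words k'] |
      a <- [:: (true, true); (true, false); (false, true); (false, false)]]
  else [:: [::]].

Lemma mem_words w : w \in words (size w).
Proof.
elim: w => // a w IH; apply/flatten_mapP; exists a; last by rewrite mem_map // => ? ? [].
by case: a => [[] []].
Qed.

Lemma words_all (P : seq letter -> bool) k : all P (words k) -> forall w, size w = k -> P w.
Proof. by move=> /allP H w sw; apply: H; rewrite -sw mem_words. Qed.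

(* The levels of the edges crossed by a walk, with the signs of the crossings. *)
Fixpoint crossings (k : int) (w : seq letter) : seq (int * bool) :=
  if w is a :: w' then (elev k a.1, a.2) :: crossings (k + sg a.1) w' else [::].

Definition coef (c : seq (int * bool)) (j : int) : int :=
  foldr (fun z acc => (if z.1 == j then sg z.2 else 0) + acc) 0 c.

Fixpoint dropz (L : seq int) := if L is c :: L' then if c == 0 then dropz L' else L else [::].

Definition trim (L : seq int) := dropz (rev (dropz (rev L))).

(* The coefficients of the levels congruent to [l] modulo [s], from level [l - 8 s] on. *)
Definition coefs (s : nat) (w : seq letter) (l : nat) : seq int :=
  [seq coef (crossings 0 w) (l%:Z + s%:Z * (i%:Z - 8)) | i <- iota 0 17].

Definition shape s w l := trim (coefs s w l).

(* A closed walk makes the polynomial with coefficients [coefs s w l] vanish at *)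
(* r^s, for every coordinate l; [trim] only removes a power of the variable.    *)
Definition shape_in (s : nat) (w : seq letter) (S : seq (seq int)) :=
  has (fun l => shape s w l \in S) (iota 0 s).

Definition pm1 : seq int := [:: 1; -1].
Definition scal (c : int) : seq (seq int) := [:: [:: c]; [:: - c]].
Definition pair2 (c d : int) : seq (seq int) :=
  [:: [:: c; d]; [:: c; - d]; [:: - c; d]; [:: - c; - d]].
Definition triple1 : seq (seq int) :=
  [seq x :: p | x <- pm1, p <- pair2 1 1].

(** For S <= s, distinct levels at distance less than S lie in different coordinates, so in a closed
    walk n divides the coefficient of the chosen level ([cwalk_single]). *)
Definition single_level (S : nat) (w : seq letter) (cs : seq int) :=
  let c := crossings 0 w in
  has (fun z => all (fun y => (y.1 == z.1) || (`|y.1 - z.1| < S)%N) c && (coef c z.1 \in cs)) c.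

(** What the word alone tells about not backtracking at the base point: for nonzero net level the
    first and last edges have different lifted base points and are not compared. *)
Definition closed0 (w : seq letter) : bool :=
  (net w != 0) || (head (true, true) w != linv (last (true, true) w)).

Notation Up := (true, true).
Notation Dn := (false, true).
Definition UDU := [:: Up; Dn; Up].
Definition UUU := [:: Up; Up; Up].

(** Integers that cannot vanish modulo n when n >= 3 and n <> 4 ([small_dvd]). *)
Definition small : seq int := [:: 1; -1; 2; -2; 4; -4].
Definition smalls : seq (seq int) := [seq [:: c] | c <- small].

(** The exceptional word stays on one level of edges and adds 8 times the same step vector, so it
    closes only if n divides 8. *)
Lemma UDU_net0 v : size v = 5%N -> redw (UDU ++ v) -> closed0 (UDU ++ v) -> net (UDU ++ v) = 0 ->
  single_level 3 (UDU ++ v) small \/ v = [:: Dn; Up; Dn; Up; Dn].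
Proof.
move=> sv rw cl nt; suff: single_level 3 (UDU ++ v) small || (v == [:: Dn; Up; Dn; Up; Dn]).
  by case/orP=> [->|/eqP]; [left|right].
apply: (implyP _ (introT and3P (And3 rw cl (introT eqP nt)))); move: v sv {rw cl nt}.
by apply: words_all; vm_compute.
Qed.

Definition all_walks (N : nat) (u : seq letter) (P : seq letter -> bool) :=
  all (fun v => redw (u ++ v) && closed0 (u ++ v) ==> P (u ++ v)) (words (N - size u)).

Lemma all_walksP N u P v : all_walks N u P ->
  size (u ++ v) = N -> redw (u ++ v) -> closed0 (u ++ v) -> P (u ++ v).
Proof.
move=> /words_all H suv rw cl; have /H : size v = (N - size u)%N by rewrite -suv size_cat addKn.
by rewrite rw cl.
Qed.

(** The second alternative means r^3 = +-1 and r^3 = +-3 at once, which makes 2 or 4 vanish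
    ([pair_small]). *)
Lemma UDU_wrap3 : all_walks 8 UDU (fun w => ((net w != 0) && (3 %| `|net w|)%N) ==>
   (shape_in 3 w smalls || (shape_in 3 w (pair2 1 1) && shape_in 3 w (pair2 3 1)))).
Proof. by vm_compute. Qed.

Lemma UDU_wrap456 s : s \in [:: 4; 5; 6]%N -> all_walks 8 UDU (fun w => ((net w != 0) && (s %| `|net w|)%N) ==>
   shape_in s w smalls).
Proof. by rewrite !inE => /or3P[]/eqP->; vm_compute. Qed.

Lemma UUUD_net0 : all_walks 8 (UUU ++ [:: Dn]) (fun w => (net w == 0) ==> single_level 4 w small).
Proof. by vm_compute. Qed.

Lemma UUUD_wrap s : s \in [:: 4; 5; 6; 7; 8]%N -> all_walks 8 (UUU ++ [:: Dn])
  (fun w => ((net w != 0) && (s %| `|net w|)%N) ==> shape_in s w smalls).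
Proof. by rewrite !inE => /or3P[/eqP->|/eqP->|/or3P[]/eqP->]; vm_compute. Qed.

Lemma UDU8_0 : all_walks 8 UDU (fun w => (net w == 0) ==>
  shape_in 2 w (smalls ++ pair2 4 2 ++ pair2 2 4 ++ scal 8)).
Proof. by vm_compute. Qed.

Lemma UDU8_4 : all_walks 8 UDU (fun w => (`|net w|%N == 4%N) ==>
  shape_in 2 w (smalls ++ pair2 1 1 ++ pair2 3 1 ++ pair2 1 3)).
Proof. by vm_compute. Qed.

Lemma UDU8_6 : all_walks 8 UDU (fun w => (`|net w|%N == 6%N) ==> shape_in 2 w (smalls ++ triple1)).
Proof. by vm_compute. Qed.

Lemma UUU8_0 x : all_walks 8 [:: Up; Up; (true, x)] (fun w => (net w == 0) ==>
  shape_in 2 w (smalls ++ [:: [:: 2; 2 * sg x]; [:: 2; 4 * sg x]; [:: 4; 2 * sg x]])).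
Proof. by case: x; vm_compute. Qed.

Lemma UUU8_6 x : all_walks 8 [:: Up; Up; (true, x)]
  (fun w => (`|net w|%N == 6%N) ==> shape_in 2 w (smalls ++ triple1)).
Proof. by case: x; vm_compute. Qed.

Lemma UUU4 : all_walks 4 UUU (fun w => single_level 3 w [:: 1; -1]).
Proof. by vm_compute. Qed.

Lemma UU4 : all_walks 4 [:: Up; Up] (fun w => (net w == 0) ==> shape_in 2 w (scal 1 ++ scal 2)).
Proof. by vm_compute. Qed.

Lemma UDU4 : all_walks 4 UDU (fun w => shape_in 2 w smalls).
Proof. by vm_compute. Qed.

Lemma UDU6_0 : all_walks 6 UDU (fun w => (net w == 0) ==> shape_in 2 w (smalls ++ scal 6)).
Proof. by vm_compute. Qed.

Lemma UDU6_4 : all_walks 6 UDU (fun w => (`|net w|%N == 4%N) ==> shape_in 2 w (smalls ++ pair2 1 1)).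
Proof. by vm_compute. Qed.

Lemma UUU6_0 : all_walks 6 UUU (fun w => (net w == 0) ==> shape_in 2 w (smalls ++ [:: [:: 2; 2]])).
Proof. by vm_compute. Qed.

Lemma UUU6_6 : all_walks 6 UUU (fun w => (`|net w|%N == 6%N) ==> (shape_in 2 w [:: [:: 1; 1; 1]; [:: 1; 1; -1]])).
Proof. by vm_compute. Qed.

Lemma UUU8_8 x : all_walks 8 [:: Up; Up; (true, x)] (fun w => (`|net w|%N == 8%N) ==>
  shape_in 2 w [seq [:: 1; sg x] ++ p | p <- pair2 1 1]).
Proof. by case: x; vm_compute. Qed.

Definition net_le (N : nat) (w : seq letter) := (`|net w| <= N)%N && ~~ odd (`|net w| + size w).

Lemma net_bound w : net_le (size w) w.
Proof.
rewrite /net_le; elim: w => //= a w /andP[IH1 IH2].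
by case: a => [[] b]; rewrite /sg /=; apply/andP; split; lia.
Qed.

Lemma net_UDU v : net (UDU ++ v) = 1 + net v.
Proof. by rewrite /net /=; rewrite /sg; lia. Qed.

Lemma net_UDU_le v : (`|net (UDU ++ v)| <= (size v).+1)%N.
Proof. by rewrite net_UDU; case/andP: (net_bound v); lia. Qed.

(* The position of a word in Z^4: its letters are added with alternating signs. *)
Fixpoint pv (w : seq letter) (c : letter) : int :=
  if w is a :: w' then (a == c)%:Z - pv w' c else 0.

Definition psign (b : bool) (z : int) : int := if b then - z else z.

Lemma pv_cat w w' c : pv (w ++ w') c = pv w c + psign (odd (size w)) (pv w' c).
Proof.
elim: w => [|a w IH] /=; first by rewrite add0r.
by rewrite IH /psign; case: odd => /=; rewrite ?opprD ?opprK ?addrA.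
Qed.

Lemma pv_rcons w a c : pv (rcons w a) c = pv w c + psign (odd (size w)) (a == c)%:Z.
Proof. by rewrite -cats1 pv_cat /= subr0. Qed.

(** Half the level reached, for a word of even length ([lmvs_formula]). *)
Definition qv (w : seq letter) : int := pv w (false, true) + pv w (false, false).

Definition parity (k : int) : bool := odd `|k|%N.

Lemma parityD1 k : parity (k + 1) = ~~ parity k.
Proof. by rewrite /parity; lia. Qed.

Lemma parityB1 k : parity (k - 1) = ~~ parity k.
Proof. by rewrite -{2}[k](subrK 1) parityD1 negbK. Qed.

Lemma parity_sg k u : parity (k + sg u) = ~~ parity k.
Proof. by case: u; rewrite /sg ?parityD1 ?parityB1. Qed.

Lemma sg_eqb a b : sg (a == b) = sg b * sg a.
Proof. by case: a b => [] []. Qed.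

Lemma parity_even (q : int) : parity (2 * q) = false.
Proof. by rewrite /parity abszM oddM. Qed.

Lemma parity_odd (q : int) : parity (2 * q - 1) = true.
Proof. by rewrite parityB1 parity_even. Qed.

Lemma elev_shift k d u : elev (k + d + d) u = elev k u + d + d.
Proof. by rewrite /elev; lia. Qed.

(** [sg (kap kappa j)] is the power of [sg kappa] with exponent floor(j / 2); this twist turns the
    sign rule of [zig_ratio] into the repetition of a label. *)
Definition kap (kappa : bool) (j : int) : bool := kappa || ~~ parity (j %/ 2)%Z.

(* The four edges at a vertex are labelled consistently at both ends: a label (b, e) *)
(* tells the parity of the level of the edge and, up to the sign [kap] of that level, *)
(* the sign of the step read from the end of even level.                             *)
Definition lab (kappa : bool) (k : int) (c : letter) : letter :=
  let up := c.1 == parity k in (up, (c.2 == kap kappa (elev k up)) (+) parity k).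

Fixpoint labw (kappa : bool) (k : int) (w : seq letter) : seq letter :=
  if w is c :: w' then lab kappa k c :: labw kappa (k + sg (lab kappa k c).1) w' else [::].

Definition zigzag (k : nat) (a b : letter) : seq letter := flatten (nseq k [:: a; b]).

Lemma pv_zigzag k a b c : pv (zigzag k a b) c = k%:Z * ((a == c)%:Z - (b == c)%:Z).
Proof. by elim: k => [|k IH]; rewrite ?mul0r //= -/(zigzag _ _ _) IH; lia. Qed.

Lemma size_zigzag k a b : size (zigzag k a b) = (2 * k)%N.
Proof. by elim: k => // k IH; rewrite /= -/(zigzag _ _ _) IH; lia. Qed.

Lemma map_zigzag (f : letter -> letter) k a b : map f (zigzag k a b) = zigzag k (f a) (f b).
Proof. by rewrite /zigzag map_flatten map_nseq. Qed.

(** * Polynomial relations and arithmetic modulo n *)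

Section Heval.
Variables (R : comUnitRingType) (t : R).

Definition heval (L : seq int) : R := foldr (fun c acc => c%:~R + t * acc) 0 L.

Lemma heval_iota f a N : heval [seq f i | i <- iota a N] = \sum_(i < N) (f (a + i)%N)%:~R * t ^+ i.
Proof.
elim: N a => [|N IH] a; first by rewrite big_ord0.
rewrite /= IH big_ord_recl addn0 expr0 mulr1 mulr_sumr; congr (_ + _).
by apply: eq_bigr => i _; rewrite exprS /= addSnnS mulrCA.
Qed.

Lemma heval_rcons0 L : heval (rcons L 0) = heval L.
Proof. by elim: L => [|c L IH] /=; rewrite ?mulr0 ?addr0 ?IH. Qed.

Lemma heval_trim L : t \is a GRing.unit -> (heval (trim L) == 0) = (heval L == 0).
Proof.
move=> ut; have dropE M : (heval (dropz M) == 0) = (heval M == 0).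
  elim: M => //= c M IH; case: (c =P 0) => [->|//]; rewrite IH add0r.
  apply/eqP/eqP => [->|]; first by rewrite mulr0.
  by move/(congr1 ( *%R t^-1)); rewrite mulrA mulVr // mul1r mulr0.
rewrite /trim dropE; congr (_ == 0); elim/last_ind: L => // L c IH.
rewrite rev_rcons /=; case: (c =P 0) => [->|_]; first by rewrite heval_rcons0.
by rewrite rev_cons revK.
Qed.

Lemma heval1 c : heval [:: c] = c%:~R.
Proof. by rewrite /heval /= mulr0 addr0. Qed.

Lemma heval_pair2 a b L : L \in pair2 a b -> heval L = 0 ->
  b%:~R * t = a%:~R \/ b%:~R * t = - a%:~R.
Proof.
have E x y : heval [:: x; y] = 0 -> y%:~R * t = - x%:~R.
  by rewrite /heval /= mulr0 addr0 addrC => /eqP; rewrite addr_eq0 mulrC => /eqP.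
rewrite !inE => /or4P[]/eqP-> /E; rewrite ?intrN ?mulNr ?opprK => H.
- by right.
- by left; apply: oppr_inj.
- by left.
- by right; rewrite -H opprK.
Qed.

End Heval.

Arguments heval {R} t L : simpl never.

Lemma crossings_bound k w z : z \in crossings k w -> (`|z.1| <= `|k| + size w)%N.
Proof.
elim: w k => //= a w IH k; rewrite inE => /predU1P[->|/IH] /=;
  case: a => [[] b]; rewrite /elev /sg /=; lia.
Qed.

Lemma coef_bigE c j : coef c j = \sum_(z <- c) (if z.1 == j then sg z.2 else 0).
Proof. by elim: c => [|z c IH]; rewrite ?big_nil // big_cons /= IH. Qed.

Section Relations.
Variables (R : comNzRingType) (y : R).
Hypothesis yAB : 4%:~R * y = 2%:~R \/ 2%:~R * y = 4%:~R.

(** The hypothesis says that y behaves like 1/2 or like 2. Substituting this into an equation for y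
    and clearing denominators leaves an integer that vanishes; the other relations below follow in
    the same way. *)
Lemma rel_sqr : y ^+ 2 = 1 \/ y ^+ 2 = -1 -> 12%:~R = 0 :> R \/ 20%:~R = 0 :> R.
Proof.
have E : 16%:~R * y ^+ 2 = 4%:~R \/ 4%:~R * y ^+ 2 = 16%:~R.
  case: yAB => E; [left|right].
    by transitivity ((4%:~R * y) * (4%:~R * y)); [ring | rewrite E; ring].
  by transitivity ((2%:~R * y) * (2%:~R * y)); [ring | rewrite E; ring].
case=> y2; rewrite y2 in E; [left|right].
  case: E => E.
    by transitivity (16%:~R * 1 - 4%:~R : R); [ring | rewrite E subrr].
  by transitivity (16%:~R - 4%:~R * 1 : R); [ring | rewrite E subrr].
case: E => E.
  by transitivity (4%:~R - 16%:~R * -1 : R); [ring | rewrite E subrr].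
by transitivity (16%:~R - 4%:~R * -1 : R); [ring | rewrite E subrr].
Qed.

Lemma rel_12 : 12%:~R = 0 :> R -> 6%:~R = 0 :> R \/ 6%:~R * y = 0.
Proof.
move=> E; case: yAB => H; [left|right].
  by transitivity (3%:~R * (4%:~R * y)); [rewrite H; ring | transitivity (12%:~R * y); [ring | rewrite E mul0r]].
by transitivity (3%:~R * (2%:~R * y)); [ring | rewrite H -[RHS]E; ring].
Qed.

Lemma rel_20 : 20%:~R = 0 :> R -> 10%:~R = 0 :> R \/ 10%:~R * y = 0.
Proof.
move=> E; case: yAB => H; [left|right].
  by transitivity (5%:~R * (4%:~R * y)); [rewrite H; ring | transitivity (20%:~R * y); [ring | rewrite E mul0r]].
by transitivity (5%:~R * (2%:~R * y)); [ring | rewrite H -[RHS]E; ring].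
Qed.

Lemma rel_24 : 2%:~R + 4%:~R * y = 0 -> 4%:~R = 0 :> R \/ 10%:~R = 0 :> R.
Proof.
move=> E; case: yAB => H; [left|right]; rewrite -[RHS]E.
  by rewrite H; ring.
by transitivity (2%:~R + 2%:~R * (2%:~R * y)); [rewrite H; ring | ring].
Qed.

Lemma rel_42 : 4%:~R + 2%:~R * y = 0 -> 10%:~R = 0 :> R \/ 8%:~R = 0 :> R.
Proof.
move=> E; case: yAB => H; [left|right].
  transitivity (2%:~R * (4%:~R + 2%:~R * y)); last by rewrite E mulr0.
  by transitivity (8%:~R + 4%:~R * y); [rewrite H; ring | ring].
by rewrite -[RHS]E H; ring.
Qed.

Lemma rel_cubic (b c : bool) : 1 + y + (sg b)%:~R * y ^+ 2 + (sg c)%:~R * y ^+ 3 = 0 ->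
  (24 + 4 * sg b + 2 * sg c)%:~R = 0 :> R \/ (6 + 8 * sg b + 16 * sg c)%:~R = 0 :> R.
Proof.
rewrite !intrD !intrM; move: (sg b)%:~R (sg c)%:~R => B D E.
case: yAB => H; [left|right].
  rewrite -[RHS](mulr0 16%:~R) -E.
  transitivity (16%:~R + 4%:~R * (4%:~R * y) + B * ((4%:~R * y) * (4%:~R * y)) +
    D * (((4%:~R * y) * (4%:~R * y)) * y)); last by ring.
  rewrite H; transitivity (24%:~R + 4%:~R * B + D * (4%:~R * y)); last by ring.
  by rewrite H; ring.
rewrite -[RHS](mulr0 2%:~R) -E.
transitivity (2%:~R + (2%:~R * y) + B * ((2%:~R * y) * y) + D * (((2%:~R * y) * y) * y)); last by ring.
rewrite H; transitivity (6%:~R + 2%:~R * (2%:~R * y) * B + D * (2%:~R * (2%:~R * y) * y)); last by ring.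
rewrite H; transitivity (6%:~R + 8%:~R * B + D * (4%:~R * (2%:~R * y))); last by ring.
by rewrite H; ring.
Qed.

Lemma rel_fourth : y ^+ 4 = 1 \/ y ^+ 4 = -1 -> 30%:~R = 0 :> R \/ 34%:~R = 0 :> R.
Proof.
have y32 : 32%:~R * y ^+ 4 = 2%:~R \/ 2%:~R * y ^+ 4 = 32%:~R.
  case: yAB => H; [left|right].
    transitivity (2%:~R * ((4%:~R * y) * (4%:~R * y)) * y * y); first by ring.
    rewrite H; transitivity (2%:~R * (4%:~R * y) * y); first by ring.
    by rewrite H; transitivity (4%:~R * y); [ring | ].
  transitivity ((2%:~R * y) * y * y * y); first by ring.
  rewrite H; transitivity (2%:~R * (2%:~R * y) * y * y); first by ring.
  rewrite H; transitivity (4%:~R * (2%:~R * y) * y); first by ring.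
  by rewrite H; transitivity (8%:~R * (2%:~R * y)); [ring | rewrite H; ring].
case=> y4; rewrite y4 in y32; [left|right].
  case: y32 => E.
    by transitivity (32%:~R * 1 - 2%:~R : R); [ring | rewrite E subrr].
  by transitivity (32%:~R - 2%:~R * 1 : R); [ring | rewrite E subrr].
case: y32 => E.
  by transitivity (2%:~R - 32%:~R * -1 : R); [ring | rewrite E subrr].
by transitivity (32%:~R - 2%:~R * -1 : R); [ring | rewrite E subrr].
Qed.

End Relations.

Lemma exprN1z (R : unitRingType) (i : int) : (-1) ^ i = (sg (~~ odd `|i|%N))%:~R :> R.
Proof.
case: i => k; rewrite ?NegzE -?exprz_inv ?invrN1 -exprnP -signr_odd ?abszN absz_nat;
  by case: odd; rewrite ?expr0 ?expr1 ?mulrN1z.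
Qed.

Lemma unit_Zp_odd n (x : 'Z_n) : (1 < n)%N -> ~~ odd n -> x \is a GRing.unit ->
  exists k, x = (2 * k + 1)%:R.
Proof.
move=> n_gt1 en ux; exists (x : nat)./2.
have : coprime n x by rewrite -unitZpE // natr_Zp.
move=> cnx; have ox : odd x.
  apply: contraLR cnx => ex; apply/negP => /eqP g1.
  by have : (2 %| gcdn n x)%N; [rewrite dvdn_gcd !dvdn2 en ex | rewrite g1].
by rewrite -{1}[x]natr_Zp -{1}(odd_double_half x) ox -mul2n addnC.
Qed.

Lemma Zp_double0_odd n (x : 'Z_n) : (1 < n)%N -> odd n -> x *+ 2 = 0 -> x = 0.
Proof.
move=> n_gt1 on x2.
have nE : n = (2 * n./2 + 1)%N by rewrite mul2n -[LHS]odd_double_half on addnC.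
have : x *+ n = 0.
  rewrite -mulr_natr -[n%:R]/(n%:~R); have /eqP -> : (n%:~R == 0 :> 'Z_n) by rewrite intr_Zp_eq0.
  by rewrite mulr0.
by rewrite [X in _ *+ X]nE mulrnDr mulrnA x2 mul0rn add0r.
Qed.

(** For odd n the factor 2 cancels and T = 1. For even n a unit is odd, so T - 1 = 2 k and (T - 1)^2
    = 2 (T - 1) k = 0. *)
Lemma double_sub1_sqr n (T : 'Z_n) : (1 < n)%N -> T \is a GRing.unit -> (T - 1) *+ 2 = 0 -> T ^+ 2 = 1.
Proof.
move=> n_gt1 uT T2; suff u2 : (T - 1) * (T - 1) = 0.
  transitivity ((T - 1) * (T - 1) + (T - 1) *+ 2 + 1); first by ring.
  by rewrite u2 T2 !add0r.
have [on|en] := boolP (odd n); first by rewrite (Zp_double0_odd n_gt1 on T2) mulr0.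
have [k kE] := unit_Zp_odd n_gt1 en uT.
have uE : T - 1 = k%:R *+ 2 by rewrite kE natrD addrK natrM mulr_natl.
by rewrite {2}uE mulrnAr -mulrnAl T2 mul0r.
Qed.

Lemma unit_Z4_sqr n (x : 'Z_n) : n = 4%N -> x \is a GRing.unit -> 1 + x ^+ 2 = 2%:R.
Proof.
by move=> n4; subst n => ux; apply/eqP; case: x ux => [[|[|[|[|]]]] //] lt_x; vm_compute.
Qed.

Lemma pm1_expM (R : nzRingType) (x y : R) k : x = 1 \/ x = -1 -> y = 1 \/ y = -1 ->
  x ^+ k * y = 1 \/ x ^+ k * y = -1.
Proof.
case=> -> [] ->; rewrite ?expr1n ?mul1r ?mulr1; try by [left|right].
  by rewrite -signr_odd; case: odd; [right|left].
by rewrite -signr_odd; case: odd; rewrite ?mulrNN ?mul1r; [left|right].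
Qed.

(** * Closed words whose closedness is invariant under permutations of the labels *)

Section ClosedWords.
Variables (m n : nat) (r : 'Z_n) (kappa : bool).
Hypotheses (m_gt0 : (0 < m)%N) (n_ge3 : (3 <= n)%N) (n4 : n != 4%N).
Hypotheses (r_unit : r \is a GRing.unit) (r_m2 : r ^+ (m * 2) = 1 \/ r ^+ (m * 2) = -1).
Local Notation t := ((sg kappa)%:~R * r ^+ 2 : 'Z_n).
Local Notation u := (t - 1).
Hypothesis u2 : u *+ 2 = 0.

Local Notation l0 := (false, true).
Local Notation l1 := (false, false).
Local Notation l2 := (true, true).
Local Notation l3 := (true, false).

(** The criterion of [lmvs_closed] for a label word of even length to return to the base vertex. *)
Definition closedw (w : seq letter) :=
  [/\ (m %| qv w)%Z, (pv w l0 - pv w l1)%:~R + u *~ (qv w %/ 2)%Z = 0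
    & (pv w l2 - pv w l3)%:~R + u *~ (qv w %/ 2)%Z = 0].

Hypothesis closedw_perm : forall a b a' b', a != b -> a' != b' ->
  exists pi : letter -> letter, [/\ injective pi, pi a = a', pi b = b'
    & forall w, ~~ odd (size w) -> closedw w -> closedw (map pi w)].

Let n_gt1 : (1 < n)%N. Proof. exact: ltnW. Qed.

(* The least positive integer whose double vanishes modulo n. *)
Let N := if odd n then n else n./2.

Lemma half_mod (z : int) : ((2 * z)%:~R == 0 :> 'Z_n) = (N %| z)%Z.
Proof.
rewrite intr_Zp_eq0 ?n_gt1 // abszM dvdzE /= /N; case: ifP => on.
  by rewrite Gauss_dvdr // coprime_sym prime_coprime // dvdn2 on.
by rewrite -{1}[n]odd_double_half on -mul2n dvdn_pmul2l.
Qed.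

Lemma N_even : ~~ odd n -> n = (2 * N)%N.
Proof. by move=> en; rewrite /N (negbTE en) mul2n even_halfK. Qed.

Lemma N_gt0 : (0 < N)%N.
Proof. by clear -n_ge3; rewrite /N; case: ifP => _; lia. Qed.

Lemma u_cases : u = 0 \/ ~~ odd n /\ u = N%:~R.
Proof.
have [on|en] := boolP (odd n); first by left; apply: Zp_double0_odd u2.
have [k uE] : exists k : nat, u = k%:~R by exists (u : nat); rewrite -pmulrn natr_Zp.
have : (N %| k%:Z)%Z by rewrite -half_mod intrM -uE mulrC mulr_natr u2.
rewrite dvdzE /= => /dvdnP[j kE]; rewrite uE kE.
have nz i : ((i * n)%N%:~R = 0 :> 'Z_n) by apply/eqP; rewrite intr_Zp_eq0 ?n_gt1 // absz_nat dvdn_mull.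
have := odd_double_half j; case: (odd j) => <-; [right; split=> //|left].
  rewrite mulnDl mul1n -muln2 -mulnA -(N_even en) PoszD intrD nz addr0 //.
by rewrite add0n -muln2 -mulnA -(N_even en) nz.
Qed.

Lemma pv_zigzag2 a b c d (x y : nat) z : pv (zigzag x a b ++ zigzag y c d) z =
  x%:Z * ((a == z)%:Z - (b == z)%:Z) + y%:Z * ((c == z)%:Z - (d == z)%:Z).
Proof. by rewrite pv_cat size_zigzag mul2n odd_double !pv_zigzag. Qed.

Lemma closedw_zigzag01 : closedw (zigzag N l0 l1).
Proof.
have p c : pv (zigzag N l0 l1) c = N%:Z * ((l0 == c)%:Z - (l1 == c)%:Z) by rewrite pv_zigzag.
have p0 : pv (zigzag N l0 l1) l0 = N by rewrite p mulr1.
have p1 : pv (zigzag N l0 l1) l1 = - N%:Z by rewrite p mulrN1.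
have p2 : pv (zigzag N l0 l1) l2 = 0 by rewrite p mulr0.
have p3 : pv (zigzag N l0 l1) l3 = 0 by rewrite p mulr0.
rewrite /closedw /qv p0 p1 p2 p3 subrr div0z mulr0z opprK !addr0.
split; [exact: dvdz0 | | by []].
by apply/eqP; rewrite -(_ : 2 * N%:Z = N%:Z + N%:Z) ?half_mod ?dvdzz //; lia.
Qed.

(** [0 1]^N moves along one coordinate only and closes because 2 N = 0. A permutation of labels
    sends it to [0 2]^N, which climbs 2 N levels, and its closing conditions are these. *)
Lemma closedw_zigzag02 : (m %| N)%N /\ N%:~R + u *~ (N %/ 2)%Z = 0.
Proof.
have [pi [_ pi0 pi1 piw]] := closedw_perm (isT : l0 != l1) (isT : l0 != l2).
have := piw _ _ closedw_zigzag01; rewrite map_zigzag pi0 pi1 size_zigzag mul2n odd_double => /(_ isT).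
have p c : pv (zigzag N l0 l2) c = N%:Z * ((l0 == c)%:Z - (l2 == c)%:Z) by rewrite pv_zigzag.
have p0 : pv (zigzag N l0 l2) l0 = N by rewrite p mulr1.
have p1 : pv (zigzag N l0 l2) l1 = 0 by rewrite p mulr0.
by rewrite /closedw /qv p0 p1 !addr0; case=> mN X _.
Qed.

(** The unit tau is odd, so N = tau - 1 is even. Then N + u (N / 2) = 0 reads N (1 + N / 2) = 0
    modulo 2 N, so N / 2 is odd. If m were odd, tau = tau^m = +-1 would give N = 0 modulo n or n
    dividing 4. *)
Lemma u_N : u = N%:~R -> ~~ odd n -> ~~ odd m /\ N = 2 %[mod 4].
Proof.
move=> uN en; have nE := N_even en; have [mN X] := closedw_zigzag02.
have ut : t \is a GRing.unit.
  by rewrite unitrM unitrX // andbT; case: (kappa); rewrite /sg ?unitr1 ?unitrN1.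
have [k tE] := unit_Zp_odd n_gt1 en ut.
have eN : ~~ odd N.
  have : (2 * k%:Z - N%:Z)%:~R == 0 :> 'Z_n.
    by rewrite intrB -uN tE natrD addrK subr_eq0 natrM intrM.
  rewrite intr_Zp_eq0 // => nd.
  have : (2 %| 2 * k%:Z - N%:Z)%Z by rewrite dvdzE; apply: dvdn_trans nd; rewrite dvdn2.
  by clear; lia.
have N4 : N = 2 %[mod 4].
  have : (N%:Z + N%:Z * (N%:Z %/ 2)%Z)%:~R == 0 :> 'Z_n.
    by rewrite intrD intrM -[in X in _ + X]uN mulrzr X.
  rewrite intr_Zp_eq0 // {1}nE.
  have -> : (N%:Z + N%:Z * (N%:Z %/ 2)%Z) = N%:Z * (1 + (N%:Z %/ 2)%Z) by rewrite mulrDr mulr1.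
  by rewrite abszM mulnC dvdn_pmul2l ?N_gt0 //; clear -eN; lia.
split=> //; apply/negP => om.
have t2 : t ^+ 2 = 1 by apply: double_sub1_sqr.
have tm : t ^+ m = t by rewrite -[m]odd_double_half om -mul2n exprD exprM t2 expr1n mulr1 expr1.
have sg1 : (sg kappa)%:~R = 1 :> 'Z_n \/ (sg kappa)%:~R = -1 :> 'Z_n.
  by case: (kappa); rewrite /sg; [left|right].
have : t = 1 \/ t = -1.
  have tmE : t = (sg kappa)%:~R ^+ m * r ^+ (m * 2) by rewrite -{1}tm exprMn -exprM mulnC.
  by rewrite tmE; apply: pm1_expM sg1 r_m2.
case=> t1.
  move: uN; rewrite t1 subrr => /esym/eqP; rewrite intr_Zp_eq0 // absz_nat => /dvdn_leq-/(_ N_gt0).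
  by rewrite {1}nE; have := N_gt0; lia.
have /eqP : (- 4)%:~R = 0 :> 'Z_n by rewrite -u2 t1; ring.
by rewrite intr_Zp_eq0 //= => /dvdn_leq-/(_ isT); clear -en n4 n_ge3; lia.
Qed.

Lemma mN_parity : odd m = odd N.
Proof.
have [mN X] := closedw_zigzag02.
case: u_cases => [u0|[en uN]].
  have oN : odd N.
    move: X; rewrite u0 mul0rz addr0 => /eqP; rewrite intr_Zp_eq0 // absz_nat.
    by rewrite /N; case: ifP => // on /dvdn_leq; clear -n_ge3 on; lia.
  rewrite oN; apply: dvdn_odd mN oN.
have [em N4] := u_N uN en; rewrite (negbTE em); clear -N4; lia.
Qed.

(** With a - c = m and a + c = N the word [0 2]^a [3 1]^c closes. Sending 0, 2 to 0, 1 gives a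
    closed word whose first coordinate is 2 a, so N divides a = (m + N) / 2; as m divides N, they
    are equal. *)
Lemma m_eq_N : m = N.
Proof.
have [mN X] := closedw_zigzag02; have mleN := dvdn_leq N_gt0 mN.
pose a := ((m + N) %/ 2)%N; pose c := ((N - m) %/ 2)%N.
have mNp := mN_parity.
have ac1 : a%:Z - c%:Z = m by rewrite /a /c; clear -mleN mNp; lia.
have ac2 : a%:Z + c%:Z = N by rewrite /a /c; clear -mleN mNp; lia.
have cw : closedw (zigzag a l0 l2 ++ zigzag c l3 l1).
  have p0 : pv (zigzag a l0 l2 ++ zigzag c l3 l1) l0 = a by rewrite pv_zigzag2 mulr1 mulr0 addr0.
  have p1 : pv (zigzag a l0 l2 ++ zigzag c l3 l1) l1 = - c%:Z by rewrite pv_zigzag2 mulr0 mulrN1 add0r.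
  have p2 : pv (zigzag a l0 l2 ++ zigzag c l3 l1) l2 = - a%:Z by rewrite pv_zigzag2 mulr0 mulrN1 addr0.
  have p3 : pv (zigzag a l0 l2 ++ zigzag c l3 l1) l3 = c by rewrite pv_zigzag2 mulr0 mulr1 add0r.
  rewrite /closedw /qv p0 p1 p2 p3 ac1 opprK ac2 -opprD ac2 dvdzz.
  have E : N%:~R + u *~ (m %/ 2)%Z = 0.
    case: u_cases => [u0|[en uN]]; first by move: X; rewrite u0 !mul0rz.
    rewrite -X; congr (_ + _); rewrite -[u in LHS]mulr1z -[u in RHS]mulr1z -!mulrzA !mul1r.
    have [em N4] := u_N uN en; apply/eqP; rewrite -subr_eq0 -mulrzBr.
    have -> : ((m %/ 2)%Z - (N %/ 2)%Z = 2 * (((m %/ 2)%Z - (N %/ 2)%Z) %/ 2)%Z).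
      have oN2 : odd N./2 by clear -N4; lia.
      have mN2 : (m./2 %| N./2)%N.
        rewrite -(dvdn_pmul2l (isT : (0 < 2)%N)) !mul2n !even_halfK //; clear -N4; lia.
      have := dvdn_odd mN2 oN2; clear -em N4; lia.
    by rewrite mulrzA -[_ *~ 2]/(_ *+ 2) u2 mul0rz.
  split=> //; rewrite intrN; apply/eqP.
  have : N%:~R + N%:~R = 0 :> 'Z_n.
    by apply/eqP; rewrite -intrD -(_ : 2 * N%:Z = N%:Z + N%:Z) ?half_mod ?dvdzz //; lia.
  by move/eqP; rewrite addr_eq0 => /eqP <-; rewrite E.
have [pi [pi_inj pi0 pi2 piw]] := closedw_perm (isT : l0 != l2) (isT : l0 != l1).
have := piw _ _ cw; rewrite size_cat !size_zigzag oddD !mul2n !odd_double => /(_ isT).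
rewrite map_cat !map_zigzag pi0 pi2.
have ne x y : x != y -> pi x != pi y by rewrite (inj_eq pi_inj).
have n30 := ne l3 l0 isT; have n32 := ne l3 l2 isT; have n10 := ne l1 l0 isT; have n12 := ne l1 l2 isT.
rewrite pi0 in n30 n10; rewrite pi2 in n32 n12.
have p0 : pv (zigzag a l0 l1 ++ zigzag c (pi l3) (pi l1)) l0 = a.
  by rewrite pv_zigzag2 (negbTE n30) (negbTE n10) mulr1 mulr0 addr0.
have p1 : pv (zigzag a l0 l1 ++ zigzag c (pi l3) (pi l1)) l1 = - a%:Z.
  by rewrite pv_zigzag2 (negbTE n32) (negbTE n12) mulrN1 mulr0 addr0.
rewrite /closedw /qv p0 p1 subrr div0z mulr0z addr0 opprK => -[_ /eqP + _].
rewrite -(_ : 2 * a%:Z = a%:Z + a%:Z) ?half_mod; last lia.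
rewrite dvdzE !absz_nat => /dvdn_leq; have := N_gt0; rewrite /a; clear -m_gt0 mleN mNp; lia.
Qed.

Lemma closedw_perm_cases :
  [/\ n = m, odd n & r ^+ 2 = 1 \/ r ^+ 2 = -1] \/
  [/\ n = (2 * m)%N, m = 2 %[mod 4] & 1 + r ^+ 2 = m%:R].
Proof.
have [mN X] := closedw_zigzag02.
have sgE : r ^+ 2 = (sg kappa)%:~R * t.
  by case: (kappa); rewrite /sg /= ?mul1r // mulrA -expr2 sqrrN expr1n mul1r.
case: u_cases => [u0|[en uN]]; [left|right].
  have on : odd n.
    move: X; rewrite u0 mul0rz addr0 => /eqP; rewrite intr_Zp_eq0 // absz_nat.
    by rewrite /N; case: ifP => // on /dvdn_leq; clear -n_ge3 on; lia.
  split=> //; first by rewrite m_eq_N /N on.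
  rewrite sgE; have -> : t = 1 by apply/eqP; rewrite -subr_eq0 u0.
  by case: (kappa); rewrite /sg mulr1; [left|right].
have nE := N_even en; have [em N4] := u_N uN en; rewrite -m_eq_N in nE N4 uN.
split=> //.
have tE : t = 1 + m%:R by rewrite -[LHS](subrK 1) uN addrC.
have m2 : m%:R = - m%:R :> 'Z_n.
  apply/eqP; rewrite -addr_eq0 -natrD addnn -mul2n -nE.
  by rewrite -[n%:R]/(n%:~R) intr_Zp_eq0.
(* For [kappa = true] the odd square r^2 = 1 + m would be 3 modulo 4, as m = 2 modulo 4 and 4
   divides n. *)
rewrite sgE tE; case kE: (kappa); last by rewrite /sg mulN1r opprD addrA subrr add0r.
have [k rE] := unit_Zp_odd n_gt1 en r_unit.
have : ((2 * k%:Z + 1) ^+ 2 - (1 + m%:Z))%:~R == 0 :> 'Z_n.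
  rewrite intrB subr_eq0 intrD -[m%:~R]/(m%:R) -tE kE mul1r rE.
  by rewrite !expr2 intrM intrD intrM natrD natrM eqxx.
rewrite intr_Zp_eq0 // => nd; suff : (4 %| m)%N by clear -N4; lia.
have n4d : (4 %| n)%N by rewrite nE; clear -N4; lia.
have := dvdn_trans n4d nd; clear; rewrite expr2.
have -> : ((2 * k%:Z + 1) * (2 * k%:Z + 1) - (1 + m%:Z) = 4 * (k%:Z * (k%:Z + 1)) - m%:Z) by ring.
move: (k%:Z * _) => z; lia.
Qed.

End ClosedWords.

(** * Lifting walks *)

Section Lift.
Variables (m s n : nat) (r : 'Z_n).
Hypotheses (m_gt0 : (0 < m)%N) (s_ge2 : (2 <= s)%N) (n_ge3 : (3 <= n)%N).
Hypotheses (r_unit : r \is a GRing.unit) (r_ms : r ^+ (m * s) = 1 \/ r ^+ (m * s) = -1).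

Lemma s_gt0 : (0 < s)%N. Proof. exact: ltnW. Qed.

Lemma n_gt1 : (1 < n)%N. Proof. exact: ltnW. Qed.

Lemma ms_gt1 : (1 < m * s)%N.
Proof. by rewrite (leq_trans s_ge2) // leq_pmull. Qed.

Lemma coord_subproof (k : int) : (`|(k %% s)%Z| < s)%N.
Proof. have := s_gt0; lia. Qed.

Definition coord (k : int) : 'I_s := Ordinal (coord_subproof k).

Lemma coord_eq k k' : (coord k == coord k') = (k == k' %[mod s])%Z.
Proof.
rewrite -val_eqE /=; have := s_gt0 => s0.
have := modz_ge0 k (d := s); have := modz_ge0 k' (d := s).
by lia.
Qed.

Lemma coord_neq (k k' : int) : (0 < `|k - k'| < s)%N -> coord k != coord k'.
Proof.
case/andP=> k0 ks; rewrite coord_eq eqz_mod_dvd; apply/negP => /(dvdn_leq k0).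
by rewrite absz_nat leqNgt ks.
Qed.

Lemma coord_exists (l : 'I_s) : exists k : nat, coord k = l.
Proof. by exists l; apply/val_inj; rewrite /= modz_nat absz_nat modn_small. Qed.

(* A vertex of the cover of the graph in which levels are integers. *)
Definition lift := (int * 'rV['Z_n]_s)%type.

Definition lstep (k : int) : 'rV['Z_n]_s := \row_(l < s) (if l == coord k then r ^ k else 0).

Definition mv (P : lift) (a : letter) : lift :=
  (P.1 + sg a.1, P.2 + lstep (elev P.1 a.1) *~ sg a.2).

Definition pr (P : lift) : CPMbar m s r := (P.1%:~R, P.2).

Arguments pr : simpl never.
Arguments mv : simpl never.

Lemma mvK P a : mv (mv P a) (linv a) = P.
Proof.
case: P => k v; rewrite /mv /elev /=; congr (_, _).
  by rewrite sgN addrK.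
rewrite sgN mulrNz; suff -> : k + sg a.1 - (~~ ~~ a.1)%:Z = k - (~~ a.1)%:Z by rewrite addrK.
by case: a.1; rewrite /=; lia.
Qed.

Lemma exprz_unit k : r ^ k \is a GRing.unit.
Proof. by rewrite unitrXz. Qed.

(** Changing the level by a multiple of m s keeps its coordinate and multiplies r^k by a power of
    r^(m s) = +-1. *)
Lemma lstep_cpm (k : int) :
  lstep k = cpm_step (m := m) r k%:~R \/ lstep k = - cpm_step (m := m) r k%:~R.
Proof.
have ms1 := ms_gt1.
set q := (k %/ (m * s)%N)%Z; set j := `|(k %% (m * s)%N)%Z|%N.
have jlt : (j < m * s)%N by rewrite /j; lia.
have kE : k = q * (m * s)%N + j%:Z.
  by rewrite {1}(divz_eq k (m * s)%N) -/q /j gez0_abs // modz_ge0 //; lia.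
have iE : (k%:~R : 'Z_(m * s)) = j%:R.
  rewrite kE intrD intrM; have -> : (((m * s)%N : int)%:~R : 'Z_(m * s)) = 0.
    by apply/eqP; rewrite intr_Zp_eq0 //= dvdnn.
  by rewrite mulr0 add0r.
have jE : (j%:R : 'Z_(m * s)) = j :> nat by rewrite val_Zp_nat // modn_small.
have rE : r ^ k = r ^+ j \/ r ^ k = - r ^+ j.
  have : r ^ (q * (m * s)%N) = 1 \/ r ^ (q * (m * s)%N) = -1.
    by rewrite mulrC -exprz_exp -exprnP; exact: exprz_pm1.
  by rewrite kE exprzDr // exprnP => -[] ->; rewrite ?mul1r ?mulN1r; [left|right].
have cE (l : 'I_s) : (l == (j %% s)%N :> nat) = (l == coord k).
  rewrite -val_eqE /=; congr (_ == _).
  rewrite kE PoszM mulrA modzMDl modz_nat absz_nat //.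
case: rE => rE; [left|right]; apply/rowP=> l; rewrite !mxE iE jE cE rE; case: ifP => //.
by rewrite oppr0.
Qed.

Lemma lstepN_cpm (k : int) (x : 'rV['Z_n]_s) (e : bool) :
  (x == cpm_step (m := m) r k%:~R) || (x == - cpm_step (m := m) r k%:~R) =
  (x == lstep k *~ sg e) || (x == lstep k *~ sg (~~ e)).
Proof.
by case: (lstep_cpm k) => ->; case: e; rewrite /sg /= ?mulrNz ?mulr1z ?opprK // orbC.
Qed.

Lemma pr_arc P e : cpm_arc r (pr P) (pr (mv P (true, e))).
Proof.
case: P => k v; apply/andP; split; first by rewrite /= intrD.
have := lstepN_cpm k (lstep k *~ sg e) e; rewrite eqxx /= => /orP[] /eqP E.
  by apply/orP; left; rewrite /= /elev subr0 E.
by apply/orP; right; rewrite /= /elev subr0 E.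
Qed.

Lemma pr_mv_adj P a : adj (pr P) (pr (mv P a)).
Proof.
case: a => [[] e]; first by apply/orP; left; exact: pr_arc.
by apply/orP; right; rewrite -{2}(mvK P (false, e)); exact: pr_arc.
Qed.

Lemma arc_from_pr P y : cpm_arc r (pr P) y -> exists e, y = pr (mv P (true, e)).
Proof.
case: P y => k v [i w] /andP[/eqP /= -> wE].
have {wE} : (w - v == cpm_step (m := m) r k%:~R) || (w - v == - cpm_step (m := m) r k%:~R).
  by rewrite !subr_eq ![_ + v]addrC.
rewrite (lstepN_cpm k _ true) => /orP[] /eqP E; [exists true|exists false];
by rewrite /pr /mv /= intrD /elev subr0 -E subrKC.
Qed.

Lemma arc_to_pr P y : cpm_arc r y (pr P) -> exists e, y = pr (mv P (false, e)).
Proof.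
case: P y => k v [i w] /andP[/= /eqP kE vE].
have iE : i = (k - 1)%:~R by rewrite intrB kE addrK.
have {vE} : (v - w == cpm_step (m := m) r (k - 1)%:~R) || (v - w == - cpm_step (m := m) r (k - 1)%:~R).
  by rewrite -iE !subr_eq ![_ + w]addrC.
rewrite (lstepN_cpm (k - 1) _ true) => /orP[] /eqP E; [exists false|exists true];
by rewrite /pr /mv /= iE /elev; congr (_, _);
  move/eqP: E; rewrite subr_eq => /eqP->; rewrite addrAC -mulrzDr [X in _ *~ X](_ : _ = 0) // mulr0z add0r.
Qed.

Lemma adj_prP P y : reflect (exists a, y = pr (mv P a)) (adj (pr P) y).
Proof.
apply: (iffP idP) => [|[a ->]]; last exact: pr_mv_adj.
by case/orP => [/arc_from_pr[e]|/arc_to_pr[e]] ->; [exists (true, e)|exists (false, e)].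
Qed.

Lemma coord_pred k : coord k != coord (k - 1).
Proof.
rewrite coord_eq; have := s_ge2 => s2.
by apply/negP; rewrite eqz_mod_dvd opprB addrCA subrr addr0 dvdz1; lia.
Qed.

Lemma lstep_coord k : lstep k 0 (coord k) = r ^ k.
Proof. by rewrite mxE eqxx. Qed.

Lemma lstep_other k l : l != coord k -> lstep k 0 l = 0.
Proof. by rewrite mxE => /negbTE->. Qed.

Lemma exprz_mulz_eq0 (k c : int) : (r ^ k *~ c == 0) = (n %| `|c|)%N.
Proof.
rewrite -intr_Zp_eq0 ?n_gt1 // -mulrzl; apply/idP/idP => [/eqP E|/eqP->]; last by rewrite mul0r.
by rewrite -[c%:~R](mulrK (exprz_unit k)) E mul0r.
Qed.

Lemma mulz_row (x : 'rV['Z_n]_s) (c : int) l : (x *~ c) 0 l = x 0 l *~ c.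
Proof. by case: c => c; rewrite ?NegzE ?mulrNz -?pmulrn ?mxE mulmxnE. Qed.

(** Upward and downward edges change different coordinates since s >= 2, and the two signs of one
    level differ since n does not divide 2. *)
Lemma mv_inj P a b : (mv P a).2 = (mv P b).2 -> a = b.
Proof.
case: P a b => k v [u e] [u' e'] /= /addrI E.
have n3 := n_ge3.
have [uu'|uu'] := eqVneq u u'.
  rewrite -{}uu' in E *; congr (_, _); move/rowP/(_ (coord (elev k u)))/eqP: E.
  rewrite !mulz_row lstep_coord -subr_eq0 -mulrzBr exprz_mulz_eq0.
  case: e e' => [] [] //= /dvdn_leq; lia.
have cc : coord (elev k u) != coord (elev k u').
  case: u u' uu' {E} => [] [] //= _; rewrite /elev ?subr0 /=; last rewrite eq_sym; exact: coord_pred.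
move/rowP/(_ (coord (elev k u)))/eqP: E.
rewrite !mulz_row lstep_coord lstep_other // mul0rz exprz_mulz_eq0.
case: e => //= /dvdn_leq; lia.
Qed.

Lemma pr_mv_inj P a b : pr (mv P a) = pr (mv P b) -> a = b.
Proof. by case=> _ /mv_inj. Qed.

Local Notation G := (CPMbar m s r).
Local Notation x0 := ((0, 0) : G).
Local Notation C := (connect (@adj G) x0).
Local Notation caut := (@caut G x0).

Fixpoint tr (P : lift) (w : seq letter) : seq lift :=
  if w is a :: w' then mv P a :: tr (mv P a) w' else [::].

Definition mvs (P : lift) (w : seq letter) : lift := foldl mv P w.

Definition vs (P : lift) (w : seq letter) : seq G := map pr (P :: tr P w).

Arguments vs : simpl never.

Lemma pr_surj (x : G) : exists P, x = pr P.
Proof. by case: x => i v; exists ((i : nat)%:Z, v); rewrite /pr /= -pmulrn natr_Zp. Qed.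

Lemma C0 : C (pr (0, 0)). Proof. exact: connect0. Qed.

Lemma C_mv P a : C (pr P) -> C (pr (mv P a)).
Proof. by move=> CP; apply: connect_adj CP _; exact: pr_mv_adj. Qed.

Lemma C_mvs P w : C (pr P) -> C (pr (mvs P w)).
Proof. by elim: w P => //= a w IH P CP; apply/IH/C_mv. Qed.

Lemma C_vs P w : C (pr P) -> all C (vs P w).
Proof.
by rewrite /vs /= => CP; rewrite CP /=; elim: w P CP => //= a w IH P CP; rewrite C_mv //= IH ?C_mv.
Qed.

Lemma vs_cons P a w : vs P (a :: w) = pr P :: vs (mv P a) w.
Proof. by []. Qed.

Lemma vs_rcons P w a : vs P (rcons w a) = rcons (vs P w) (pr (mv (mvs P w) a)).
Proof. by elim: w P => //= b w IH P; rewrite vs_cons IH. Qed.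

Lemma vs_inj P w w' : vs P w = vs P w' -> w = w'.
Proof.
elim: w w' P => [|a w IH] [|a' w'] P // E.
have aa' : a = a' by apply: (@pr_mv_inj P); exact: (congr1 (fun z => nth x0 z 1) E).
rewrite -aa' in E *; rewrite (IH w' (mv P a)) //.
by move: E; rewrite !vs_cons => /(congr1 behead).
Qed.

Lemma vs_img F P P' w : caut F -> C (pr P) -> F (pr P) = pr P' -> redw w ->
  exists2 w', redw w' & size w' = size w /\ map F (vs P w) = vs P' w'.
Proof.
move=> FA; elim: w P P' => [|a w IH] P P' CP FP rw.
  by exists [::]; rewrite //= FP.
have CPa := C_mv a CP.
have /adj_prP[a' Fa] : adj (pr P') (F (pr (mv P a))).
  by rewrite -FP (caut_adj FA) ?pr_mv_adj.
have rw0 : redw w by case: w rw {IH} => //= b w /andP[].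
have [w' rw' [sw' E]] := IH _ _ CPa Fa rw0.
exists (a' :: w'); last by split; [rewrite /= sw' | rewrite !vs_cons map_cons E FP].
case: w w' sw' E rw {IH rw0} rw' => [|b w] [|b' w'] //= _ E /andP[ab _] ->.
rewrite andbT; apply: contra ab => /eqP b'E.
have : F (pr (mv (mv P a) b)) = pr (mv (mv P' a') b') by exact: (congr1 (fun z => nth x0 z 1) E).
rewrite b'E mvK -FP => /(caut_inj FA) -/(_ (C_mv _ CPa) CP).
by rewrite -{2}(mvK P a) => /pr_mv_inj ->.
Qed.

Lemma vs_img1 F P P' a a' w : caut F -> C (pr P) -> F (pr P) = pr P' ->
    F (pr (mv P a)) = pr (mv P' a') -> redw (a :: w) ->
  exists2 w', redw (a' :: w') & size w' = size w /\ map F (vs P (a :: w)) = vs P' (a' :: w').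
Proof.
move=> FA CP FP Fa rw; have [w2 rw2 [sw2 E2]] := vs_img FA CP FP rw.
case: w2 rw2 sw2 E2 => [|b w'] rw' // [sw'] E.
have ba : b = a'.
  by apply: (@pr_mv_inj P'); rewrite -Fa; exact/esym/(congr1 (fun z => nth x0 z 1) E).
by rewrite -ba; exists w'.
Qed.

Lemma lift_aut (f : lift -> lift) (h : G -> G) :
    injective h -> (forall P, h (pr P) = pr (f P)) ->
    (forall P a, exists a', f (mv P a) = mv (f P) a') ->
    (forall P a', exists a, f (mv P a) = mv (f P) a') ->
  forall x y, adj (h x) (h y) = adj x y.
Proof.
move=> h_inj hE f1 f2 x y; have [P ->] := pr_surj x; rewrite hE.
apply/adj_prP/adj_prP => [[a' hy]|[a ->]]; last first.
  by have [a' E] := f1 P a; exists a'; rewrite hE E.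
by have [a E] := f2 P a'; exists a; apply: h_inj; rewrite hy hE E.
Qed.

(** * Reflections of one coordinate and equivalence of walks *)

Definition refl (l : 'I_s) (c : 'Z_n) (x : G) : G :=
  (x.1, \row_j (if j == l then c *+ 2 - x.2 0 j else x.2 0 j)).

Definition refl_lift (l : 'I_s) (c : 'Z_n) (P : lift) : lift :=
  (P.1, \row_j (if j == l then c *+ 2 - P.2 0 j else P.2 0 j)).

Lemma refl_mv l c P a :
  refl_lift l c (mv P a) =
  mv (refl_lift l c P) (if coord (elev P.1 a.1) == l then lbar a else a).
Proof.
case: P a => k v [u e]; rewrite /refl_lift /mv /=; case: ifP => lE /=; congr (_, _).
  apply/rowP=> j; rewrite !mxE !mulz_row !mxE sgN mulrNz; case: (eqVneq j l) => [->|jl].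
    by rewrite eq_sym (eqP lE) eqxx opprD addrA.
  by rewrite -(eqP lE) in jl *; rewrite (negbTE jl) mul0rz oppr0.
apply/rowP=> j; rewrite !mxE !mulz_row !mxE; case: (eqVneq j l) => [->|jl] //.
by rewrite eq_sym lE mul0rz !addr0.
Qed.

Lemma lbarK : involutive lbar. Proof. by case=> u e; rewrite /lbar /= negbK. Qed.

Lemma refl_caut l c x : C x -> x.2 0 l = c -> caut (refl l c) /\ refl l c x = x.
Proof.
move=> Cx xl; have reflK : involutive (refl l c).
  case=> i v; congr (_, _); apply/rowP=> j; rewrite !mxE; case: eqP => // _.
  by rewrite opprB addrC subrK.
have fx : refl l c x = x.
  case: x xl {Cx} => i v /= vl; congr (_, _); apply/rowP=> j; rewrite !mxE.
  by case: eqP => // ->; rewrite vl mulr2n addrK.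
split=> //; apply: (caut_restrict (x := x)) => //; last by rewrite fx.
  exact: inv_inj.
apply: (@lift_aut (refl_lift l c)) => // [|P a|P a]; first exact: inv_inj.
  by eexists; exact: refl_mv.
exists (if coord (elev P.1 a.1) == l then lbar a else a); rewrite refl_mv.
have [H|H] := boolP (coord (elev P.1 a.1) == l); last by rewrite (negbTE H).
by rewrite (H : coord (elev P.1 (lbar a).1) == l) lbarK.
Qed.

Definition avoids (l : 'I_s) (k : int) (w : seq letter) := all (fun j => coord j != l) (levels k w).

Lemma avoids_mvs l (P : lift) w : avoids l P.1 w -> (mvs P w).2 0 l = P.2 0 l.
Proof.
elim: w P => //= a w IH P /andP[al wl]; rewrite IH // /mv /= !mxE mulz_row.
by rewrite lstep_other 1?eq_sym // mul0rz addr0.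
Qed.

Lemma refl_vs l (P : lift) w :
  avoids l P.1 w -> map (refl l (P.2 0 l)) (vs P w) = vs P w.
Proof.
move=> H; have [c Pl] : exists c, P.2 0 l = c by exists (P.2 0 l).
rewrite Pl; move: H Pl.
elim: w P => [|a w IH] P; rewrite ?vs_cons /=.
  move=> _ Pl; congr [:: _]; congr (_, _); apply/rowP=> j; rewrite !mxE.
  by case: eqP => // ->; rewrite Pl mulr2n addrK.
case/andP=> al wl Pl; congr (_ :: _).
  congr (_, _); apply/rowP=> j; rewrite !mxE.
  by case: eqP => // ->; rewrite Pl mulr2n addrK.
by apply: IH => //; rewrite -Pl (@avoids_mvs l P [:: a]) //= /avoids /= al.
Qed.

(** No edge of [w] changes the coordinate of the last edge, so the reflection fixes the vertices of
    [w] and swaps the two choices of that edge. *)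
Lemma refl_last P w a : C (pr P) -> avoids (coord (elev (mvs P w).1 a.1)) P.1 w ->
  exists2 F, caut F & map F (vs P (rcons w a)) = vs P (rcons w (lbar a)).
Proof.
set l := coord _ => CP wl; have [F _] := refl_caut CP (erefl (P.2 0 l)).
exists (refl l (P.2 0 l)) => //; rewrite !vs_rcons map_rcons refl_vs //; congr (rcons _ _).
have reflE Q : refl l (P.2 0 l) (pr Q) = pr (refl_lift l (P.2 0 l) Q) by [].
rewrite reflE refl_mv eqxx; congr (pr (mv _ _)).
have := avoids_mvs wl; case: (mvs P w) => k v /= vl; congr (_, _); apply/rowP=> j; rewrite !mxE.
by case: eqP => // ->; rewrite vl mulr2n addrK.
Qed.

Definition eqv (xs ys : seq G) := exists2 F, caut F & map F xs = ys.

Lemma eqv_trans xs ys zs : eqv xs ys -> eqv ys zs -> eqv xs zs.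
Proof.
by case=> F FA <- [F' FA' <-]; exists (F' \o F); [exact: caut_comp | rewrite map_comp].
Qed.

Lemma eqv_sym xs ys : all C xs -> eqv xs ys -> eqv ys xs.
Proof.
move=> Cxs [F FA <-]; have [F' FA' F'K] := caut_inv FA.
exists F' => //; rewrite -map_comp; apply: map_id_in => x xxs /=.
by apply: F'K; exact: (allP Cxs).
Qed.

Lemma eqv_rev xs ys : eqv xs ys -> eqv (rev xs) (rev ys).
Proof. by case=> F FA <-; exists F => //; rewrite map_rev. Qed.

Lemma eqv_refl xs : eqv xs xs.
Proof. by exists id; [exact: caut_id | rewrite map_id]. Qed.

Lemma rev_vs P w : rev (vs P w) = vs (mvs P w) (rev (map linv w)).
Proof.
elim: w P => [|a w IH] P //; rewrite vs_cons rev_cons IH map_cons rev_cons vs_rcons.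
congr (rcons _ _); suff -> : mvs (mvs (mv P a) w) (rev (map linv w)) = mv P a by rewrite mvK.
move: (mv P a) => {IH a}P.
elim: w P => //= b w IH P; rewrite rev_cons /mvs foldl_rcons.
by have := IH (mv P b); rewrite /mvs => ->; rewrite mvK.
Qed.

Lemma redw_rev w : redw w -> redw (rev (map linv w)).
Proof.
rewrite /redw rev_sorted sorted_map; apply: sub_sorted => a b; rewrite /nb /=.
by apply: contra => /eqP ->; rewrite linvK.
Qed.

Lemma vs2_neq P a b : nb a b -> pr P != pr (mv (mv P a) b).
Proof.
by apply: contra => /eqP; rewrite -{1}(mvK P a) => /pr_mv_inj ->.
Qed.

Lemma coord_elevN k u : coord (elev k u) != coord (elev k (~~ u)).
Proof.
by case: u; rewrite /elev /= !subr0; [exact: coord_pred | rewrite eq_sym; exact: coord_pred].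
Qed.

Lemma elev_turn k u : elev (k + sg u) (~~ u) = elev k u.
Proof. by case: u; rewrite /elev /sg /=; lia. Qed.

(** * Vectors of words and closed walks *)

Lemma mvs_level P w : (mvs P w).1 = P.1 + net w.
Proof.
elim: w P => [|a w IH] P; rewrite /= ?addr0 // /mvs /= -/(mvs _ _) IH.
by rewrite /mv /= addrA.
Qed.

Lemma mvs_vec P w : (mvs P w).2 = P.2 + \sum_(z <- crossings P.1 w) lstep z.1 *~ sg z.2.
Proof.
elim: w P => [|a w IH] P; rewrite /= ?big_nil ?addr0 // big_cons /mvs /= -/(mvs _ _) IH.
by rewrite /mv /= addrA.
Qed.

Lemma mvs_coord w (l : 'I_s) :
  (mvs (0, 0) w).2 0 l = \sum_(z <- crossings 0 w | coord z.1 == l) r ^ z.1 *~ sg z.2.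
Proof.
rewrite mvs_vec add0r summxE [RHS]big_mkcond; apply: eq_bigr => z _.
by rewrite mulz_row mxE eq_sym; case: ifP => // _; rewrite mul0rz.
Qed.

(** A walk of length at most 8 crosses only levels that lie in the window of 17 terms inspected by
    [coefs]. *)
Lemma mvs_coefs w (l : 'I_s) : (size w <= 8)%N ->
  (mvs (0, 0) w).2 0 l = r ^ (l%:Z - 8 * s%:Z) * heval (r ^+ s) (coefs s w l).
Proof.
move=> sw; rewrite mvs_coord /coefs heval_iota.
under [X in _ * X]eq_bigr do rewrite coef_bigE add0n.
rewrite mulr_sumr; under [RHS]eq_bigr do rewrite rmorph_sum /= mulr_suml mulr_sumr.
rewrite exchange_big /= big_mkcond big_seq [RHS]big_seq; apply: eq_bigr => z zc.
have zb := crossings_bound zc; have s2 := s_ge2; have ls := ltn_ord l.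
rewrite -{1}(_ : coord l = l); last first.
  by apply/val_inj; rewrite /= modz_nat absz_nat modn_small.
rewrite coord_eq; case: ifP => [zl|zl]; last first.
  rewrite big1 // => i _; case: eqP => [zE|_]; last by rewrite mul0r mulr0.
  by rewrite zE addrC mulrC modzMDl eqxx in zl.
have /dvdzP[q qE] : (s %| z.1 - l%:Z)%Z by rewrite -eqz_mod_dvd.
have qb : (`|q| <= 8)%N by nia.
have [k kE] : exists k : nat, q = k%:Z - 8 by exists (absz (q + 8)); lia.
have i17 : (k < 17)%N by lia.
rewrite (bigD1 (Ordinal i17)) //= big1 ?addr0 => [|i iq].
  have zE : z.1 = l%:Z + (k%:Z - 8) * s%:Z by rewrite -kE -qE addrC subrK.
  rewrite ifT; last by apply/eqP; rewrite zE; ring.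
  rewrite mulrCA -[in LHS]mulrzl; congr (_ * _).
  rewrite -exprM exprnP -exprzDr //; congr (_ ^ _).
  by rewrite PoszM zE; ring.
case: eqP => [zE|_]; last by rewrite mul0r mulr0.
case/negP: iq; rewrite -val_eqE /=.
have /eqP : s%:Z * (i%:Z - 8 - q) = 0.
  by rewrite mulrBr [s%:Z * q]mulrC -qE zE; ring.
by rewrite mulf_eq0; lia.
Qed.

Lemma size_vs P w : size (vs P w) = (size w).+1.
Proof. by rewrite size_map /=; congr _.+1; elim: w P => //= a w IH P; rewrite IH. Qed.

Lemma nth_vs P w i : (i <= size w)%N -> nth x0 (vs P w) i = pr (mvs P (take i w)).
Proof. by elim: w P i => [|a w IH] P [|i] // iw; rewrite vs_cons [LHS]IH. Qed.

Lemma vs_cat P u v : vs P (u ++ v) = vs P u ++ behead (vs (mvs P u) v).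
Proof.
elim: u P => [|a u IH] P; first by rewrite /vs.
by rewrite cat_cons !vs_cons cat_cons IH.
Qed.

(* Closed walks that backtrack nowhere, not even at their base point. *)
Definition cwalk (P : lift) (w : seq letter) : Prop :=
  [/\ redw w, nth x0 (vs P w) (size w) = pr P &
      nth x0 (vs P w) 1 != nth x0 (vs P w) (size w).-1].

Lemma cwalkE P w : w != [::] -> cwalk P w <->
  [/\ redw w, pr (mvs P w) = pr P & pr (mv P (head Up w)) != pr (mv (mvs P w) (linv (last Up w)))].
Proof.
case/lastP: w => // u a _; rewrite /cwalk nth_vs // take_size last_rcons.
have -> : nth x0 (vs P (rcons u a)) 1 = pr (mv P (head Up (rcons u a))).
  by case: u => [|b u]; rewrite nth_vs // rcons_cons /= take0.
have -> : nth x0 (vs P (rcons u a)) (size (rcons u a)).-1 = pr (mvs P u).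
  by rewrite nth_vs size_rcons //= -cats1 take_size_cat.
by have -> : mv (mvs P (rcons u a)) (linv a) = mvs P u by rewrite /mvs foldl_rcons mvK.
Qed.

Lemma intr_Zms (k : int) : (k%:~R == 0 :> 'Z_(m * s)) = (m * s %| `|k|)%N.
Proof. by rewrite intr_Zp_eq0 ?ms_gt1. Qed.

Lemma cwalk_net w : cwalk (0, 0) w -> (m * s %| `|net w|)%N.
Proof.
case=> _ + _; rewrite nth_vs // take_size.
by rewrite /pr mvs_level add0r => -[/eqP]; rewrite intr_Zms.
Qed.

Lemma cwalk_vec w : cwalk (0, 0) w -> (mvs (0, 0) w).2 = 0.
Proof. by case=> _ + _; rewrite nth_vs // take_size => /(congr1 snd). Qed.

Lemma cwalk_closed0 w : cwalk (0, 0) w -> closed0 w.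
Proof.
have [->|w0] := eqVneq w [::]; first by case=> _ _; rewrite eqxx.
move=> cw; have v0 := cwalk_vec cw; case/cwalkE: cw => // _ _ ne; rewrite /closed0.
have [n0|//] := eqVneq (net w) 0; apply: contra ne => /eqP hE /=.
by rewrite (surjective_pairing (mvs _ w)) v0 mvs_level n0 addr0 -hE; case: (w) w0.
Qed.

Lemma cwalk_redw P w : cwalk P w -> redw w. Proof. by case. Qed.

Lemma unit_rs : r ^+ s \is a GRing.unit. Proof. exact: unitrX. Qed.

Lemma cwalk_walks N u p v : all_walks N u p -> size (u ++ v) = N -> cwalk (0, 0) (u ++ v) -> p (u ++ v).
Proof. by move=> H sz cw; apply: all_walksP H sz (cwalk_redw cw) (cwalk_closed0 cw). Qed.

Lemma shape_eq0 w (l : 'I_s) : (size w <= 8)%N ->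
  (heval (r ^+ s) (shape s w l) == 0) = ((mvs (0, 0) w).2 0 l == 0).
Proof.
move=> sw; rewrite heval_trim ?unit_rs // mvs_coefs //.
apply/eqP/eqP => [->|H]; first by rewrite mulr0.
by apply: (mulrI (exprz_unit (l%:Z - 8 * s%:Z))); rewrite H mulr0.
Qed.

Lemma cwalk_shape w S : cwalk (0, 0) w -> (size w <= 8)%N -> shape_in s w S ->
  exists2 L, L \in S & heval (r ^+ s) L = 0.
Proof.
move=> cw sw /hasP[l]; rewrite mem_iota add0n /= => ls lS.
exists (shape s w l) => //; apply/eqP.
by rewrite (@shape_eq0 w (Ordinal ls)) // cwalk_vec // mxE.
Qed.

Lemma coef_mvs w (j : int) S : (S <= s)%N ->
    all (fun y => (y.1 == j) || (`|y.1 - j| < S)%N) (crossings 0 w) ->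
  (mvs (0, 0) w).2 0 (coord j) = r ^ j *~ coef (crossings 0 w) j.
Proof.
move=> Ss /allP H; rewrite mvs_coord coef_bigE mulrz_sumr big_mkcond.
rewrite big_seq [RHS]big_seq; apply: eq_bigr => z zc.
case: (z.1 =P j) => [->|/eqP zj]; first by rewrite eqxx.
have := H _ zc; rewrite (negbTE zj) /= => zjS; rewrite (negbTE (@coord_neq _ _ _)) ?mulr0z //.
by rewrite (leq_trans zjS Ss) andbT absz_gt0 subr_eq0.
Qed.

Lemma cwalk_single w S cs : cwalk (0, 0) w -> (S <= s)%N -> single_level S w cs ->
  exists2 c : int, c \in cs & (n %| `|c|)%N.
Proof.
move=> cw Ss /hasP[z zc /andP[za zcs]]; exists (coef (crossings 0 w) z.1) => //.
by rewrite -(exprz_mulz_eq0 z.1) -(coef_mvs Ss) // cwalk_vec // mxE.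
Qed.

(** If the first and last letters have the same direction, the two edges at the base point have
    levels differing by 1 modulo s, hence different coordinates, and no backtracking occurs
    there. *)
Lemma mk_cwalk_vec w : redw w -> (m * s %| `|net w|)%N -> (mvs (0, 0) w).2 = 0 ->
    ((head Up w).1 == (last Up w).1) || (net w == 0) && (head Up w != linv (last Up w)) ->
  w != [::] -> cwalk (0, 0) w.
Proof.
move=> rw nw v0 hl w0; apply/cwalkE => //.
have PE : mvs (0, 0) w = (net w, 0) by rewrite (surjective_pairing (mvs _ w)) v0 mvs_level add0r.
split=> //; first by rewrite PE /pr /=; congr (_, _); apply/eqP; rewrite intr_Zms.
rewrite PE; apply/negP => /eqP /(congr1 snd) E.
case/orP: hl => [/eqP hl|/andP[/eqP n0 hl]]; last first.
  by case/negP: hl; apply/eqP; apply: (@mv_inj (0, 0)); rewrite -{2}n0.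
have {}E : lstep (elev 0 (head Up w).1) *~ sg (head Up w).2 =
    lstep (elev (net w) (~~ (last Up w).1)) *~ sg (~~ (last Up w).2).
  by apply: (@addrI _ 0); exact: E.
have cc : coord (elev 0 (head Up w).1) != coord (elev (net w) (~~ (last Up w).1)).
  have ns : (s %| net w)%Z by rewrite dvdzE /= (dvdn_trans _ nw) ?dvdn_mull.
  have -> : coord (elev (net w) (~~ (last Up w).1)) = coord (elev 0 (~~ (last Up w).1)).
    apply/eqP; rewrite coord_eq eqz_mod_dvd (_ : _ - _ = net w) // /elev; lia.
  by rewrite hl coord_elevN.
move/rowP/(_ (coord (elev 0 (head Up w).1)))/eqP: E.
rewrite !mulz_row lstep_coord lstep_other // mul0rz exprz_mulz_eq0.
have := n_ge3; case: (head Up w).2 => n3 /dvdn_leq /=; lia.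
Qed.

Lemma mk_cwalk w : redw w -> (size w <= 8)%N -> (m * s %| `|net w|)%N ->
    all (fun l => heval (r ^+ s) (shape s w l) == 0) (iota 0 s) ->
    ((head Up w).1 == (last Up w).1) || (net w == 0) && (head Up w != linv (last Up w)) ->
  w != [::] -> cwalk (0, 0) w.
Proof.
move=> rw sw nw /allP sh; apply: mk_cwalk_vec => //.
apply/rowP=> l; rewrite [RHS]mxE; apply/eqP; rewrite -shape_eq0 //.
by apply: sh; rewrite mem_iota /=.
Qed.

Lemma mvs_vec0 w : (size w <= 8)%N ->
    all (fun z => coef (crossings 0 w) z.1 == 0) (crossings 0 w) -> (mvs (0, 0) w).2 = 0.
Proof.
move=> sw /allP cz; have c0 j : coef (crossings 0 w) j = 0.
  have [/mapP[z zc ->]|jc] := boolP (j \in map fst (crossings 0 w)); first exact/eqP/cz.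
  rewrite coef_bigE big_seq big1 // => z zc; case: eqP => // zj.
  by rewrite -zj map_f in jc.
apply/rowP=> l; rewrite [RHS]mxE mvs_coefs // /coefs heval_iota big1 ?mulr0 // => i _.
by rewrite c0 mul0r.
Qed.

Lemma mk_cwalk0 w : redw w -> (size w <= 8)%N -> net w = 0 ->
    all (fun z => coef (crossings 0 w) z.1 == 0) (crossings 0 w) ->
  head Up w != linv (last Up w) -> w != [::] -> cwalk (0, 0) w.
Proof.
move=> rw sw nw cz hl; apply: mk_cwalk_vec; rewrite ?nw ?dvdn0 ?hl ?orbT //.
exact: mvs_vec0.
Qed.

Lemma turn_cwalk_n4 : n = 4%N -> cwalk (0, 0) (UDU ++ [:: Dn]).
Proof.
move=> n4; apply: mk_cwalk_vec => //.
rewrite mvs_vec (_ : crossings _ _ = nseq 4 (0 : int, true)) // !big_cons big_nil add0r addr0.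
rewrite -!mulrzDr; apply/rowP=> l; rewrite mulz_row !mxE; case: ifP => _; rewrite ?mul0rz //.
by apply/eqP; rewrite exprz_mulz_eq0 n4.
Qed.

Lemma cwalk_img F P P' w0 w0' w : C (pr P) -> C (pr P') -> (0 < size w0')%N ->
    caut F -> map F (vs P w0) = vs P' w0' -> cwalk P (w0 ++ w) ->
  exists w', [/\ size w' = size w, cwalk P' (w0' ++ w')
    & map F (vs P (w0 ++ w)) = vs P' (w0' ++ w')].
Proof.
move=> CP CP' s0 FA F0 [rw cl ne].
have FP : F (pr P) = pr P' := congr1 (fun z => nth x0 z 0) F0.
have [v rv [sv E]] := vs_img FA CP FP rw.
have ss : size w0 = size w0' by move/(congr1 size): F0; rewrite size_map !size_vs => -[].
have vE : v = w0' ++ drop (size w0') v.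
  rewrite -{1}(cat_take_drop (size w0') v); congr (_ ++ _); apply: (@vs_inj P').
  have st : size (take (size w0') v) = size w0' by rewrite size_takel // sv size_cat ss leq_addr.
  move/(congr1 (take (size w0').+1)): E.
  rewrite -{1}(cat_take_drop (size w0') v) !vs_cat map_cat F0.
  by rewrite !take_size_cat ?size_vs ?st.
exists (drop (size w0') v); rewrite -vE; split=> //.
  by rewrite size_drop sv size_cat ss addKn.
have nthE i : (i <= size v)%N -> nth x0 (vs P' v) i = F (nth x0 (vs P (w0 ++ w)) i).
  by move=> iv; rewrite -E (nth_map x0) // size_vs ltnS -sv.
have v0 : (0 < size v)%N by rewrite sv size_cat ss (leq_trans s0) ?leq_addr.
split=> //; first by rewrite nthE // sv cl.
rewrite !nthE ?leq_pred // sv; apply: contra ne => /eqP /(caut_inj FA)-> //.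
  by apply: (allP (C_vs (w0 ++ w) CP)); rewrite mem_nth // size_vs -sv.
by apply: (allP (C_vs (w0 ++ w) CP)); rewrite mem_nth // size_vs; lia.
Qed.

Lemma sg_sqr (x : bool) : (sg x)%:~R * (sg x)%:~R = 1 :> 'Z_n.
Proof. by rewrite -intrM; case: x. Qed.

(** * Labels for s = 2 *)

Section Labels.
Hypothesis s2 : s = 2%N.
Variable kappa : bool.
Local Notation lab := (lab kappa).
Local Notation kap := (kap kappa).

Definition mvl (P : lift) (c : letter) : lift := mv P (lab P.1 c).
Arguments mvl : simpl never.
Definition lmvs (P : lift) (w : seq letter) : lift := foldl mvl P w.

Lemma lab_inj k : injective (lab k).
Proof.
move=> [b e] [b' e']; rewrite /lab /= => -[].
have [->|bb] := eqVneq b b'; last by case: (b) (b') (parity k) bb => [] [] [].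
move=> _ /(congr1 (addb^~ (parity k))); rewrite -!addbA addbb !addbF => E.
by congr (_, _); move: E; case: (kap _) e e' => [] [] [].
Qed.

Lemma lab_surj k a : exists c, a = lab k c.
Proof.
pose b := a.1 == parity k.
exists (b, (a.2 (+) parity k) == kap (elev k a.1)).
case: a @b => u e; rewrite /lab /=.
have -> : ((u == parity k) == parity k) = u by case: u (parity k) => [] [].
by congr (_, _); case: (kap _) e (parity k) => [] [] [].
Qed.

Lemma lab_mvl P c : lab (mvl P c).1 c = linv (lab P.1 c).
Proof.
case: P c => k v [b e]; rewrite /mvl /mv /lab /= parity_sg /linv /=.
set u := b == parity k.
have -> : (b == ~~ parity k) = ~~ u by rewrite /u; case: (b) (parity k) => [] [].
by rewrite elev_turn addbN.
Qed.

Lemma mvlK P c : mvl (mvl P c) c = P.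
Proof. by rewrite {1}/mvl lab_mvl mvK. Qed.

Lemma C_mvl P c : C (pr P) -> C (pr (mvl P c)). Proof. exact: C_mv. Qed.

Lemma C_lmvs P w : C (pr P) -> C (pr (lmvs P w)).
Proof. by elim: w P => //= c w IH P /(C_mvl c); apply: IH. Qed.

Lemma pr_mvl_inj P c c' : pr (mvl P c) = pr (mvl P c') -> c = c'.
Proof. by move/pr_mv_inj/lab_inj. Qed.

Lemma adj_mvlP P y : reflect (exists c, y = pr (mvl P c)) (adj (pr P) y).
Proof.
apply: (iffP (adj_prP P y)) => [[a ->]|[c ->]]; last by exists (lab P.1 c).
by have [c ->] := lab_surj P.1 a; exists c.
Qed.

Definition tau : 'Z_n := (sg kappa)%:~R * r ^+ 2.

Lemma unit_tau : tau \is a GRing.unit.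
Proof. by rewrite unitrM unitrX // andbT; case: kappa; rewrite ?unitrN unitr1. Qed.

Definition pX (P : lift) := P.2 0 (coord 0).
Definition pY (P : lift) := P.2 0 (coord 1).

Lemma coord01 (l : 'I_s) : l = coord 0 \/ l = coord 1.
Proof.
have [k <-] := coord_exists l.
have : (k%:Z == 0 %[mod s])%Z || (k%:Z == 1 %[mod s])%Z.
  by rewrite s2 !modz_nat; have := ltn_pmod k (isT : (0 < 2)%N); case: (k %% 2)%N => [|[|]].
by rewrite -!coord_eq => /orP[]/eqP->; [left|right].
Qed.

Lemma coord_even (j : int) : coord (2 * j) = coord 0.
Proof. by apply/eqP; rewrite coord_eq eqz_mod_dvd subr0 s2 dvdz_mulr. Qed.

Lemma coord_odd (j : int) : coord (2 * j + 1) = coord 1.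
Proof. by apply/eqP; rewrite coord_eq eqz_mod_dvd addrK s2 dvdz_mulr. Qed.

Lemma coord01_neq : coord 0 != coord 1.
Proof. by rewrite coord_eq s2. Qed.

(** The twist absorbs the sign in tau = sg kappa * r^2, so the signed steps along a coordinate are
    consecutive powers of tau, times r on odd levels. *)
Lemma kap_step (j i : int) : (j %/ 2)%Z = i -> r ^ j *~ sg (kap j) = tau ^ i * r ^ (j - 2 * i).
Proof.
move=> ji; rewrite /tau.
have us : ((sg kappa)%:~R : 'Z_n) \is a GRing.unit by case: kappa; rewrite ?unitrN unitr1.
rewrite (exprMz_comm i us (unitrX 2 r_unit)); last exact: mulrC.
rewrite exprnP exprz_exp -mulrA -exprzDr // addrC subrK -mulrzl; congr (_ * _).
rewrite /kap ji; case: kappa => /=; first by rewrite exp1rz.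
by rewrite exprN1z.
Qed.

Lemma coord_mv P a (l : 'I_s) : (mv P a).2 0 l =
  P.2 0 l + (if coord (elev P.1 a.1) == l then r ^ elev P.1 a.1 *~ sg a.2 else 0).
Proof.
rewrite /mv /= mxE mulz_row mxE eq_sym; congr (_ + _).
by case: ifP => // _; rewrite mul0rz.
Qed.

Lemma kap_even (q : int) : r ^ (2 * q) *~ sg (kap (2 * q)) = tau ^ q.
Proof. by rewrite (@kap_step _ q) ?subrr ?mulr1 //; lia. Qed.

Lemma kap_odd (q : int) : r ^ (2 * q - 1) *~ sg (kap (2 * q - 1)) = tau ^ (q - 1) * r.
Proof.
rewrite (@kap_step _ (q - 1)); last by lia.
by have -> : 2 * q - 1 - 2 * (q - 1) = 1 by lia.
Qed.

Lemma coord_odd' (q : int) : coord (2 * q - 1) = coord 1.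
Proof. by rewrite (_ : 2 * q - 1 = 2 * (q - 1) + 1) ?coord_odd //; lia. Qed.

Lemma mvl_even_x (P : lift) q e : P.1 = 2 * q ->
  [/\ (mvl P (false, e)).1 = 2 * (q + 1) - 1, pX (mvl P (false, e)) = pX P + tau ^ q *~ sg e
    & pY (mvl P (false, e)) = pY P].
Proof.
move=> PE; rewrite /pX /pY /mvl !coord_mv /lab PE parity_even /= /elev subr0 coord_even eqxx.
rewrite (negbTE coord01_neq) addr0 addbF sg_eqb mulrzA kap_even.
by split=> //; rewrite /sg PE; lia.
Qed.

Lemma mvl_even_y (P : lift) q e : P.1 = 2 * q ->
  [/\ (mvl P (true, e)).1 = 2 * q - 1, pX (mvl P (true, e)) = pX P
    & pY (mvl P (true, e)) = pY P + (tau ^ (q - 1) * r) *~ sg e].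
Proof.
move=> PE; rewrite /pX /pY /mvl !coord_mv /lab PE parity_even /= /elev /= coord_odd' eqxx.
rewrite eq_sym (negbTE coord01_neq) addr0 addbF sg_eqb mulrzA kap_odd.
by split=> //; rewrite /sg PE.
Qed.

Lemma mvl_odd_x (P : lift) q e : P.1 = 2 * q - 1 ->
  [/\ (mvl P (false, e)).1 = 2 * (q - 1), pX (mvl P (false, e)) = pX P - tau ^ (q - 1) *~ sg e
    & pY (mvl P (false, e)) = pY P].
Proof.
move=> PE; rewrite /pX /pY /mvl !coord_mv /lab PE parity_odd /= /elev /=.
have -> : 2 * q - 1 - 1 = 2 * (q - 1) by lia.
rewrite coord_even eqxx (negbTE coord01_neq) addr0 addbT sgN mulrNz sg_eqb mulrzA kap_even.
by split=> //; rewrite /sg PE; lia.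
Qed.

Lemma mvl_odd_y (P : lift) q e : P.1 = 2 * q - 1 ->
  [/\ (mvl P (true, e)).1 = 2 * q, pX (mvl P (true, e)) = pX P
    & pY (mvl P (true, e)) = pY P - (tau ^ (q - 1) * r) *~ sg e].
Proof.
move=> PE; rewrite /pX /pY /mvl !coord_mv /lab PE parity_odd /= /elev /= subr0 coord_odd' eqxx.
rewrite eq_sym (negbTE coord01_neq) addr0 addbT sgN mulrNz sg_eqb mulrzA kap_odd.
by split=> //; rewrite /sg PE; lia.
Qed.

Lemma lmvs_labw P w : lmvs P w = mvs P (labw kappa P.1 w).
Proof. by elim: w P => //= c w IH P; rewrite [RHS]IH. Qed.

Hypothesis tau2 : (tau - 1) *+ 2 = 0.

Lemma tau_sqr : tau ^+ 2 = 1.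
Proof. exact: double_sub1_sqr n_gt1 unit_tau tau2. Qed.

Lemma tau_mulz2 (z : int) : (tau - 1) *~ (2 * z) = 0.
Proof. by rewrite mulrzA -[_ *~ 2]/(_ *+ 2) tau2 mul0rz. Qed.

Lemma tau_mulz (a b : int) : (2 %| a - b)%Z -> (tau - 1) *~ a = (tau - 1) *~ b.
Proof.
case/dvdzP=> z E; rewrite -[a](subrK b) E mulrzDr [z * 2]mulrC tau_mulz2 add0r //.
Qed.

Lemma tau_exp (q : int) e : tau ^ q *~ sg e = (sg e)%:~R + (tau - 1) *~ (parity q)%:Z.
Proof.
have -> : tau ^ q = 1 + (tau - 1) *~ (parity q)%:Z.
  rewrite {1}(divz_eq q 2) mulrC exprzDr ?unit_tau // -exprz_exp -exprnP tau_sqr exp1rz mul1r.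
  have -> : (q %% 2)%Z = (parity q)%:Z by rewrite /parity; lia.
  by case: parity; rewrite ?mulr1z ?subrKC // ?mulr0z addr0.
rewrite mulrzDl; congr (_ + _); rewrite -mulrzA; apply: tau_mulz; case: e; rewrite /sg; lia.
Qed.

Local Notation u := (tau - 1).

Lemma u_add (a d c p a' c' : int) : a + d = a' -> (2 %| c + p - c')%Z ->
  (a%:~R + u *~ c) + (d%:~R + u *~ p) = a'%:~R + u *~ c'.
Proof. by move=> <- /tau_mulz <-; rewrite intrD mulrzDr addrACA. Qed.

Lemma u_sub (a d c p a' c' : int) : a - d = a' -> (2 %| c - p - c')%Z ->
  (a%:~R + u *~ c) - (d%:~R + u *~ p) = a'%:~R + u *~ c'.
Proof. by move=> <- /tau_mulz <-; rewrite intrB mulrzBr opprD addrACA. Qed.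

(** A step contributes +-tau^i, that is, +-1 plus u for odd i (times r in the second coordinate). As
    2 u = 0, only the parity of the number of corrections u counts, and the height determines it. *)
Lemma lmvs_formula w :
  [/\ (lmvs (0, 0) w).1 = 2 * qv w - (odd (size w))%:Z,
      pX (lmvs (0, 0) w) = (pv w (false, true) - pv w (false, false))%:~R + u *~ (qv w %/ 2)%Z
    & pY (lmvs (0, 0) w) = r * ((pv w (true, true) - pv w (true, false))%:~R
        + u *~ ((qv w - (odd (size w))%:Z) %/ 2)%Z)].
Proof.
elim/last_ind: w => [|w a [E1 EX EY]].
  split; rewrite /pX /pY /qv /= ?mxE ?subrr ?addr0 ?subr0 ?div0z ?mulr0z ?addr0 ?mulr0 //.
rewrite /lmvs foldl_rcons -/(lmvs _ _) /qv !pv_rcons size_rcons [odd _.+1]/=.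
move: E1 EX EY; rewrite /qv; move: (lmvs _ w) (pv w _) (pv w _) (pv w _) (pv w _) => P x x' y y'.
have qE : parity = (fun k : int => odd `|k|%N) by [].
case: (odd (size w)) => E1 EX EY; rewrite /psign [nat_of_bool (~~ _)]/=.
  case: a => [[] e].
    have [-> -> ->] := mvl_odd_y e E1; rewrite EX EY [tau ^ _ * r]mulrC -mulrzAr -mulrBr tau_exp.
    split.
    - case: e; rewrite /=; lia.
    - by congr (_ %:~R + _ *~ (_ %/ _)%Z); case: e; rewrite /=; lia.
    - by congr (_ * _); apply: u_sub; rewrite ?qE; case: e; rewrite /sg /=; lia.
  have [-> -> ->] := mvl_odd_x e E1; rewrite EX EY tau_exp; split.
  - case: e; rewrite /=; lia.
  - by apply: u_sub; rewrite ?qE; case: e; rewrite /sg /=; lia.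
  - by congr (_ * (_ %:~R + _ *~ (_ %/ _)%Z)); case: e; rewrite /=; lia.
have {}E1 : P.1 = 2 * (y' + y) by rewrite E1 subr0.
case: a => [[] e].
  have [-> -> ->] := mvl_even_y e E1; rewrite EX EY [tau ^ _ * r]mulrC -mulrzAr -mulrDr tau_exp; split.
  - case: e; rewrite /=; lia.
  - by congr (_ %:~R + _ *~ (_ %/ _)%Z); case: e; rewrite /=; lia.
  - by congr (_ * _); apply: u_add; rewrite ?qE; case: e; rewrite /sg /=; lia.
have [-> -> ->] := mvl_even_x e E1; rewrite EX EY tau_exp; split.
- case: e; rewrite /=; lia.
- by apply: u_add; rewrite ?qE; case: e; rewrite /sg /=; lia.
- by congr (_ * (_ %:~R + _ *~ (_ %/ _)%Z)); case: e; rewrite /=; lia.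
Qed.

Lemma lmvs_closed w : ~~ odd (size w) -> pr (lmvs (0, 0) w) = pr (0, 0) <->
  [/\ (m %| qv w)%Z, (pv w (false, true) - pv w (false, false))%:~R + u *~ (qv w %/ 2)%Z = 0
    & (pv w (true, true) - pv w (true, false))%:~R + u *~ (qv w %/ 2)%Z = 0].
Proof.
move=> ew; have [E1 EX EY] := lmvs_formula w; rewrite (negbTE ew) !subr0 in E1 EY.
have levE : ((2 * qv w)%:~R == 0 :> 'Z_(m * s)) = (m %| qv w)%Z.
  by rewrite intr_Zms s2 abszM mulnC dvdn_pmul2l.
split.
  move=> E; have := congr1 snd E; have := congr1 fst E => /= L V.
  rewrite E1 in L; rewrite -levE L eqxx; split=> //.
    by rewrite -EX /pX V mxE.
  by apply: (mulrI r_unit); rewrite -EY mulr0 /pY V mxE.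
case=> mq X0 Y0; have V0 : (lmvs (0, 0) w).2 = 0.
  apply/rowP=> l; rewrite [RHS]mxE; case: (coord01 l) => ->.
    by rewrite -/(pX _) EX.
  by rewrite -/(pY _) EY Y0 mulr0.
rewrite /pr V0 E1; congr (_, _); apply/eqP; by rewrite levE.
Qed.

End Labels.

Arguments mvl kappa P c : simpl never.

(** * Consequences of 2-arc-transitivity *)

Section TwoArc.
Hypothesis tG : two_arc_transitive (component x0).

Lemma two_arc_eqv P a b P' a' b' :
    C (pr P) -> C (pr P') -> redw [:: a; b] -> redw [:: a'; b'] ->
  eqv (vs P [:: a; b]) (vs P' [:: a'; b']).
Proof.
move=> CP CP' /andP[ab _] /andP[ab' _].
have arc2 Q c d : nb c d -> two_arc (pr Q) (pr (mv Q c)) (pr (mv (mv Q c) d)).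
  by move=> cd; rewrite /two_arc !pr_mv_adj vs2_neq.
have [F FA [F0 F1 F2]] := two_arc_transitive_caut tG (C_mv a CP) (C_mv a' CP') (arc2 P _ _ ab) (arc2 P' _ _ ab').
by exists F => //; rewrite /vs /= F0 F1 F2.
Qed.

Lemma ext_img F P a b c P' a' b' : caut F -> C (pr P) -> redw [:: a; b; c] ->
    map F (vs P [:: a; b]) = vs P' [:: a'; b'] ->
  exists2 c', nb b' c' & map F (vs P [:: a; b; c]) = vs P' [:: a'; b'; c'].
Proof.
move=> FA CP rw E; have F0 : F (pr P) = pr P' := congr1 (fun z => nth x0 z 0) E.
have F1 : F (pr (mv P a)) = pr (mv P' a') := congr1 (fun z => nth x0 z 1) E.
have [w rw' [sw E']] := vs_img1 FA CP F0 F1 rw.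
case: w sw rw' E' => [|b1 [|c1 []]] // _ rw' E'.
have F2 : F (pr (mv (mv P a) b)) = pr (mv (mv P' a') b') := congr1 (fun z => nth x0 z 2) E.
have bb : b1 = b'.
  apply: (@pr_mv_inj (mv P' a')); rewrite -F2; exact/esym/(congr1 (fun z => nth x0 z 2) E').
by rewrite bb in rw' E'; exists c1 => //; case/and3P: rw'.
Qed.

(* The images of the alternating 3-arcs. *)
Definition zig (xs : seq G) :=
  exists P a b c, [/\ C (pr P), redw [:: a; b; c], a.1 != b.1, b.1 != c.1
    & eqv (vs P [:: a; b; c]) xs].

Lemma refl_turn P a b c : C (pr P) -> a.1 != b.1 -> b.1 = c.1 ->
  eqv (vs P [:: a; b; c]) (vs P [:: a; b; lbar c]).
Proof.
move=> CP ab bc; have [|F FA E] := @refl_last P [:: a; b] c CP; last by exists F.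
have bE : b.1 = ~~ a.1 by case: (a.1) (b.1) ab => [] [].
rewrite /avoids /= /mvs /= /mv /= -bc bE elev_turn sgN addrK; by rewrite coord_elevN.
Qed.

(** An exceptional automorphism takes the turning extension of an alternating 2-arc to a straight
    one, so it takes the two straight extensions, equivalent by a reflection, to the other straight
    one and the turning one. The straight ones are equivalent by a reflection too, so all three are;
    2-arc-transitivity spreads this to all 3-arcs. *)
Lemma three_arc_or_zigzag :
  (forall P w P' w', C (pr P) -> C (pr P') -> redw w -> redw w' -> size w = 3%N -> size w' = 3%N ->
    eqv (vs P w) (vs P' w')) \/
  (forall P a b c, C (pr P) -> redw [:: a; b; c] -> a.1 != b.1 -> b.1 = c.1 ->
    ~ zig (vs P [:: a; b; c])).
Proof.
have [ex|nex] := classic (exists P a b c, [/\ C (pr P), redw [:: a; b; c], a.1 != b.1, b.1 = c.1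
   & zig (vs P [:: a; b; c])]); last first.
  by right=> P a b c CP rw ab bc z; apply: nex; exists P, a, b, c.
left; have [P [a [b [c [CP rw ab bc zc]]]]] := ex.
have [P0 [a0 [b0 [c0 [CP0 rw0 ab0 bc0 [F FA FE]]]]]] := zc.
have [nab nbc] : nb a b /\ nb b c by case/and3P: rw.
have [nab0 nbc0] : nb a0 b0 /\ nb b0 c0 by case/and3P: rw0.
have FE2 : map F (vs P0 [:: a0; b0]) = vs P [:: a; b].
  exact: (congr1 (take 3) FE).
have CE Q w : C (pr Q) -> all C (vs Q w) by exact: C_vs.
pose ct := (~~ b.1, b.2).
have nct : nb b ct by rewrite /ct; case: (b) => [[] []].
pose g := (b0.1, true); pose g' := (b0.1, false).
have ng : nb b0 g by rewrite /g; case: (b0) => [[] []].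
have ng' : nb b0 g' by rewrite /g'; case: (b0) => [[] []].
have gg' : eqv (vs P0 [:: a0; b0; g]) (vs P0 [:: a0; b0; g']).
  exact: (refl_turn (c := g)).
have FE' d : nb b0 d -> exists2 d', nb b d' & map F (vs P0 [:: a0; b0; d]) = vs P [:: a; b; d'].
  by move=> nd; apply: ext_img FE2 => //; rewrite /redw /= nab0 nd.
have inj d d' e : nb b0 d -> nb b0 d' -> map F (vs P0 [:: a0; b0; d]) = vs P [:: a; b; e] ->
    map F (vs P0 [:: a0; b0; d']) = vs P [:: a; b; e] -> d = d'.
  move=> nd nd' <- E; apply: (@pr_mv_inj (mv (mv P0 a0) b0)).
  by apply: (caut_inj FA); rewrite ?C_mv //; exact/esym/(congr1 (fun z => nth x0 z 3) E).
have all_ext d : nb b d -> eqv (vs P0 [:: a0; b0; c0]) (vs P [:: a; b; d]).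
  move=> nd; have cc : c0 <> g /\ c0 <> g' by rewrite /g /g'; case: (b0) (c0) bc0 => [[] []] [[] []].
  have c0F : eqv (vs P0 [:: a0; b0; c0]) (vs P [:: a; b; c]) by exists F.
  have c0F' : eqv (vs P0 [:: a0; b0; c0]) (vs P [:: a; b; lbar c]).
    exact: eqv_trans c0F (refl_turn CP ab bc).
  have dE : [\/ d = c, d = lbar c | d = ct].
    rewrite /ct; case: (b) (c) (d) bc nd => [[] []] [[] []] [[] []] //= _ _;
      first [by constructor 1 | by constructor 2 | by constructor 3].
  case: dE => -> //.
  have [h nh hE] := FE' g ng; have [h' nh' hE'] := FE' g' ng'.
  have hc : h <> c by move=> E; rewrite E in hE; have [] := cc; move: (inj _ _ _ nbc0 ng FE hE).
  have hc' : h' <> c by move=> E; rewrite E in hE'; have [] := cc; move: (inj _ _ _ nbc0 ng' FE hE').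
  have hh' : h <> h' by move=> E; rewrite -E in hE'; move: (inj _ _ _ ng ng' hE hE').
  have gh : eqv (vs P0 [:: a0; b0; g]) (vs P [:: a; b; h]) by exists F.
  have gh' : eqv (vs P0 [:: a0; b0; g']) (vs P [:: a; b; h']) by exists F.
  have hh : eqv (vs P [:: a; b; h]) (vs P [:: a; b; h']).
    by apply: eqv_trans gh'; apply: eqv_trans gg'; apply: eqv_sym gh; exact: CE.
  (* [F] sends [c0] to [c], so [g] and [g'] go to the two remaining extensions in some order. *)
  have [[h1 h2]|[h1 h2]] : (h = ct /\ h' = lbar c) \/ (h = lbar c /\ h' = ct).
    move: nh nh' hc hc' hh'; rewrite /ct; case: (b) (c) (h) (h') bc => [[] []] [[] []] [[] []] [[] []] //= _ _ _ *;
    first [by left | by right].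
    rewrite h1 h2 in hh; apply: eqv_trans c0F' _; apply: eqv_sym hh; exact: CE.
  by rewrite h1 h2 in hh; apply: eqv_trans c0F' hh.
have all3 Q w : C (pr Q) -> redw w -> size w = 3%N -> eqv (vs P0 [:: a0; b0; c0]) (vs Q w).
  case: w => [|a1 [|b1 [|c1 []]]] // CQ rw1 _.
  have rw2 : redw [:: a1; b1] by case/and3P: rw1 => H _ _; rewrite /redw /= H.
  have rwab : redw [:: a; b] by rewrite /redw /= nab.
  have [F1 F1A F1E] := two_arc_eqv CQ CP rw2 rwab.
  have [d nd F1E'] := ext_img F1A CQ rw1 F1E.
  apply: eqv_trans (all_ext d nd) _; apply: eqv_sym; first exact: CE.
  by exists F1.
move=> Q w Q' w' CQ CQ' rw1 rw1' sw sw'; apply: eqv_trans (all3 _ _ CQ' rw1' sw').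
by apply: eqv_sym (all3 _ _ CQ rw1 sw); exact: CE.
Qed.

Lemma zig_eqv xs ys : zig xs -> eqv xs ys -> zig ys.
Proof.
case=> P [a [b [c [CP rw ab bc E]]]] E'; exists P, a, b, c; split=> //; exact: eqv_trans E E'.
Qed.

Lemma zig_turn P a b c : C (pr P) -> redw [:: a; b; c] -> a.1 != b.1 -> b.1 != c.1 ->
  zig (vs P [:: a; b; c]).
Proof. by move=> CP rw ab bc; exists P, a, b, c; split=> //; exact: eqv_refl. Qed.

Lemma zig_rev P a b c : zig (vs P [:: a; b; c]) ->
  zig (vs (mvs P [:: a; b; c]) [:: linv c; linv b; linv a]).
Proof.
case=> Q [a' [b' [c' [CQ rw ab bc E]]]].
exists (mvs Q [:: a'; b'; c']), (linv c'), (linv b'), (linv a'); split.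
- exact: C_mvs.
- exact: (redw_rev rw).
- by rewrite /= (inj_eq negb_inj) eq_sym.
- by rewrite /= (inj_eq negb_inj) eq_sym.
- by move/eqv_rev: E; rewrite !rev_vs.
Qed.

Hypothesis no_TS : forall P a b c, C (pr P) -> redw [:: a; b; c] -> a.1 != b.1 -> b.1 = c.1 ->
  ~ zig (vs P [:: a; b; c]).

Lemma zig_ext P a b : C (pr P) -> redw [:: a; b] ->
  exists2 c, nb b c & zig (vs P [:: a; b; c]).
Proof.
move=> CP rw; pose u := (true, true); pose d := (false, true).
have [F FA FE] := two_arc_eqv C0 CP (isT : redw [:: u; d]) rw.
have [c nc E] := ext_img FA C0 (isT : redw [:: u; d; u]) FE.
by exists c => //; exists (0, 0), u, d, u; split=> //; exists F.
Qed.

(** Move the 2-arc to up-down: its straight extensions are excluded by [no_TS], and there is a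
    single turning one. *)
Lemma zig_unique P a b c c' : C (pr P) -> redw [:: a; b] -> nb b c -> nb b c' ->
  zig (vs P [:: a; b; c]) -> zig (vs P [:: a; b; c']) -> c = c'.
Proof.
move=> CP rw nc nc' z z'; pose u := (true, true); pose d := (false, true).
have nab : nb a b by case/andP: rw.
have [F FA FE] := two_arc_eqv CP C0 rw (isT : redw [:: u; d]).
have key e : nb b e -> zig (vs P [:: a; b; e]) -> map F (vs P [:: a; b; e]) = vs (0, 0) [:: u; d; u].
  move=> ne ze; have rwe : redw [:: a; b; e] by rewrite /redw /= nab ne.
  have [e' ne' E] := ext_img FA CP rwe FE.
  have [e'u|e'd] := boolP e'.1; first by rewrite E; congr (vs _ [:: _; _; _]); case: (e') ne' e'u => [[] []].
  case: (no_TS (P := (0, 0)) (a := u) (b := d) (c := e')) => //.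
  - by rewrite /redw /= ne'.
  - by case: (e') e'd => [[] []].
  - by apply: zig_eqv ze _; exists F.
apply: (@pr_mv_inj (mv (mv P a) b)); apply: (caut_inj FA); rewrite ?C_mv //.
have E : map F (vs P [:: a; b; c]) = map F (vs P [:: a; b; c']) by rewrite !key.
exact: (congr1 (fun z => nth x0 z 3) E).
Qed.

(** If the extension turned, the reversed 3-arc would turn first and then go straight, against
    [no_TS]. *)
Lemma zig_straight P a b : C (pr P) -> redw [:: a; b] -> a.1 = b.1 ->
  exists2 c, c.1 = b.1 & zig (vs P [:: a; b; c]).
Proof.
move=> CP rw ab; have nab : nb a b by case/andP: rw.
have [c nc z] := zig_ext CP rw; exists c => //; apply/eqP/negPn/negP => bc.
apply: no_TS (zig_rev z); [exact: C_mvs | | |by rewrite /= ab].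
  by apply: (@redw_rev [:: a; b; c]); rewrite /redw /= nab nc.
by rewrite /= (inj_eq negb_inj).
Qed.

(** For s >= 3 the third edge of a straight walk lies in a new coordinate; reflecting that
    coordinate would give a second extension of the same 2-arc. *)
Lemma zig_s_eq2 : s = 2%N.
Proof.
apply/eqP; rewrite eqn_leq s_ge2 andbT leqNgt; apply/negP => s3.
pose u := (true, true).
have [[c1 c2] /= -> z] := zig_straight C0 (isT : redw [:: u; u]) erefl.
have [|F FA E] := @refl_last (0, 0) [:: u; u] (true, c2) C0.
  by rewrite /avoids /mvs /= /mv /= !coord_neq //; rewrite /elev /sg /=; lia.
have z' : zig (vs (0, 0) [:: u; u; (true, ~~ c2)]) by apply: zig_eqv z _; exists F.
have nu e : nb u (true, e) by [].
by have [] := zig_unique C0 (isT : redw [:: u; u]) (nu _) (nu _) z z'; case: c2 {z z' E}.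
Qed.

(** * The shift automorphism and the sign rule for s = 2 *)

Hypothesis s2 : s = 2%N.

(** For s = 2, [rev_ord] swaps the coordinates; together with the factor r this takes the steps of
    level k to those of level k + 1. *)
Definition shift_vec (w v : 'rV['Z_n]_s) : 'rV['Z_n]_s := \row_j (r * v 0 (rev_ord j)) + w.

Definition shift (w : 'rV['Z_n]_s) (P : lift) : lift := (P.1 + 1, shift_vec w P.2).

Lemma rev_coord k j : (rev_ord j == coord k) = (j == coord (k + 1)).
Proof.
rewrite -!val_eqE /=; move: (ltn_ord j); move: (nat_of_ord j) => i; rewrite s2.
by case: i => [|[|]] //; lia.
Qed.

Lemma shift_mv w P a : shift w (mv P a) = mv (shift w P) a.
Proof.
case: P => k v; rewrite /shift /mv /=; congr (_, _); first by rewrite addrAC.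
apply/rowP=> j; rewrite /shift_vec !mxE !mulz_row !mxE rev_coord.
have -> : elev (k + 1) a.1 = elev k a.1 + 1 by rewrite /elev; lia.
rewrite mulrDr mulrzAr addrAC; congr (_ + _ + _ *~ _).
by case: ifP => _; rewrite ?mulr0 // exprzDr // mulrC.
Qed.

Lemma shift_caut P P' : C (pr P) -> C (pr P') -> P'.1 = P.1 + 1 ->
  exists2 F, caut F & forall w, map F (vs P w) = vs P' w.
Proof.
move=> CP CP' PP'; pose w := P'.2 - shift_vec 0 P.2.
pose h (x : G) : G := (x.1 + 1, shift_vec w x.2).
have hE Q : h (pr Q) = pr (shift w Q) by rewrite /h /pr /= intrD.
have sP : shift w P = P'.
  rewrite /shift -PP' [RHS]surjective_pairing; congr (_, _).
  apply/rowP=> j; rewrite !mxE; ring.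
have h_inj : injective h.
  move=> [i v] [i' v'] E; have /addIr -> := congr1 fst E : i + 1 = i' + 1.
  congr (_, _); apply/rowP=> j; have /addIr/rowP/(_ (rev_ord j)) := congr1 snd E : shift_vec w v = shift_vec w v'.
  by rewrite !mxE rev_ordK => /(mulrI r_unit).
have hvs u Q : map h (vs Q u) = vs (shift w Q) u.
  elim: u Q => [|a u IH] Q; first by rewrite /vs /= hE.
  by rewrite !vs_cons map_cons hE IH shift_mv.
exists h => [|u]; last by rewrite hvs sP.
apply: (caut_restrict (x := pr P)) => //; last by rewrite hE sP.
apply: (@lift_aut (shift w)) => // Q a; exists a; exact: shift_mv.
Qed.

Fixpoint flipw (l : 'I_s) (k : int) (w : seq letter) : seq letter :=
  if w is a :: w' then (if coord (elev k a.1) == l then lbar a else a) :: flipw l (k + sg a.1) w'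
  else [::].

Lemma zig_flip l P w : C (pr P) -> zig (vs P w) -> zig (vs P (flipw l P.1 w)).
Proof.
move=> CP z; have [FA _] := refl_caut CP (erefl (P.2 0 l)).
apply: zig_eqv z _; exists (refl l (P.2 0 l)) => //.
have flipE Q u c : map (refl l c) (vs Q u) = vs (refl_lift l c Q) (flipw l Q.1 u).
  elim: u Q => [|a u IH] Q //; rewrite vs_cons map_cons IH refl_mv [flipw _ _ (_ :: _)]/= vs_cons.
  by case: ifP.
rewrite flipE; congr (vs _ _); case: (P) => k v; congr (_, _); apply/rowP=> j; rewrite !mxE.
by case: eqP => // ->; rewrite mulr2n addrK.
Qed.

(** Reflecting the coordinate of the outer edges reverses their two signs together, and reflecting
    the other coordinate reverses the middle sign alone. So the product of the outer signs is
    constant; shifts carry it to all levels and reversal to downward walks. *)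
Lemma zig_ratio : exists kappa : bool, forall P u e0 e1, C (pr P) ->
  zig (vs P [:: (u, e0); (u, e1); (u, e0 == kappa)]).
Proof.
have [[u kappa] /= -> z0] := zig_straight C0 (isT : redw [:: Up; Up]) erefl.
exists kappa.
have flips P e0 e1 e2 : C (pr P) -> zig (vs P [:: (true, e0); (true, e1); (true, e2)]) ->
    zig (vs P [:: (true, ~~ e0); (true, e1); (true, ~~ e2)]) /\
    zig (vs P [:: (true, e0); (true, ~~ e1); (true, e2)]).
  move=> CP z; have c02 : coord (P.1 + 1 + 1) = coord P.1.
    apply/eqP; rewrite coord_eq eqz_mod_dvd (_ : _ - _ = 2); last by ring.
    by rewrite s2.
  have c01 : coord (P.1 + 1) != coord P.1.
    by have := coord_pred (P.1 + 1); rewrite addrK.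
  split.
    have := zig_flip (coord P.1) CP z.
    by rewrite /= /elev !subr0 c02 eqxx (negbTE c01).
  have := zig_flip (coord (P.1 + 1)) CP z.
  by rewrite /= /elev !subr0 c02 eqxx eq_sym (negbTE c01).
pose Z P := forall e0 e1, zig (vs P [:: (true, e0); (true, e1); (true, e0 == kappa)]).
have Zup P : C (pr P) -> zig (vs P [:: Up; Up; (true, kappa)]) -> Z P.
  move=> CP z; have [z1 z2] := flips _ _ _ _ CP z; have [_ z3] := flips _ _ _ _ CP z1.
  have kE : (true == kappa) = kappa by case: (kappa).
  have kE' : (false == kappa) = ~~ kappa by case: (kappa).
  by case=> [] []; rewrite ?kE ?kE'.
have Zshift P P' : C (pr P) -> C (pr P') -> P'.1 = P.1 + 1 -> (Z P -> Z P') /\ (Z P' -> Z P).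
  move=> CP CP' /(shift_caut CP CP')[F FA FE]; split=> H e0 e1.
    by apply: zig_eqv (H e0 e1) _; exists F.
  apply: zig_eqv (H e0 e1) _; apply: eqv_sym; first exact: C_vs.
  by exists F.
have ZU P : C (pr P) -> Z P.
  have [k] : exists k, k = P.1 by exists P.1.
  elim/int_ind: k P => [|k IH|k IH] P PE CP.
  - have P1 : (mv (0, 0) Up).1 = P.1 + 1 by rewrite -PE.
    apply: (proj2 (Zshift P (mv (0, 0) Up) CP (C_mv _ C0) P1)).
    have P01 : (mv (0, 0) Up).1 = (0, 0 : 'rV['Z_n]_s).1 + 1 by [].
    exact: (proj1 (Zshift (0, 0) (mv (0, 0) Up) C0 (C_mv Up C0) P01) (Zup (0, 0) C0 z0)).
  - have P1 : P.1 = (mv P Dn).1 + 1 by rewrite /mv /= /sg subrK.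
    apply: (proj1 (Zshift (mv P Dn) P (C_mv _ CP) CP P1)).
    by apply: IH (C_mv _ CP); rewrite /mv /= -PE /sg; lia.
  - have P1 : (mv P Up).1 = P.1 + 1 by [].
    apply: (proj2 (Zshift P (mv P Up) CP (C_mv _ CP) P1)).
    by apply: IH (C_mv _ CP); rewrite /mv /= -PE /sg; lia.
move=> P [] e0 e1 CP; first exact: ZU.
pose Q := mvs P [:: (false, e0); (false, e1); (false, e0 == kappa)].
have := zig_rev (ZU Q (C_mvs _ CP) (~~ (e0 == kappa)) (~~ e1)).
have -> : (~~ (e0 == kappa) == kappa) = ~~ e0 by case: (e0) (kappa) => [] [].
rewrite /linv /= !negbK; congr (zig (vs _ _)).
by rewrite /Q /mvs /=; rewrite -![(true, ~~ _)]/(linv (false, _)) !mvK.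
Qed.

(** * Automorphisms permute the labels *)

Section Rigid.
Variable kappa : bool.
Hypothesis zigK : forall P u e0 e1, C (pr P) ->
  zig (vs P [:: (u, e0); (u, e1); (u, e0 == kappa)]).
Local Notation mvk := (mvl kappa).
Local Notation lmk := (lmvs kappa).
Local Notation labk := (lab kappa).
Local Notation o := ((0, 0) : lift).

Lemma nb_lab P a b : a != b -> nb (labk P.1 a) (labk (mvk P a).1 b).
Proof.
by move=> ab; rewrite /nb -lab_mvl (inj_eq (@lab_inj kappa _)) eq_sym.
Qed.

Lemma kap_shift j u : kap kappa (j + sg u + sg u) = (kap kappa j == kappa).
Proof.
rewrite /kap; case: kappa => //=; rewrite eqbF_neg negbK.
by rewrite /parity; case: u; rewrite /sg; lia.
Qed.

Lemma lab1 k c : (labk k c).1 = (c.1 == parity k). Proof. by []. Qed.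

Lemma lab2 k c : (labk k c).2 = (c.2 == kap kappa (elev k (labk k c).1)) (+) parity k.
Proof. by []. Qed.

Lemma mvl_level P c : (mvk P c).1 = P.1 + sg (labk P.1 c).1. Proof. by []. Qed.

(** If a and b belong to levels of the same parity, the walk alternates; otherwise it is straight
    and [kap] has been chosen to follow [zigK]. *)
Lemma zig_label P a b : a != b -> C (pr P) ->
  zig (vs P [:: labk P.1 a; labk (mvk P a).1 b; labk (mvk (mvk P a) b).1 a]).
Proof.
move=> ab CP; have n1 := nb_lab P ab; have n2 : nb (labk (mvk P a).1 b) (labk (mvk (mvk P a) b).1 a).
  by apply: nb_lab; rewrite eq_sym.
have pA : parity (mvk P a).1 = ~~ parity P.1 by rewrite mvl_level parity_sg.
have pB : parity (mvk (mvk P a) b).1 = parity P.1 by rewrite mvl_level parity_sg pA negbK.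
have [ab1|ab1] := eqVneq a.1 b.1.
  apply: zig_turn => //; first by rewrite /redw /= n1 n2.
    by rewrite !lab1 pA -ab1; case: (a.1) (parity P.1) => [] [].
  by rewrite !lab1 pA pB -ab1; case: (a.1) (parity P.1) => [] [].
have b1E : b.1 = ~~ a.1 by case: (a.1) (b.1) ab1 => [] [].
set l1 := labk P.1 a; set l2 := labk _ b; set l3 := labk _ a.
have l2E : l2 = (l1.1, l2.2).
  rewrite [LHS]surjective_pairing; congr (_, _).
  by rewrite /l2 /l1 !lab1 pA b1E; case: (a.1) (parity P.1) => [] [].
have l3E : l3 = (l1.1, l1.2 == kappa).
  have l31 : l3.1 = l1.1 by rewrite /l3 /l1 !lab1 pB.
  rewrite [LHS]surjective_pairing; congr (_, _) => //.
  have kE : (mvk (mvk P a) b).1 = P.1 + sg l1.1 + sg l1.1.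
    by rewrite mvl_level -/l2 l2E mvl_level.
  rewrite /l3 lab2 -/l3 l31 pB kE.
  rewrite elev_shift.
  have l12 : l1.2 = (a.2 == kap kappa (elev P.1 l1.1)) (+) parity P.1 by [].
  rewrite kap_shift l12.
  by case: (a.2) (parity _) (kappa) (kap _ _) => [] [] [] [].
by rewrite l2E l3E [l1]surjective_pairing; apply: zigK.
Qed.

Lemma vs_lab2 P a b : vs P [:: labk P.1 a; labk (mvk P a).1 b] =
  [:: pr P; pr (mvk P a); pr (mvk (mvk P a) b)].
Proof. by []. Qed.

(** By induction on the word: the unique extension of a 2-arc labelled a b is labelled a, and
    automorphisms respect it, so the permutation of labels at one vertex passes on to the next. *)
Lemma label_perm F : caut F -> F (pr o) = pr o ->
  exists pi : letter -> letter, [/\ injective pi,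
    forall c, F (pr (mvk o c)) = pr (mvk o (pi c))
    & forall w, F (pr (lmk o w)) = pr (lmk o (map pi w))].
Proof.
move=> FA Fo.
have ex c : exists c', F (pr (mvk o c)) = pr (mvk o c').
  apply/(adj_mvlP kappa o); rewrite -{1}Fo (caut_adj FA) ?C_mvl ?C0 //.
  by apply/(adj_mvlP kappa o); exists c.
have [pi piE] := fin_all_exists ex.
have pi_inj : injective pi.
  move=> c c' /(congr1 (fun c => pr (mvk o c))); rewrite -!piE => /(caut_inj FA).
  by move=> /(_ (C_mvl _ _ C0) (C_mvl _ _ C0)) /pr_mvl_inj.
exists pi; split=> // w.
suff [] : F (pr (lmk o w)) = pr (lmk o (map pi w)) /\
    forall c, F (pr (mvk (lmk o w) c)) = pr (mvk (lmk o (map pi w)) (pi c)) by [].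
elim/last_ind: w => [|w b [E1 E2]]; first by split.
rewrite map_rcons /lmvs !foldl_rcons -/(lmk _ _) -/(lmk _ (map pi w)).
move: (C_lmvs kappa w C0) (C_lmvs kappa (map pi w) C0) E1 E2.
move: (lmk o w) (lmk o (map pi w)) => P P' CP CP' E1 E2.
split; first exact: E2.
move=> a; have [->|ab] := eqVneq a b; first by rewrite !mvlK.
have pab : pi a != pi b by rewrite (inj_eq pi_inj).
pose Q := mvk P a; pose Q' := mvk P' (pi a).
have CQ : C (pr Q) by exact: C_mvl. have CQ' : C (pr Q') by exact: C_mvl.
have z := zig_label ab CQ; have z' := zig_label pab CQ'.
have QP : mvk Q a = P by rewrite mvlK. have QP' : mvk Q' (pi a) = P' by rewrite mvlK.
have F2 : map F (vs Q [:: labk Q.1 a; labk (mvk Q a).1 b]) =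
    vs Q' [:: labk Q'.1 (pi a); labk (mvk Q' (pi a)).1 (pi b)].
  rewrite !vs_lab2 QP QP'.
  by congr [:: _; _; _]; [exact: E2 | exact: E1 | exact: E2].
have rw : redw [:: labk Q.1 a; labk (mvk Q a).1 b; labk (mvk (mvk Q a) b).1 a].
  by apply: redw3; apply: nb_lab; rewrite // eq_sym.
have [c' nc' E'] := ext_img FA CQ rw F2.
have := zig_eqv z (ex_intro2 _ _ F FA E') => z2.
have c'E : c' = labk (mvk (mvk Q' (pi a)) (pi b)).1 (pi a).
  apply: (zig_unique CQ' _ nc' _ z2 z'); first by apply/redw2/nb_lab.
  by apply: nb_lab; rewrite eq_sym.
have E3 : F (pr (mvk (mvk (mvk Q a) b) a)) = pr (mv (mvk (mvk Q' (pi a)) (pi b)) c').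
  exact: (congr1 (fun z => nth x0 z 3) E').
by rewrite QP QP' in c'E E3; rewrite E3 c'E.
Qed.

Lemma two_arc_labels a b a' b' : a != b -> a' != b' ->
  exists pi : letter -> letter, [/\ injective pi, pi a = a', pi b = b'
    & forall w, pr (lmk o w) = pr o -> pr (lmk o (map pi w)) = pr o].
Proof.
move=> ab ab'.
have arc c d : c != d -> two_arc (pr (mvk o c)) (pr o) (pr (mvk o d)).
  move=> cd; rewrite /two_arc adj_sym !pr_mv_adj /=.
  by apply: contra cd => /eqP/pr_mvl_inj->.
have [F FA [F0 F1 F2]] := two_arc_transitive_caut tG C0 C0 (arc _ _ ab) (arc _ _ ab').
have [pi [pi_inj piE piw]] := label_perm FA F1.
exists pi; split=> //.
- by apply/esym/(@pr_mvl_inj kappa o); rewrite -piE F0.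
- by apply/esym/(@pr_mvl_inj kappa o); rewrite -piE F2.
- by move=> w E; rewrite -piw E.
Qed.

Local Notation l0 := (false, true).
Local Notation l1 := (false, false).
Local Notation l2 := (true, true).
Local Notation l3 := (true, false).

(** The commutator of the double steps [0 1] and [2 3] closes for all parameters; its image when 0,
    1 go to 0, 2 closes only if 2 (1 - tau) = 0. *)
Lemma rigid_tau2 : (tau kappa - 1) *+ 2 = 0.
Proof.
pose w := [:: l0; l1; l2; l3; l1; l0; l3; l2].
have ww : pr (lmk o w) = pr o.
  have V0 : (mvs o (labw kappa 0 w)).2 = 0 by apply: mvs_vec0; case: (kappa); vm_compute.
  have L0 : net (labw kappa 0 w) = 0 by case: (kappa).
  by rewrite lmvs_labw [mvs _ _]surjective_pairing V0 mvs_level L0.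
have [pi [pi_inj pi0 pi1 piw]] := two_arc_labels (isT : l0 != l1) (isT : l0 != l2).
have pi23 : (pi l2 = l1 /\ pi l3 = l3) \/ (pi l2 = l3 /\ pi l3 = l1).
  have ne c d : c != d -> pi c != pi d by rewrite (inj_eq pi_inj).
  have := ne l2 l0 isT; have := ne l2 l1 isT; have := ne l3 l0 isT; have := ne l3 l1 isT; have := ne l2 l3 isT.
  by rewrite pi0 pi1; case: (pi l2) (pi l3) => [[] []] [[] []] //; [right|left].
have E := piw _ ww.
have closed u : (size u <= 8)%N -> map pi w = u -> heval (r ^+ s) (shape 2 (labw kappa 0 u) 0) = 0.
  move=> su wu; rewrite wu lmvs_labw in E.
  have sl : (size (labw kappa 0 u) <= 8)%N.
    suff -> : size (labw kappa 0 u) = size u by [].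
    by elim: (u) (0 : int) => //= c v IH k; rewrite IH.
  have := shape_eq0 (Ordinal s_gt0) sl; rewrite (congr1 snd E : (mvs _ _).2 = 0) mxE eqxx => /eqP.
  by rewrite {2}s2.
have [x xE] : exists x : bool, heval (r ^+ s) (if x then [:: 2; - 2 * sg kappa] else [:: - 2 * sg kappa; 2]) = 0.
  case: pi23 => -[p2 p3].
    exists true; have := @closed [:: l0; l2; l1; l3; l2; l0; l3; l1] isT.
    rewrite /w /= pi0 pi1 p2 p3 => /(_ erefl) <-; congr (heval _ _).
    by case: (kappa); vm_compute.
  exists false; have := @closed [:: l0; l2; l3; l1; l2; l0; l1; l3] isT.
  rewrite /w /= pi0 pi1 p2 p3 => /(_ erefl) <-; congr (heval _ _).
  by case: (kappa); vm_compute.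
have tE : r ^+ s = (sg kappa)%:~R * tau kappa by rewrite /tau mulrA sg_sqr mul1r s2.
have t2 : 2%:~R - 2%:~R * tau kappa = 0.
  move: xE; rewrite /heval; case: (x) => /=; rewrite mulr0 addr0 tE; move: (tau kappa) => T.
    by move=> <-; case: (kappa); rewrite /sg; ring.
  move=> xE; transitivity (- (sg kappa)%:~R * ((- 2 * sg kappa)%:~R + (sg kappa)%:~R * T * 2%:~R) : 'Z_n).
    by case: (kappa); rewrite /sg; ring.
  by rewrite xE mulr0.
rewrite -mulr_natr -[LHS]opprK -[RHS]oppr0 -t2; congr (- _); move: (tau kappa) => T; ring.
Qed.

Lemma rigid_cases : n != 4%N ->
  [/\ n = m, odd n & r ^+ 2 = 1 \/ r ^+ 2 = -1] \/
  [/\ n = (2 * m)%N, m = 2 %[mod 4] & 1 + r ^+ 2 = m%:R].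
Proof.
move=> n4; have r_m2 : r ^+ (m * 2) = 1 \/ r ^+ (m * 2) = -1 by move: r_ms; rewrite s2.
apply: (@closedw_perm_cases m n r kappa) => //; first exact: rigid_tau2.
move=> a b a' b' ab ab'; have [pi [pi_inj pia pib piw]] := two_arc_labels ab ab'.
exists pi; split=> // w ew /(lmvs_closed s2 rigid_tau2 ew)/piw.
by move/(lmvs_closed s2 rigid_tau2); rewrite size_map; apply.
Qed.

End Rigid.

End TwoArc.

Lemma small_dvd (c : int) : n != 4%N -> c \in small -> (n %| `|c|)%N = false.
Proof.
move=> n4 cs; apply/negP => nc; have : (n %| 4)%N.
  by apply: dvdn_trans nc _; move: cs; rewrite !inE; do 5 ?[case/predU1P=> [->//|]] => /eqP->.
move=> nd; have := dvdn_leq (isT : (0 < 4)%N) nd; have := n_ge3; case: (n =P 3) nd => [->//|]; lia.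
Qed.

Lemma smalls_neq0 (t : 'Z_n) L : n != 4%N -> L \in smalls -> heval t L <> 0.
Proof.
move=> n4 /mapP[c cs ->]; rewrite heval1 => /eqP.
by rewrite intr_Zp_eq0 ?n_gt1 // small_dvd.
Qed.

Lemma single_level_small w S : n != 4%N -> (S <= s)%N -> cwalk (0, 0) w -> ~~ single_level S w small.
Proof.
move=> n4 Ss cw; apply/negP => /(cwalk_single cw Ss)[c cs].
by rewrite small_dvd.
Qed.

Lemma shape_small w : n != 4%N -> cwalk (0, 0) w -> (size w <= 8)%N -> ~~ shape_in s w smalls.
Proof.
by move=> n4 cw sw; apply/negP => /(cwalk_shape cw sw)[L /(smalls_neq0 n4)-/(_ (r ^+ s))].
Qed.

Lemma pair_small (t : 'Z_n) : n != 4%N -> ~ ((exists2 L, L \in pair2 1 1 & heval t L = 0) /\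
  (exists2 L, L \in pair2 3 1 & heval t L = 0)).
Proof.
move=> n4 [[L1 L1s E1] [L2 L2s E2]].
have nz (c : int) : c \in small -> (c%:~R : 'Z_n) <> 0.
  by move=> cs /eqP; rewrite intr_Zp_eq0 ?n_gt1 // small_dvd.
have := heval_pair2 L1s E1; have := heval_pair2 L2s E2; rewrite !mul1r.
by case=> -> [] /eqP; rewrite -subr_eq0 ?opprK -?intrN -intrD => /eqP E3; by apply: nz E3.
Qed.

(** * All 3-arcs equivalent *)

Section ThreeArc.
Hypothesis three_arc : forall P w P' w', C (pr P) -> C (pr P') -> redw w -> redw w' ->
  size w = 3%N -> size w' = 3%N -> eqv (vs P w) (vs P' w').

Lemma three_arc_cwalk u v w : redw u -> redw v -> size u = 3%N -> size v = 3%N ->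
  cwalk (0, 0) (u ++ w) -> exists2 w', size w' = size w & cwalk (0, 0) (v ++ w').
Proof.
move=> ru rv su sv cw; have [F FA E] := three_arc C0 C0 ru rv su sv.
have v3 : (0 < size v)%N by rewrite sv.
by have [w' [sw' cw' _]] := cwalk_img C0 C0 v3 FA E cw; exists w'.
Qed.

Lemma three_arc_cwalk2 u v w1 w2 : redw u -> redw v -> size u = 3%N -> size v = 3%N ->
    cwalk (0, 0) (u ++ w1) -> cwalk (0, 0) (u ++ w2) -> size w1 = size w2 -> w1 <> w2 ->
  exists w1' w2', [/\ size w1' = size w1, size w2' = size w2, w1' <> w2', cwalk (0, 0) (v ++ w1')
    & cwalk (0, 0) (v ++ w2')].
Proof.
move=> ru rv su sv cw1 cw2 s12 w12; have [F FA E] := three_arc C0 C0 ru rv su sv.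
have v3 : (0 < size v)%N by rewrite sv.
have [w1' [sw1' cw1' E1]] := cwalk_img C0 C0 v3 FA E cw1.
have [w2' [sw2' cw2' E2]] := cwalk_img C0 C0 v3 FA E cw2.
exists w1', w2'; split=> // w12'; apply: w12.
rewrite w12' -E2 in E1.
have /vs_inj/eqP : vs (0, 0) (u ++ w1) = vs (0, 0) (u ++ w2).
  have Cv w : all C (vs (0, 0) w) by apply: C_vs; exact: C0.
  move: (Cv (u ++ w1)) (Cv (u ++ w2)) E1.
  elim: (vs _ (u ++ w1)) (vs _ (u ++ w2)) => [|x xs IH] [|y ys] //= /andP[Cx Cxs] /andP[Cy Cys] [].
  by move=> /(caut_inj FA) -> // /IH ->.
by rewrite eqseq_cat // => /andP[_ /eqP].
Qed.

(** Read from its second vertex, this is the commutator of the double steps along levels 1 and 0, so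
    all crossings cancel. *)
Lemma commutator_cwalk : cwalk (0, 0)
  [:: Up; Up; Dn; (false, false); (true, false); (true, false); (false, false); Dn].
Proof. exact: mk_cwalk0. Qed.

Lemma cwalk_net_lt w : cwalk (0, 0) w -> net w != 0 -> (s <= `|net w|)%N /\ (s %| `|net w|)%N.
Proof.
move=> /cwalk_net nw n0; have sn : (s %| `|net w|)%N by apply: dvdn_trans nw; rewrite dvdn_mull.
by split=> //; apply: dvdn_leq sn; rewrite absz_gt0.
Qed.

(** * At least three coordinates *)

Section LargeS.
Hypothesis s_ge3 : (3 <= s)%N.

(** For n = 4 there is an alternating 4-cycle, but a closed 4-walk through up-up-up would make n
    divide 1. *)
Lemma large_s_n4 : n != 4%N.
Proof.
apply/eqP => /turn_cwalk_n4 cw.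
have [[|a []] // _ cw'] := three_arc_cwalk (isT : redw UDU) (isT : redw UUU) erefl erefl cw.
have [c] := cwalk_single cw' s_ge3 (cwalk_walks UUU4 (v := [:: a]) erefl cw').
have n3 := n_ge3; rewrite !inE => /orP[]/eqP-> /dvdn_leq /=; lia.
Qed.

(** All other candidates make a member of [small] vanish modulo n, directly or through
    [pair_small]. *)
Lemma large_s_UDU v : size v = 5%N -> cwalk (0, 0) (UDU ++ v) ->
  n = 8%N /\ v = [:: Dn; Up; Dn; Up; Dn].
Proof.
move=> sv cw; have n4 := large_s_n4.
have sw : size (UDU ++ v) = 8%N by rewrite size_cat sv.
have rw := cwalk_redw cw; have cl := cwalk_closed0 cw.
have [n0|n0] := eqVneq (net (UDU ++ v)) 0.
  case: (UDU_net0 sv rw cl n0) => [/cwalk_single|vE].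
    by case/(_ cw s_ge3) => c cs; rewrite small_dvd.
  split=> //; have vec := cwalk_vec cw.
  have : (mvs (0, 0) (UDU ++ v)).2 0 (coord 0) = r ^ 0 *~ 8.
    by rewrite (@coef_mvs _ _ 1) ?s_gt0 // vE.
  rewrite vec mxE => /esym/eqP; rewrite exprz_mulz_eq0 => n8.
  have := dvdn_leq (isT : (0 < 8)%N) n8; have n3 := n_ge3.
  by case: (n) n3 n4 n8 => [|[|[|[|[|[|[|[|[|]]]]]]]]].
have [sle sdv] := cwalk_net_lt cw n0.
have nle : (`|net (UDU ++ v)| <= 6)%N.
  by have := net_UDU_le v; rewrite sv.
have s6 : (s <= 6)%N by exact: leq_trans sle nle.
have n0s : (net (UDU ++ v) != 0) && (s %| `|net (UDU ++ v)|)%N by rewrite n0.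
have sh := shape_small n4 cw; rewrite sw in sh.
have [s3|s3] := eqVneq s 3%N.
  move: (cwalk_walks UDU_wrap3 sw cw) (sh isT) n0s; rewrite {1}s3 => + /negbTE shF n0s.
  rewrite s3 in n0s; rewrite {}n0s {}shF => /andP[h1 h2].
  by case: (pair_small (t := r ^+ s) n4); split; apply: (cwalk_shape cw); rewrite ?sw ?s3.
have s456 : s \in [:: 4; 5; 6]%N by rewrite !inE; have := s_ge3; lia.
by move: (cwalk_walks (UDU_wrap456 s456) sw cw); rewrite n0s (negbTE (sh isT)).
Qed.

Lemma large_s_unique w1 w2 u : redw u -> size u = 3%N -> size w1 = 5%N -> size w2 = 5%N ->
  cwalk (0, 0) (u ++ w1) -> cwalk (0, 0) (u ++ w2) -> w1 = w2.
Proof.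
move=> ru su sw1 sw2 cw1 cw2; apply: NNPP => w12.
have [w1' [w2' [sw1' sw2' ne cw1' cw2']]] :=
  three_arc_cwalk2 ru (isT : redw UDU) su erefl cw1 cw2 (etrans sw1 (esym sw2)) w12.
rewrite sw1 in sw1'; rewrite sw2 in sw2'.
have [_ E1] := large_s_UDU sw1' cw1'; have [_ E2] := large_s_UDU sw2' cw2'.
by rewrite E1 E2 in ne.
Qed.

Lemma large_s_n8 : n = 8%N.
Proof.
have [w sw cw] := three_arc_cwalk (u := [:: Up; Up; Dn]) (isT : redw [:: Up; Up; Dn])
  (isT : redw UDU) erefl erefl commutator_cwalk.
by have [] := large_s_UDU sw cw.
Qed.

(** By [large_s_unique] a 3-arc has at most one continuation to a closed 8-walk. For s = 3 there are
    two through up-up-up. For s >= 4 a reflection yields a second one if the fourth edge goes up,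
    and the enumeration excludes that it goes down. *)
Lemma three_arc_large_s_False : False.
Proof.
have n8 := large_s_n8; have n4 := large_s_n4.
have [s3|s3] := eqVneq s 3%N.
  (* Modulo 8 the unit r^3 is odd; the sign is minus if it is 1 modulo 4, and plus if it is 3 modulo
     4. *)
  have [x xE] : exists x, 2 + (2 * sg x)%:~R * r ^+ 3 = 0.
    have [k ->] : exists k, r ^+ 3 = (2 * k + 1)%:R by apply: unit_Zp_odd; rewrite ?unitrX ?n8.
    have e8 : (8%:R : 'Z_n) = 0 by apply/eqP; rewrite -[_%:R]/(8%:~R) intr_Zp_eq0 ?n_gt1 // n8.
    have [j] : exists j, k = (2 * j)%N \/ k = (2 * j + 1)%N by exists k./2; lia.
    case=> ->; [exists false|exists true]; rewrite !(natrD, natrM, intrM) /sg.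
      by transitivity (- 8%:R * j%:R : 'Z_n); [ring | rewrite e8; ring].
    by transitivity (8%:R * j%:R + 8%:R : 'Z_n); [ring | rewrite e8; ring].
  pose w1 := [:: (true, x); (false, x); (false, false); (false, false); Dn].
  pose w2 := [:: Dn; (false, false); (false, false); (false, x); (true, x)].
  have dv0 (k : int) : k = 0 -> (m * s %| `|k|)%N by move->; rewrite dvdn0.
  have shE (u : seq letter) (S : seq (seq int)) : S = [seq shape 3 u l | l <- iota 0 3] ->
      all (fun L => heval (r ^+ 3) L == 0) S -> all (fun l => heval (r ^+ s) (shape s u l) == 0) (iota 0 s).
    by rewrite s3 => ->; rewrite all_map.
  have x2E : heval (r ^+ 3) [:: 2; 2 * sg x] = 0.
    by rewrite /heval /= mulr0 addr0 mulrC xE.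
  have x2E' : heval (r ^+ 3) [:: 2 * sg x; 2] = 0.
    apply: (@mulrI _ (sg x)%:~R); first by case: (x); rewrite ?unitrN unitr1.
    rewrite mulr0 -[RHS]x2E /heval /= !mulr0 !addr0 mulrDr -!intrM; congr (_ + _).
      by case: (x).
    by rewrite mulrCA -intrM [sg x * _]mulrC.
  have cw1 : cwalk (0, 0) (UUU ++ w1).
    rewrite /w1; apply: mk_cwalk; [by case: (x) | by [] | by apply: dv0; case: (x) | | by case: (x) | by []].
    by apply: (@shE _ [:: [:: 2; 2 * sg x]; [::]; [::]]); [case: (x) | rewrite /= x2E !eqxx].
  have cw2 : cwalk (0, 0) (UUU ++ w2).
    rewrite /w2; apply: mk_cwalk; [by case: (x) | by [] | by apply: dv0; case: (x) | | by case: (x) | by []].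
    by apply: (@shE _ [:: [::]; [::]; [:: 2 * sg x; 2]]); [case: (x) | rewrite /= x2E' !eqxx].
  by have := large_s_unique (isT : redw UUU) erefl (erefl : size w1 = 5%N) (erefl : size w2 = 5%N) cw1 cw2.
have [w sw cw] := three_arc_cwalk (isT : redw [:: Up; Up; Dn]) (isT : redw UUU) erefl erefl commutator_cwalk.
have sw8 : size (UUU ++ w) = 8%N by rewrite size_cat sw.
have s4 : (4 <= s)%N by have := s_ge3; lia.
case: w sw cw sw8 => // -[[] e] w [sw] cw sw8.
  have [|F FA E] := @refl_last (0, 0) UUU (true, e) C0.
    by rewrite /avoids /= !coord_neq.
  have FU : map F (vs (0, 0) UUU) = vs (0, 0) UUU by exact: (congr1 (take 4) E).
  have [w' [sw' cw' E']] := cwalk_img C0 C0 (isT : (0 < size UUU)%N) FA FU cw.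
  have w'E : w' = (true, e) :: w.
    by apply: (large_s_unique (isT : redw UUU)) cw' cw; rewrite ?sw' //= sw.
  have : F (pr (mv (mvs (0, 0) UUU) (true, e))) = pr (mv (mvs (0, 0) UUU) (lbar (true, e))).
    exact: (congr1 (fun z => nth x0 z 4) E).
  rewrite (congr1 (fun z => nth x0 z 4) E' : F (pr (mv (mvs (0, 0) UUU) (true, e))) = _) w'E.
  move=> H; have /pr_mv_inj := H : pr (mv (mvs (0, 0) UUU) (true, e)) = _.
  by case: (e).
have e1 : e = true by have := cwalk_redw cw; case: (e).
rewrite {}e1 in cw sw8; have n0F := shape_small n4 cw; rewrite sw8 in n0F.
have [n0|n0] := eqVneq (net (UUU ++ Dn :: w)) 0.
  have := cwalk_walks UUUD_net0 (v := w) sw8 cw; rewrite n0 /=.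
  by rewrite (negbTE (single_level_small n4 s4 cw)).
have [sle sdv] := cwalk_net_lt cw n0.
have s8 : s \in [:: 4; 5; 6; 7; 8]%N.
  have := leq_trans sle (_ : _ <= 8)%N; case/andP: (net_bound (UUU ++ Dn :: w)); rewrite sw8 => -> _ /(_ isT).
  by rewrite !inE; lia.
have := cwalk_walks (UUUD_wrap s8) (v := w) sw8 cw; rewrite n0 sdv /=.
by rewrite (negbTE (n0F isT)).
Qed.

End LargeS.

(** * Two coordinates and n different from 4 *)

Section SmallS.
Hypotheses (s2 : s = 2%N) (n4 : n != 4%N).
Local Notation t := (r ^+ s).

Lemma t_pm1 : t ^+ m = 1 \/ t ^+ m = -1.
Proof. by rewrite -exprM mulnC. Qed.

Lemma unit_t : t \is a GRing.unit. Proof. exact: unitrX. Qed.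

Lemma int_eq0 (c : int) : c%:~R = 0 :> 'Z_n -> (n %| `|c|)%N.
Proof. by move=> /eqP; rewrite intr_Zp_eq0 ?n_gt1. Qed.

Lemma small_neq0 c : c \in small -> c%:~R <> 0 :> 'Z_n.
Proof. by move=> cs /int_eq0; rewrite small_dvd. Qed.

Lemma mk_cwalk2 w : redw w -> (size w <= 8)%N -> (m * s %| `|net w|)%N ->
    heval t (shape 2 w 0) = 0 -> heval t (shape 2 w 1) = 0 ->
    ((head Up w).1 == (last Up w).1) || (net w == 0) && (head Up w != linv (last Up w)) ->
  w != [::] -> cwalk (0, 0) w.
Proof.
move=> rw sw nw h0 h1 hl wn; apply: mk_cwalk => //.
have E l : shape s w l = shape 2 w l by rewrite s2.
have Ei : iota 0 s = [:: 0; 1]%N by rewrite s2.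
by rewrite Ei /= !E h0 h1 eqxx.
Qed.

Lemma shape2 w S : cwalk (0, 0) w -> (size w <= 8)%N -> shape_in 2 w S ->
  exists2 L, L \in S & heval t L = 0.
Proof. by move=> cw sw H; apply: (cwalk_shape cw sw); rewrite s2. Qed.

Lemma shape2_small w S : cwalk (0, 0) w -> (size w <= 8)%N -> shape_in 2 w (smalls ++ S) ->
  exists2 L, L \in S & heval t L = 0.
Proof.
move=> cw sw /(shape2 cw sw)[L]; rewrite mem_cat => /orP[/(smalls_neq0 n4)-/(_ t)//|LS E].
by exists L.
Qed.

Lemma cwalk_net_m w k : cwalk (0, 0) w -> `|net w|%N = (2 * k)%N -> (m %| k)%N.
Proof. by move/cwalk_net => + E; rewrite E s2 mulnC dvdn_pmul2l. Qed.

(** Four upward steps with signs + + x x would close, as 2 m divides 4 and 1 + x r^2 = 0; but no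
    closed 4-walk passes through up-down-up. *)
Lemma t_not_pm1_m2 : (m <= 2)%N -> (t = 1 \/ t = -1) -> False.
Proof.
move=> m2 tE; have [x xE] : exists x, 1 + (sg x)%:~R * t = 0.
  by case: tE => ->; [exists false|exists true]; rewrite /sg; ring.
pose u := [:: Up; Up; (true, x)].
have hx : heval t [:: 1; sg x] = 0 by rewrite /heval /= mulr0 addr0 mulrC xE.
have cw : cwalk (0, 0) (u ++ [:: (true, x)]).
  have ms4 : (m * s %| 4)%N by rewrite s2; case: (m) m_gt0 m2 => [|[|[]]].
  have shE l : (l < 2)%N -> shape 2 (u ++ [:: (true, x)]) l = [:: 1; sg x].
    by rewrite /u; case: l => [|[|]] // _; case: (x); vm_compute.
  apply: mk_cwalk2.
  - by rewrite /u; case: (x).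
  - by rewrite /u.
  - by rewrite (_ : `|net _|%N = 4%N) //; rewrite /u; case: (x).
  - by rewrite shE.
  - by rewrite shE.
  - by rewrite /u; case: (x).
  - by [].
have ru : redw u by rewrite /u; case: (x).
have [v sv cw'] := three_arc_cwalk ru (isT : redw UDU) erefl erefl cw.
have sw : size (UDU ++ v) = 4%N by rewrite size_cat sv.
have := shape_small n4 cw'; rewrite sw => /(_ isT)/negP; apply.
by rewrite s2; exact: cwalk_walks UDU4 sw cw'.
Qed.

Lemma m_ge2 : (2 <= m)%N.
Proof.
have := t_pm1; have := t_not_pm1_m2; case: (m) m_gt0 => [|[|k]] // _; rewrite expr1 => H /H.
by case.
Qed.

Lemma net_even w : ~~ odd (size w) -> exists k, `|net w|%N = (2 * k)%N /\ (2 * k <= size w)%N.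
Proof.
move=> ev; case/andP: (net_bound w); rewrite oddD (negbTE ev) addbF => le nev.
by exists `|net w|./2; rewrite mul2n even_halfK.
Qed.

Lemma pair11 : (m <= 2)%N -> (exists2 L, L \in pair2 1 1 & heval t L = 0) -> False.
Proof.
move=> m2 [L LS E]; apply: (t_not_pm1_m2 m2).
by have := heval_pair2 LS E; rewrite mul1r.
Qed.

Lemma dvdm_le2 k : (m %| k)%N -> (0 < k <= 2)%N -> (m <= 2)%N.
Proof. by move=> mk /andP[k0 k2]; apply: leq_trans k2; apply: dvdn_leq. Qed.

Lemma UDU6_n6 v : size v = 3%N -> cwalk (0, 0) (UDU ++ v) -> (n %| 6)%N.
Proof.
move=> sv cw; have sw : size (UDU ++ v) = 6%N by rewrite size_cat sv.
have sw8 : (size (UDU ++ v) <= 8)%N by rewrite sw.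
have [|k [kE k3]] := @net_even (UDU ++ v); first by rewrite sw.
have mk := cwalk_net_m cw kE; have m2 := m_ge2.
have nle : (`|net (UDU ++ v)| <= 4)%N.
  by have := net_UDU_le v; rewrite sv.
have : (k <= 2)%N by lia.
case: k kE mk {k3} => [|[|[|]]] // kE mk _.
- have := cwalk_walks UDU6_0 sw cw; rewrite -absz_eq0 kE /= => /(shape2_small cw sw8)[L].
  by rewrite !inE => /orP[]/eqP->; rewrite heval1 => /int_eq0.
- by have := leq_trans m2 (dvdn_leq (isT : (0 < 1)%N) mk).
have := cwalk_walks UDU6_4 sw cw; rewrite kE /= => /(shape2_small cw sw8).
by move/(pair11 (dvdm_le2 mk isT)).
Qed.

Lemma t_eq1 : (n %| 6)%N -> t = 1.
Proof.
move=> n6; rewrite s2; have n3 := n_ge3.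
have n36 : n = 3%N \/ n = 6%N.
  have := dvdn_leq (isT : (0 < 6)%N) n6; move: n6 n4 n3.
  by case: (n) => [|[|[|[|[|[|[|]]]]]]] //; [left|right].
have cnr : coprime n r by rewrite -unitZpE ?n_gt1 // natr_Zp.
have rn : (r < n)%N by rewrite -{2}(Zp_cast n_gt1) ltn_ord.
rewrite -[r]natr_Zp -natrX; apply/eqP; rewrite -subr_eq0.
have kk (k : nat) : (k ^ 2)%:R - 1 = ((k ^ 2)%:Z - 1)%:~R :> 'Z_n by rewrite intrB.
rewrite kk intr_Zp_eq0 ?n_gt1 //.
move: (nat_of_ord r) cnr rn => k cnk kn.
by case: n36 => nE; rewrite nE in cnk kn *; case: k cnk kn => [|[|[|[|[|[|]]]]]].
Qed.

(** With r^2 = 1 the walk three levels up and back closes by 2 - 2 r^2 = 0. Its image through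
    up-up-up cannot have net level 0, since 4 <> 0; so it rises or falls by 6 levels, whence m = 3,
    and 1 + 1 +- 1 = 0 gives n = 3. *)
Lemma three_arc_n6 : (n %| 6)%N -> n = 3%N /\ m = 3%N.
Proof.
move=> n6; have t1 := t_eq1 n6.
have m3 : (2 < m)%N.
  by rewrite ltnNge; apply/negP => m2; apply: (t_not_pm1_m2 m2); left.
pose u := [:: Up; Up; (true, false)].
have h22 : heval t [:: 2; -2] = 0 by rewrite /heval /= t1 mulr0 addr0 mul1r; ring.
have cw : cwalk (0, 0) (u ++ [:: (false, false); (false, false); Dn]).
  apply: mk_cwalk2; [by [] | by [] | exact: dvdn0 | exact: h22 | by [] | by [] | by []].
have [v sv cw'] := three_arc_cwalk (isT : redw u) (isT : redw UUU) erefl erefl cw.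
have sw : size (UUU ++ v) = 6%N by rewrite size_cat sv.
have sw8 : (size (UUU ++ v) <= 8)%N by rewrite sw.
have [|k [kE]] := @net_even (UUU ++ v); first by rewrite sw.
have mk := cwalk_net_m cw' kE; rewrite sw => k6.
have [k0|k0] := posnP k.
  have := cwalk_walks UUU6_0 sw cw'; rewrite -absz_eq0 kE k0 /= => /(shape2_small cw' sw8)[L].
  rewrite inE => /eqP->; rewrite /heval /= t1 mulr0 addr0 mul1r -intrD => /small_neq0.
  by case.
have k3 : k = 3%N by have := dvdn_leq k0 mk; lia.
have m3E : m = 3%N by have := dvdn_leq k0 mk; lia.
split=> //; have := cwalk_walks UUU6_6 sw cw'; rewrite kE k3 /= => /(shape2 cw' sw8)[L].
rewrite !inE => /orP[]/eqP->; rewrite /heval /= t1 mulr0 addr0 !mul1r -!intrD.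
  by move/int_eq0/(dvdn_leq (isT : (0 < 3)%N)); have := n_ge3; lia.
by move/int_eq0; rewrite dvdn1; have := n_ge3; lia.
Qed.

Hypothesis nN6 : ~~ (n %| 6)%N.

Lemma no_cwalk6 u v : redw u -> size u = 3%N -> size v = 3%N -> ~ cwalk (0, 0) (u ++ v).
Proof.
move=> ru su sv cw; case/negP: nN6.
have [v' sv' cw'] := three_arc_cwalk ru (isT : redw UDU) su erefl cw.
by apply: UDU6_n6 cw'; rewrite sv' sv.
Qed.

Lemma t2_neq x : heval t [:: 2; 2 * sg x] <> 0.
Proof.
move=> hx; pose u := [:: Up; Up; (true, x)]; pose v := [:: (false, x); (false, false); Dn].
apply: (@no_cwalk6 u v) => //.
have shE l : (l < 2)%N -> shape 2 (u ++ v) l = nth [::] [:: [:: 2; 2 * sg x]; [::]] l.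
  by rewrite /u /v; case: l => [|[|]] // _; case: (x); vm_compute.
apply: mk_cwalk2.
- by rewrite /u /v; case: (x).
- by [].
- by rewrite (_ : net _ = 0) ?dvdn0 // /u /v; case: (x).
- by rewrite shE.
- by rewrite shE.
- by rewrite /u /v; case: (x).
- by [].
Qed.

(** The relation would close the 6-walk with signs a a b b x x, which rises by 6 = 2 m levels,
    against [no_cwalk6]. *)
Lemma triple_neq L : m = 3%N -> L \in triple1 -> heval t L <> 0.
Proof.
move=> m3 LT hL.
have [a [b [x LE]]] : exists a b x, L = [:: sg a; sg b; sg x].
  case/allpairsP: LT => -[y p] /= []; rewrite !inE.
  case/orP=> /eqP-> /or4P[]/eqP-> ->; 
    [exists true, true, true|exists true,true,false|exists true,false,true|exists true,false,false
    |exists false, true, true|exists false,true,false|exists false,false,true|exists false,false,false] => //.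
pose u := [:: (true, a); (true, a); (true, b)]; pose v := [:: (true, b); (true, x); (true, x)].
apply: (@no_cwalk6 u v) => //.
have shE l : (l < 2)%N -> shape 2 (u ++ v) l = [:: sg a; sg b; sg x].
  by rewrite /u /v; case: l => [|[|]] // _; case: (a) (b) (x) => [] [] []; vm_compute.
apply: mk_cwalk2.
- by rewrite /u /v; case: (a) (b) (x) => [] [] [].
- by [].
- by rewrite (_ : net _ = 6) ?m3 ?s2 // /u /v; case: (a) (b) (x) => [] [] [].
- by rewrite shE // -LE.
- by rewrite shE // -LE.
- by rewrite /u /v; case: (a) (b) (x) => [] [] [].
- by [].
Qed.

Lemma t_sqr : exists k : nat, t = (k * k)%:R.
Proof. by exists (r : nat); rewrite s2 natrM natr_Zp. Qed.

(* Here [a r^2 = b] is impossible modulo 5, as the squares modulo 5 are 0, 1 and -1. *)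
Lemma not_dvd5 (a b : int) : a%:~R * t = b%:~R ->
  all (fun i : nat => ~~ (5 %| a * (i * i)%N%:Z - b)%Z) (iota 0 5) -> ~~ (5 %| n)%N.
Proof.
move=> E H; apply/negP => n5; have [k tE] := t_sqr.
have : (n %| a * (k * k)%N%:Z - b)%Z.
  by rewrite dvdzE; apply: int_eq0; rewrite intrB intrM -E tE subrr.
have n5z : (5 %| n%:Z)%Z by exact: n5.
move/(dvdz_trans n5z); set i := (k %% 5)%N.
have i5 : i \in iota 0 5 by rewrite mem_iota ltn_mod.
move: (allP H _ i5) => /negP H' H''; apply: H'; move: H''.
rewrite (divn_eq k 5) -/i; move: (k %/ 5)%N i {i5} => q i.
have -> : a * ((q * 5 + i) * (q * 5 + i))%N%:Z - b =
    a * (q * q * 5 + 2 * q * i)%N%:Z * 5 + (a * (i * i)%N%:Z - b).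
  by rewrite !(PoszM, PoszD); ring.
by rewrite rpredDl // dvdz_mull.
Qed.

Lemma dvd10_False : ~~ (5 %| n)%N -> (n %| 10)%N -> False.
Proof.
move=> n5 n10; have : (n %| 2)%N.
  by rewrite -(Gauss_dvdr (n := 5)) // coprime_sym prime_coprime.
by move/(dvdn_leq (isT : (0 < 2)%N)); have := n_ge3; lia.
Qed.

Lemma n_ndvd2 : (n %| 2)%N = false.
Proof. by apply/negP => /dvdn_leq -/(_ isT); have := n_ge3; lia. Qed.

Lemma n_ndvd4 : (n %| 4)%N = false. Proof. by rewrite (@small_dvd 4). Qed.

(** Odd squares are 1 modulo 8, so n = 8 would give 2 - 2 r^2 = 0, against [t2_neq]. *)
Lemma n_ndvd8 : (n %| 8)%N = false.
Proof.
apply/negP => n8d; have n8 : n = 8%N.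
  have := dvdn_leq (isT : (0 < 8)%N) n8d; move: n4 n_ge3 n8d.
  by case: (n) => [|[|[|[|[|[|[|[|[|]]]]]]]]].
have [k rE] : exists k, r = (2 * k + 1)%:R by apply: unit_Zp_odd; rewrite ?n8.
apply: (@t2_neq false); rewrite /heval /= mulr0 addr0 s2 rE.
have e8 : (8%:R : 'Z_n) = 0 by apply/eqP; rewrite -[_%:R]/(8%:~R) intr_Zp_eq0 ?n_gt1 // n8.
rewrite natrD natrM; transitivity (- 8%:R * (k%:R ^+ 2 + k%:R) : 'Z_n); last by rewrite e8; ring.
by ring.
Qed.

(* Either relation is the closing condition of an 8-cycle with three turns in a row. *)
Definition relA (x : bool) := 4%:~R * t = (2 * sg x)%:~R.
Definition relB (x : bool) := 2%:~R * t = (4 * sg x)%:~R.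

(** Carry the commutator to up-down-up. Net levels +-2 contradict m >= 2, and +-4 and +-6 force m =
    2 and m = 3, where the resulting relations are impossible; net level 0 leaves these two
    relations. *)
Lemma relAB : (exists x, relA x) \/ (exists x, relB x).
Proof.
have [v sv cw] := three_arc_cwalk (isT : redw [:: Up; Up; Dn]) (isT : redw UDU) erefl erefl commutator_cwalk.
have sw : size (UDU ++ v) = 8%N by rewrite size_cat sv.
have sw8 : (size (UDU ++ v) <= 8)%N by rewrite sw.
have [|k [kE _]] := @net_even (UDU ++ v); first by rewrite sw.
have mk := cwalk_net_m cw kE; have m2 := m_ge2.
have nle : (`|net (UDU ++ v)| <= 6)%N.
  by have := net_UDU_le v; rewrite sv.
have : (k <= 3)%N by lia.
case: k kE mk => [|[|[|[|]]]] // kE mk _.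
- have := cwalk_walks UDU8_0 sw cw; rewrite -absz_eq0 kE muln0 eqxx implyTb => /(shape2_small cw sw8)[L].
  rewrite !mem_cat => /orP[L42|/orP[L24|]] E.
  + by right; have [] := heval_pair2 L42 E => H; [exists true|exists false].
  + by left; have [] := heval_pair2 L24 E => H; [exists true|exists false].
  + by move: E; rewrite !inE; case/orP=> /eqP->; rewrite heval1 => /int_eq0; rewrite n_ndvd8.
- by have := leq_trans m2 (dvdn_leq (isT : (0 < 1)%N) mk).
- have m2E : (m <= 2)%N := dvdm_le2 mk isT.
  have := cwalk_walks UDU8_4 sw cw; rewrite kE eqxx implyTb => /(shape2_small cw sw8)[L].
  have tm : t ^+ 2 = 1 \/ t ^+ 2 = -1.
    by have -> : 2%N = m; [lia | exact: t_pm1].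
  (* The absolute values of a and b are 1 and 3; squaring and using t^2 = +-1 gives 8 = 0 or 10 =
     0. *)
  have n5 (a b : int) : a%:~R * t = b%:~R -> `|b * b - a * a| = 8 -> `|b * b + a * a| = 10 ->
      all (fun i : nat => ~~ (5 %| a * (i * i)%N%:Z - b)%Z) (iota 0 5) -> False.
    move=> E d8 d10 /(not_dvd5 E) n5.
    have E2 : (a * a)%:~R * t ^+ 2 = (b * b)%:~R by rewrite !intrM -E; ring.
    case: tm E2 => ->; rewrite ?mulrN1 ?mulr1 => E2.
      have /int_eq0 : (b * b - a * a)%:~R = 0 :> 'Z_n by rewrite intrB E2 subrr.
      by rewrite (_ : absz _ = 8%N) ?n_ndvd8 //; lia.
    have /int_eq0 : (b * b + a * a)%:~R = 0 :> 'Z_n by rewrite intrD -E2 addNr.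
    by rewrite (_ : absz _ = 10%N); [exact: dvd10_False | lia].
  rewrite !mem_cat => /or3P[L11|L31|L13] E.
  + by case: (pair11 m2E); exists L.
  + by have [] := heval_pair2 L31 E; rewrite -?intrN => H; case: (n5 _ _ H erefl erefl isT).
  + by have [] := heval_pair2 L13 E; rewrite -?intrN => H; case: (n5 _ _ H erefl erefl isT).
have m3 : m = 3%N.
  by have := dvdn_leq (isT : (0 < 3)%N) mk; case: (m) mk m2 => [|[|[|[|]]]].
have := cwalk_walks UDU8_6 sw cw; rewrite kE eqxx implyTb => /(shape2_small cw sw8)[L LT].
by move/(triple_neq m3 LT).
Qed.

Lemma dvd30_False : ~~ (5 %| n)%N -> (n %| 30)%N -> False.
Proof.
move=> n5 n30; case/negP: nN6.
by rewrite -(Gauss_dvdr (n := 5)) // coprime_sym prime_coprime.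
Qed.

Lemma three_arc_small_s_False : False.
Proof.
have [x [n5 AB]] : exists x, ~~ (5 %| n)%N /\ (relA x \/ relB x).
  case: relAB => -[x xAB]; exists x; split; try by [left|right].
    by apply: not_dvd5 xAB _; case: (x).
  by apply: not_dvd5 xAB _; case: (x).
(* The sign x is absorbed, so that y behaves like 1/2 or like 2. *)
pose y := (sg x)%:~R * t.
have tE : t = (sg x)%:~R * y by rewrite mulrA sg_sqr mul1r.
have yAB : 4%:~R * y = 2%:~R \/ 2%:~R * y = 4%:~R.
  case: AB => H; [left|right]; rewrite mulrCA [X in _ * X]H intrM mulrCA sg_sqr mulr1 //.
have y2 : y ^+ 2 = t ^+ 2 by rewrite exprMn expr2 sg_sqr mul1r.
have uy (c : int) : c%:~R * y = 0 -> c%:~R = 0 :> 'Z_n.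
  move=> cy; apply: (mulIr unit_t); rewrite mul0r tE mulrCA cy mulr0 //.
have [m2|m3] := leqP m 2.
  have tm : t ^+ 2 = 1 \/ t ^+ 2 = -1.
    by have -> : 2%N = m; [have := m_ge2; lia | exact: t_pm1].
  have y2' : y ^+ 2 = 1 \/ y ^+ 2 = -1 by rewrite y2.
  case: (rel_sqr yAB y2') => [/(rel_12 yAB)|/(rel_20 yAB)] H.
    have /int_eq0 : 6%:~R = 0 :> 'Z_n by case: H => // /uy.
    by rewrite (negbTE nN6).
  by apply: (dvd10_False n5); apply: (@int_eq0 10); case: H => // /uy.
(* The third sign x turns a term c x r^2 of the closing relations into c y. *)
pose u := [:: Up; Up; (true, x)].
have [v sv cw] := three_arc_cwalk (isT : redw [:: Up; Up; Dn]) (isT : redw u) erefl erefl commutator_cwalk.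
have sw : size (u ++ v) = 8%N by rewrite size_cat sv.
have sw8 : (size (u ++ v) <= 8)%N by rewrite sw.
have [|k [kE]] := @net_even (u ++ v); first by rewrite sw.
rewrite sw => k8; have mk := cwalk_net_m cw kE.
have [k0|k0] := posnP k.
  have := cwalk_walks (UUU8_0 x) sw cw; rewrite -absz_eq0 kE k0 muln0 eqxx implyTb => /(shape2_small cw sw8)[L].
  have hE a c : heval t [:: a; c * sg x] = a%:~R + c%:~R * y.
    by rewrite /heval /= mulr0 addr0 intrM mulrC mulrA.
  rewrite !inE => /or3P[]/eqP->; first by move/t2_neq.
    rewrite hE => /(rel_24 yAB)[]/int_eq0; first by rewrite n_ndvd4.
    exact: dvd10_False n5.
  rewrite hE => /(rel_42 yAB)[]/int_eq0; first exact: dvd10_False n5.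
  by rewrite n_ndvd8.
have mk' := dvdn_leq k0 mk.
have [k3|k4] : k = 3%N \/ k = 4%N by lia.
  have m3E : m = 3%N by lia.
  have := cwalk_walks (UUU8_6 x) sw cw; rewrite kE k3 eqxx implyTb => /(shape2_small cw sw8)[L LT].
  by move/(triple_neq m3E LT).
have m4 : m = 4%N by move: mk mk' m3; rewrite k4; case: (m) => [|[|[|[|[|]]]]].
have y4 : y ^+ 4 = 1 \/ y ^+ 4 = -1.
  by have := t_pm1; rewrite m4 -[4%N]/(2 * 2)%N !exprM y2.
have := cwalk_walks (UUU8_8 x) sw cw; rewrite kE k4 eqxx implyTb => /(shape2 cw sw8)[L /mapP[p pS ->]].
have [b [c pE]] : exists b c, p = [:: sg b; sg c].
  by move: pS; rewrite !inE => /or4P[]/eqP->;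
    [exists true, true|exists true, false|exists false, true|exists false, false].
have hE : heval t [:: 1, sg x, sg b & [:: sg c]] = 1 + y + (sg b)%:~R * y ^+ 2 + (sg c * sg x)%:~R * y ^+ 3.
  have xx := sg_sqr x.
  rewrite /heval /= mulr0 addr0 tE intrM.
  transitivity (1%:~R + ((sg x)%:~R * (sg x)%:~R) * y + (sg x)%:~R * (sg x)%:~R * (sg b)%:~R * y ^+ 2 +
     (sg x)%:~R * (sg x)%:~R * ((sg c)%:~R * (sg x)%:~R) * y ^+ 3 : 'Z_n); first by ring.
  by rewrite !xx !mul1r.
rewrite pE /= hE; have -> : sg c * sg x = sg (c == x) by case: (c) (x) => [] [].
move: (c == x) => c' E {hE pE}.
(* The integers of [rel_cubic] up to sign. Each has greatest common divisor 2 with 34, and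
   [rel_fourth] makes n divide 30 or 34. *)
pose nn := [:: 30; 26; 22; 18; 14; 2]%N.
have [k' k'n nk'] : exists2 k' : nat, k' \in nn & (n %| k')%N.
  by case: (rel_cubic yAB E) => /int_eq0; case: (b) (c') => [] [] nk; eexists; try exact: nk.
have [n30|n34] : (n %| 30)%N \/ (n %| 34)%N.
  by case: (rel_fourth yAB y4) => /int_eq0; [left|right].
  exact: dvd30_False n5 n30.
have : (n %| gcdn k' 34)%N by rewrite dvdn_gcd nk'.
have -> : gcdn k' 34 = 2%N by move: k'n; rewrite !inE; do 5 ?[case/predU1P=> [->//|]] => /eqP->.
by rewrite n_ndvd2.
Qed.

End SmallS.

End ThreeArc.

(** The alternating 4-cycle through up-down goes to a closed 4-walk through up-up. Net level 0 would
    make 1 or 2 vanish modulo 4, so 2 m divides a nonzero integer of absolute value at most 4. *)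
Lemma two_arc_transitive_n4 : two_arc_transitive (component x0) -> s = 2%N -> n = 4%N -> (m <= 2)%N.
Proof.
move=> tG s2 n4.
have [F FA E] := two_arc_eqv tG C0 C0 (isT : redw [:: Up; Dn]) (isT : redw [:: Up; Up]).
have [w' [sw cw _]] := cwalk_img (w0' := [:: Up; Up]) (w := [:: Up; Dn]) C0 C0 isT FA E (turn_cwalk_n4 n4).
case: w' sw cw => [|a [|b []]] // _ cw.
have /implyP := cwalk_walks UU4 (v := [:: a; b]) erefl cw.
have net4 : (`|net ([:: Up; Up] ++ [:: a; b])| <= 4)%N by case/andP: (net_bound ([:: Up; Up] ++ [:: a; b])).
case: (net _ =P 0) => [_ /(_ isT)|/eqP net0 _]; last first.
  have := cwalk_net cw; rewrite s2 => /dvdn_leq; move: net0 net4; clear; lia.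
rewrite -{1}s2 => /(cwalk_shape cw isT)[L]; rewrite !inE => /or4P[]/eqP-> /eqP;
  by rewrite heval1 intr_Zp_eq0 ?n_gt1 // n4.
Qed.

Lemma two_arc_transitive_cases : two_arc_transitive (component x0) ->
  s = 2%N /\
     [\/ n = 4%N /\ m = 1%N,
         [/\ n = m, odd n & r ^+ 2 = 1 \/ r ^+ 2 = -1]
       | [/\ n = (2 * m)%N, m = 2 %[mod 4] & 1 + r ^+ 2 = m%:R]].
Proof.
move=> tG; suff [s2 H] : s = 2%N /\ (n != 4%N ->
     [/\ n = m, odd n & r ^+ 2 = 1 \/ r ^+ 2 = -1] \/
     [/\ n = (2 * m)%N, m = 2 %[mod 4] & 1 + r ^+ 2 = m%:R]).
  split=> //; case: (n =P 4%N) => [n4|/eqP/H[]]; [|by constructor 2|by constructor 3].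
  have := two_arc_transitive_n4 tG s2 n4; have := m_gt0.
  case: {-2}m (erefl m) => [|[|[|//]]] mE _ _ //; first by constructor 1.
  (* For n = 4 the value m = 2 falls under the third case, as 1 + r^2 = 2 for every unit r. *)
  constructor 3; split=> //; exact: unit_Z4_sqr.
case: three_arc_or_zigzag => // [three_arc|no_TS].
  have [s3|s3] := ltnP 2 s; first by case: (three_arc_large_s_False three_arc s3).
  have s2 : s = 2%N by apply/eqP; rewrite eqn_leq s3.
  split=> // n4; left; have [n6|nN6] := boolP (n %| 6)%N; last first.
    by case: (three_arc_small_s_False three_arc s2 n4 nN6).
  have [n3 m3] := three_arc_n6 three_arc s2 n4 n6; split; rewrite ?n3 ?m3 //.
  by left; rewrite -{1}s2; apply: t_eq1.
have s2 := zig_s_eq2 tG no_TS; split=> // n4.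
have [kappa zigK] := zig_ratio tG no_TS s2.
exact: rigid_cases tG no_TS s2 kappa zigK n4.
Qed.

End Lift.

(** * Graphs covered by words in the labels *)

(** Stated for an arbitrary map on words rather than for labelled steps, so that it also applies
    after adding a prefix or permuting letters. *)
Definition covers (G : sgraph) (x0 : G) (T : Type) (E : seq T -> G) : Prop :=
  connect (@adj G) x0 (E [::]) /\ forall w y, adj (E w) y <-> exists c, y = E (rcons w c).

Lemma covers_in (G : sgraph) (x0 : G) T (E : seq T -> G) w : covers x0 E -> connect (@adj G) x0 (E w).
Proof.
case=> C0 A; elim/last_ind: w => // w c IH.
by apply: connect_adj IH _; apply/A; exists c.
Qed.

Lemma covers_surj (G : sgraph) (x0 : G) T (E : seq T -> G) x : covers x0 E ->
  connect (@adj G) x0 x -> exists w, x = E w.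
Proof.
case=> C0 A Cx; have: connect (@adj G) (E [::]) x.
  by apply: connect_trans Cx; rewrite (sym_connect_sym (@adj_sym G)).
case/connectP=> p; elim: p [::] => [|y p IH] w /=; first by move=> _ ->; exists w.
by case/andP=> /A[c ->]; apply: IH.
Qed.

Section Cover.
Variables (T : choiceType) (G H : sgraph) (x0 : G) (y0 : H) (E1 : seq T -> G) (E2 : seq T -> H).
Hypotheses (c1 : covers x0 E1) (c2 : covers y0 E2).
Hypothesis E12 : forall w w', E1 w = E1 w' -> E2 w = E2 w'.

Lemma cover_hom : exists2 f : component x0 -> component y0,
  (forall x y, adj x y -> adj (f x) (f y)) & forall x w, val x = E1 w -> val (f x) = E2 w.
Proof.
have ew (x : component x0) : exists w, val x == E1 w.
  by have [w ->] := covers_surj c1 (valP x); exists w.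
pose f x : component y0 := Sub (E2 (xchoose (ew x))) (covers_in _ c2).
have fE x w : val x = E1 w -> val (f x) = E2 w.
  by move=> xE; apply: E12; rewrite -xE; apply/esym/eqP; apply: (xchooseP (ew x)).
exists f => // x y xy; have [w xE] := covers_surj c1 (valP x).
have /(proj2 c1)[c yE] : adj (E1 w) (val y) by rewrite -xE.
change (adj (val (f x)) (val (f y))); rewrite (fE _ _ xE) (fE _ _ yE).
by apply/(proj2 c2); exists c.
Qed.

End Cover.

Lemma cover_iso (T : choiceType) (G H : sgraph) (x0 : G) (y0 : H) (E1 : seq T -> G) (E2 : seq T -> H) :
    covers x0 E1 -> covers y0 E2 -> (forall w w', E1 w = E1 w' <-> E2 w = E2 w') ->
  exists f : component x0 -> component y0, [/\ bijective f,
    forall x y, adj (f x) (f y) = adj x y & forall x w, val x = E1 w -> val (f x) = E2 w].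
Proof.
move=> c1 c2 E12; have [f fA fE] := cover_hom c1 c2 (fun w w' => (E12 w w').1).
have [g gA gE] := cover_hom c2 c1 (fun w w' => (E12 w w').2).
have fK : cancel f g.
  move=> x; have [w xE] := covers_surj c1 (valP x); apply: val_inj.
  by rewrite (gE _ _ (fE _ _ xE)) xE.
have gK : cancel g f.
  move=> x; have [w xE] := covers_surj c2 (valP x); apply: val_inj.
  by rewrite (fE _ _ (gE _ _ xE)) xE.
exists f; split=> //; first by exists g.
by move=> x y; apply/idP/idP => [/gA|/fA //]; rewrite !fK.
Qed.

(** * The quotient of words by their positions *)

Definition pv_congr (N : nat) (w w' : seq letter) : Prop :=
  odd (size w) = odd (size w') /\ forall c, (N %| pv w c - pv w' c)%Z.

Lemma pv_map (pi : letter -> letter) w c : injective pi -> pv (map pi w) (pi c) = pv w c.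
Proof. by move=> pi_inj; elim: w => //= a w ->; rewrite (inj_eq pi_inj). Qed.

(** A common prefix cancels from the difference of positions and at most negates it. *)
Lemma pv_congr_cat N w z z' : pv_congr N (w ++ z) (w ++ z') <-> pv_congr N z z'.
Proof.
have E c : (N %| pv (w ++ z) c - pv (w ++ z') c)%Z = (N %| pv z c - pv z' c)%Z.
  rewrite !pv_cat addrAC opprD addrA subrr add0r /psign; case: odd; last by rewrite addrC.
  by rewrite opprK -[RHS]rpredN opprB addrC.
rewrite /pv_congr !size_cat !oddD; split=> -[oz dz]; split.
- exact: (can_inj (addKb (odd (size w)))).
- by move=> c; rewrite -E.
- by rewrite oz.
- by move=> c; rewrite E.
Qed.

Lemma pv_congr_map N (pi : {perm letter}) z z' : pv_congr N (map pi z) (map pi z') <-> pv_congr N z z'.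
Proof.
rewrite /pv_congr !size_map; split=> -[oz dz]; split=> // c.
  by have := dz (pi c); rewrite !pv_map //; apply: perm_inj.
by rewrite -[c](permKV pi) !pv_map //; apply: perm_inj.
Qed.

(* A graph whose component of [x0] is the quotient of the 4-valent tree of words by [pv_congr N]. *)
Definition pv_cover (G : sgraph) (x0 : G) (N : nat) (E : seq letter -> G) : Prop :=
  covers x0 E /\ forall w w', E w = E w' <-> pv_congr N w w'.

Lemma pv_cover_isomorphic (G H : sgraph) (x0 : G) (y0 : H) N E1 E2 :
  pv_cover x0 N E1 -> pv_cover y0 N E2 -> isomorphic (component x0) (component y0).
Proof.
move=> [c1 K1] [c2 K2]; have [|f [f_bij fA _]] := cover_iso c1 c2; last by exists f.
by move=> w w'; rewrite K1 K2.
Qed.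

Lemma perm_pair (T : finType) (a b a' b' : T) : a != b -> a' != b' ->
  exists p : {perm T}, p a = a' /\ p b = b'.
Proof.
move=> ab ab'; exists (tperm a a' * tperm (tperm a a' b) b')%g; rewrite !permM tpermL; split.
  by rewrite tpermD // 1?eq_sym //; apply: contra ab => /eqP; rewrite -{1}(tpermL a a') => /perm_inj->.
by rewrite tpermL.
Qed.

(** A 2-arc consists of a centre [E w] and two distinct letters. Mapping [E (w ++ z)] to
    [E (w' ++ map pi z)] is well defined because the congruence is invariant under prefixes and
    permutations of letters. *)
Lemma pv_cover_two_arc_transitive (G : sgraph) (x0 : G) N E :
  pv_cover x0 N E -> two_arc_transitive (component x0).
Proof.
move=> [c1 K] u0 u1 u2 v0 v1 v2 uu vv.
have arcE (x0' x1 x2 : component x0) : two_arc x0' x1 x2 -> exists w a b,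
    [/\ a != b, val x1 = E w, val x0' = E (rcons w a) & val x2 = E (rcons w b)].
  case/and3P=> x01 x12 x02; have [w xE] := covers_surj c1 (valP x1).
  have /(proj2 c1)[a aE] : adj (E w) (val x0') by rewrite -xE; rewrite adj_sym.
  have /(proj2 c1)[b bE] : adj (E w) (val x2) by rewrite -xE.
  exists w, a, b; split=> //; apply: contra x02 => /eqP ab.
  by apply/eqP/val_inj; rewrite aE ab -bE.
have [w [a [b [ab u1E u0E u2E]]]] := arcE _ _ _ uu.
have [w' [a' [b' [ab' v1E v0E v2E]]]] := arcE _ _ _ vv.
have [pi [pia pib]] := perm_pair ab ab'.
have cw : covers x0 (fun z => E (w ++ z)).
  split=> [|z y]; first exact: covers_in.
  by rewrite (proj2 c1); split=> -[c ->]; exists c; rewrite rcons_cat.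
have cw' : covers x0 (fun z => E (w' ++ map pi z)).
  split=> [|z y]; first exact: covers_in.
  rewrite (proj2 c1); split=> -[c ->]; last by exists (pi c); rewrite map_rcons rcons_cat.
  by exists ((pi^-1)%g c); rewrite map_rcons permKV rcons_cat.
have [z z'|f [f_bij fA fE]] := cover_iso cw cw'.
  by rewrite !K !pv_congr_cat pv_congr_map.
exists (perm (bij_inj f_bij)); split; first by move=> x y; rewrite !permE.
rewrite !permE; split; apply: val_inj.
- by rewrite (fE _ [:: a]) ?v0E /= ?pia ?cats1.
- by rewrite (fE _ [::]) /= ?cats0.
- by rewrite (fE _ [:: b]) ?v2E /= ?pib ?cats1.
Qed.

Lemma pv_sum w : pv w (false, true) + pv w (false, false) + pv w (true, true) + pv w (true, false)
  = (odd (size w))%:Z.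
Proof.
elim: w => //= a w IH.
have -> : (~~ odd (size w))%:Z = 1 - (odd (size w))%:Z by case: odd.
by rewrite -IH; case: a => [[] []] /=; ring.
Qed.

Lemma half_diff (x y z : int) : x - y = 2 * z -> (x %/ 2)%Z - (y %/ 2)%Z = z.
Proof. lia. Qed.

(** Since C + D = - (A + B), the conditions yield divisibility of twice each number, and 2 is
    invertible modulo m. *)
Lemma congr_odd (m : nat) (A B C D : int) : odd m -> A + B + C + D = 0 ->
  [/\ (m %| A + B)%Z, (m %| A - B)%Z & (m %| C - D)%Z] <-> [/\ (m %| A)%Z, (m %| B)%Z, (m %| C)%Z & (m %| D)%Z].
Proof.
move=> om ABCD; have half z : (m %| 2 * z)%Z = (m %| z)%Z.
  by rewrite Gauss_dvdzr // coprimezE coprime_sym prime_coprime // dvdn2 om.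
split=> [[ABp ABm CDm]|[mA mB mC mD]]; last by split; [apply: rpredD|apply: rpredB|apply: rpredB].
have CDp : (m %| C + D)%Z by rewrite (_ : C + D = - (A + B)) ?rpredN //; lia.
split; rewrite -half.
- by rewrite (_ : 2 * A = (A + B) + (A - B)); [apply: rpredD | lia].
- by rewrite (_ : 2 * B = (A + B) - (A - B)); [apply: rpredB | lia].
- by rewrite (_ : 2 * C = (C + D) + (C - D)); [apply: rpredD | lia].
- by rewrite (_ : 2 * D = (C + D) - (C - D)); [apply: rpredB | lia].
Qed.

(** If A + B = k N, both half-differences equal k N / 2, an odd multiple of k. Modulo 2 N the
    correction is therefore k N, which equals A + B and C + D; the last two conditions become 2 N
    dividing 2 A and 2 C. *)
Lemma congr_2mod4 (N : nat) (A B C D q q' o : int) : N = 2 %[mod 4] -> A + B + C + D = 0 -> q - q' = A + B ->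
  [/\ (N %| A + B)%Z, ((2 * N)%N %| A - B + N%:Z * ((q %/ 2)%Z - (q' %/ 2)%Z))%Z
    & ((2 * N)%N %| C - D + N%:Z * (((q - o) %/ 2)%Z - ((q' - o) %/ 2)%Z))%Z]
  <-> [/\ (N %| A)%Z, (N %| B)%Z, (N %| C)%Z & (N %| D)%Z].
Proof.
move=> N4 ABCD qE; have [g NE] : exists g : int, N%:Z = 4 * g + 2 by exists (N %/ 4)%N%:Z; lia.
have half k : A + B = k * N%:Z -> [/\ (q %/ 2)%Z - (q' %/ 2)%Z = (2 * g + 1) * k
    & ((q - o) %/ 2)%Z - ((q' - o) %/ 2)%Z = (2 * g + 1) * k].
  move=> ABk; have E : q - q' = 2 * ((2 * g + 1) * k) by rewrite qE ABk NE; ring.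
  by split; apply: half_diff; rewrite -E //; ring.
split.
  case=> /dvdzP[k ABk]; have [-> ->] := half k ABk.
  move=> /dvdzP[i iE] /dvdzP[j jE]; rewrite PoszM in iE jE.
  have DE : D = - (A + B) - C by lia.
  have BE : B = k * N%:Z - A by lia.
  have AE : A = (i - k * g) * N%:Z by move: iE; rewrite BE NE; lia.
  have CE : C = (j - k * (g + 1)) * N%:Z by move: jE; rewrite DE ABk NE; lia.
  have mA : (N %| A)%Z by apply/dvdzP; exists (i - k * g).
  have mC : (N %| C)%Z by apply/dvdzP; exists (j - k * (g + 1)).
  have mAB : (N %| A + B)%Z by apply/dvdzP; exists k.
  by split=> //; [rewrite BE; apply: rpredB; rewrite ?dvdz_mull | rewrite DE; apply: rpredB; rewrite ?rpredN].
case=> /dvdzP[a AE] /dvdzP[b BE] /dvdzP[c CE] /dvdzP[d DE].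
have ABk : A + B = (a + b) * N%:Z by rewrite AE BE mulrDl.
have [-> ->] := half _ ABk; have abcd : a + b + c + d = 0.
  have : (a + b + c + d) * N%:Z = 0 by rewrite !mulrDl -AE -BE -CE -DE.
  by move/eqP; rewrite mulf_eq0 => /orP[/eqP //|/eqP N0]; move: NE; rewrite N0; lia.
rewrite PoszM; split; apply/dvdzP; first by exists (a + b).
  by exists (a + g * (a + b)); rewrite AE BE; ring.
by exists (a + b + c + g * (a + b)); rewrite CE DE (_ : d = - (a + b + c)); [ring|lia].
Qed.

Lemma qv_sub w w' : qv w - qv w' =
  (pv w (false, true) - pv w' (false, true)) + (pv w (false, false) - pv w' (false, false)).
Proof. by rewrite /qv; ring. Qed.

Lemma pv_sub_sum w w' : odd (size w) = odd (size w') ->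
  (pv w (false, true) - pv w' (false, true)) + (pv w (false, false) - pv w' (false, false))
  + (pv w (true, true) - pv w' (true, true)) + (pv w (true, false) - pv w' (true, false)) = 0.
Proof.
move=> oE; rewrite -(subrr (odd (size w))%:Z) {2}oE -!pv_sum; ring.
Qed.

Lemma pv_dvd4 N w w' :
  [/\ (N %| pv w (false, true) - pv w' (false, true))%Z, (N %| pv w (false, false) - pv w' (false, false))%Z,
      (N %| pv w (true, true) - pv w' (true, true))%Z & (N %| pv w (true, false) - pv w' (true, false))%Z]
  <-> forall c, (N %| pv w c - pv w' c)%Z.
Proof. by split=> [[? ? ? ?] [[] []]|H]. Qed.

(** * Label words in the graphs with s = 2 *)

Section LabelCover.
Variables (m s n : nat) (r : 'Z_n).
Hypotheses (m_gt0 : (0 < m)%N) (s_ge2 : (2 <= s)%N) (n_ge3 : (3 <= n)%N).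
Hypotheses (r_unit : r \is a GRing.unit) (r_ms : r ^+ (m * s) = 1 \/ r ^+ (m * s) = -1).
Hypothesis s2 : s = 2%N.

Local Notation l0 := (false, true).
Local Notation l1 := (false, false).
Local Notation l2 := (true, true).
Local Notation l3 := (true, false).

Definition lmvs0 kappa (w : seq letter) : CPMbar m s r := pr m r (lmvs m_gt0 s_ge2 n_ge3 r_unit kappa (0, 0) w).

Lemma covers_lmvs0 kappa : covers ((0, 0) : CPMbar m s r) (lmvs0 kappa).
Proof.
split; first exact: connect0.
move=> w y; split=> [/(adj_mvlP m_gt0 s_ge2 n_ge3 r_unit r_ms kappa)[c ->]|[c ->]].
  by exists c; rewrite /lmvs0 /lmvs foldl_rcons.
by apply/(adj_mvlP m_gt0 s_ge2 n_ge3 r_unit r_ms kappa); exists c; rewrite /lmvs0 /lmvs foldl_rcons.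
Qed.

Lemma lmvs0_eq kappa (v : int) w w' : tau r kappa - 1 = v%:~R -> (tau r kappa - 1) *+ 2 = 0 ->
  lmvs0 kappa w = lmvs0 kappa w' <-> odd (size w) = odd (size w') /\
  [/\ (m %| qv w - qv w')%Z,
    (n %| (pv w l0 - pv w' l0) - (pv w l1 - pv w' l1) + v * ((qv w %/ 2)%Z - (qv w' %/ 2)%Z))%Z
    & (n %| (pv w l2 - pv w' l2) - (pv w l3 - pv w' l3)
         + v * (((qv w - (odd (size w))%:Z) %/ 2)%Z - ((qv w' - (odd (size w))%:Z) %/ 2)%Z))%Z].
Proof.
move=> vE u2; rewrite /lmvs0.
have [] := lmvs_formula m_gt0 s_ge2 n_ge3 r_unit s2 u2 w.
have [] := lmvs_formula m_gt0 s_ge2 n_ge3 r_unit s2 u2 w'.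
rewrite vE; move: (lmvs _ _ _ _ _ _ w) (lmvs _ _ _ _ _ _ w') => P P' E1' EX' EY' E1 EX EY.
have XE (x x' z z' : int) : (x%:~R + v%:~R *~ z = x'%:~R + v%:~R *~ z' :> 'Z_n) <-> (n %| x - x' + v * (z - z'))%Z.
  rewrite -[v%:~R *~ z]mulrzr -[v%:~R *~ z']mulrzr -!intrM -!intrD dvdzE /= -intr_Zp_eq0 ?(ltnW n_ge3) //.
  rewrite (_ : x - x' + v * (z - z') = x + v * z - (x' + v * z')); last by ring.
  rewrite intrB subr_eq0; split=> [->|/eqP E]; [exact: eqxx|exact: E].
have LE : (P.1%:~R = P'.1%:~R :> 'Z_(m * s)) <->
    odd (size w) = odd (size w') /\ (m %| qv w - qv w')%Z.
  have -> : (P.1%:~R = P'.1%:~R :> 'Z_(m * s)) <-> (m * s %| `|(P.1 - P'.1)%R|)%N.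
    by rewrite -(intr_Zms m_gt0 s_ge2) intrB subr_eq0; split=> [->|/eqP].
  rewrite E1 E1' {1}s2; split.
    move=> d; have d2 : (2 %| 2 * qv w - (odd (size w))%:Z - (2 * qv w' - (odd (size w'))%:Z))%Z.
      by rewrite dvdzE; apply: dvdn_trans d; rewrite dvdn_mull.
    have oE : odd (size w) = odd (size w').
      by move: d2; clear; move: (qv w) (qv w') => q q'; case: odd; case: odd => //; lia.
    split=> //; move: d; rewrite oE.
    rewrite (_ : _ - _ = (qv w - qv w') * 2); last by ring.
    by rewrite abszM dvdn_pmul2r.
  case=> -> d; rewrite (_ : _ - _ = (qv w - qv w') * 2); last by ring.
  by rewrite abszM dvdn_pmul2r.
have VE : P.2 = P'.2 <-> pX m_gt0 s_ge2 n_ge3 r_unit P = pX m_gt0 s_ge2 n_ge3 r_unit P' /\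
    pY m_gt0 s_ge2 n_ge3 r_unit P = pY m_gt0 s_ge2 n_ge3 r_unit P'.
  split=> [E|[X Y]]; first by rewrite /pX /pY E.
  by apply/rowP => l; case: (coord01 m_gt0 s_ge2 n_ge3 r_unit s2 l) => ->.
have PE : pr m r P = pr m r P' <-> P.1%:~R = P'.1%:~R :> 'Z_(m * s) /\ P.2 = P'.2.
  split=> [E|[E1'' E2]]; last by rewrite /pr E1'' E2.
  by split; [have := congr1 fst E | have := congr1 snd E].
rewrite PE LE VE EX EX' EY EY' XE.
have rI (x y : 'Z_n) : r * x = r * y <-> x = y by split=> [/(mulrI r_unit)|->].
have arr (a b c d : int) : a - b - (c - d) = a - c - (b - d) by ring.
rewrite rI XE [_ - _ - (pv w' l0 - _)]arr [_ - _ - (pv w' l2 - _)]arr.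
by split=> [[[-> mq] [dX dY]]|[-> [mq dX dY]]]; [split|split].
Qed.

Lemma pv_cover_odd kappa : n = m -> odd n -> tau r kappa = 1 ->
  pv_cover ((0, 0) : CPMbar m s r) m (lmvs0 kappa).
Proof.
move=> nm on t1; split=> [|w w']; first exact: covers_lmvs0.
have u0 : tau r kappa - 1 = 0%:~R by rewrite t1 subrr.
rewrite (lmvs0_eq w w' u0) ?u0 ?mul0rn // !mul0r !addr0 nm qv_sub.
have om : odd m by rewrite -nm.
by split=> -[oE H]; split=> //; have S0 := pv_sub_sum oE;
  [move/(congr_odd om S0): H; rewrite pv_dvd4 | apply/(congr_odd om S0)/pv_dvd4].
Qed.

(** The alternative N = 2 with m dividing 2 includes n = 4, m = 1; there the condition on the first
    coordinate modulo 4 makes the difference of [qv] even. *)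
Lemma pv_cover_2mod4 N : n = (2 * N)%N -> N = 2 %[mod 4] -> m = N \/ N = 2%N /\ (m %| N)%N ->
  1 + r ^+ 2 = N%:R -> pv_cover ((0, 0) : CPMbar m s r) N (lmvs0 false).
Proof.
move=> nN N4 mN rN; split=> [|w w']; first exact: covers_lmvs0.
have N2 : (2 * N)%N%:R = 0 :> 'Z_n.
  by apply/eqP; rewrite -nN -[n%:R]/(n%:~R) intr_Zp_eq0 // (ltnW n_ge3).
have uN : tau r false - 1 = N%:~R.
  apply/eqP; rewrite -subr_eq0 -oppr_eq0 -N2 natrM -[N%:~R]/(N%:R) -rN /tau /sg.
  by apply/eqP; ring.
rewrite (lmvs0_eq w w' uN); last by rewrite uN -mulr_natl -natrM N2.
rewrite nN; split=> -[oE H]; split=> //; have S0 := pv_sub_sum oE.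
  apply/pv_dvd4/(congr_2mod4 _ N4 S0 (qv_sub w w')).
  case: H => mq X Y; split; [rewrite -qv_sub | exact: X | exact: Y].
  case: mN => [<- //|[NE _]]; move: X; rewrite NE PoszM => /dvdzP[k kE].
  rewrite qv_sub; apply/dvdzP; move: kE.
  move: (pv w l0 - _) (pv w l1 - _) ((qv w %/ 2)%Z - (qv w' %/ 2)%Z) => A B z kE.
  by exists (2 * k - z + B); lia.
have [NAB X Y] := (congr_2mod4 (odd (size w))%:Z N4 S0 (qv_sub w w')).2 ((pv_dvd4 N w w').2 H).
split=> //; rewrite qv_sub; case: mN => [-> //|[_ mN]].
by apply: dvdz_trans NAB; rewrite dvdzE.
Qed.

End LabelCover.

Theorem theorem7p3 (m s n : nat) (m_gt0 : (0 < m)%N) (s_ge2 : (2 <= s)%N)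
    (n_ge3 : (3 <= n)%N) (r : 'Z_n) (r_unit : r \is a GRing.unit)
    (r_ms : r ^+ (m * s) = 1 \/ r ^+ (m * s) = -1) :
  (two_arc_transitive (CPM m s r) <->
     s = 2%N /\
     [\/ n = 4%N /\ m = 1%N,
         [/\ n = m, odd n & r ^+ 2 = 1 \/ r ^+ 2 = -1]
       | [/\ n = (2 * m)%N, m = 2 %[mod 4] & 1 + r ^+ 2 = m%:R]]) /\
  (s = 2%N -> n = 4%N -> m = 1%N ->
     isomorphic (CPM m s r) (CPM 1 2 (1 : 'Z_4)) /\
     isomorphic (CPM 1 2 (1 : 'Z_4)) (CPM 2 2 (1 : 'Z_4))).
Proof.
(* For n = 4, all units and both m = 1 and m = 2 lead to the same quotient, with N = 2. *)
have cover4 k (k_gt0 : (0 < k)%N) t (x : 'Z_t) : (k %| 2)%N -> t = 4%N -> x \is a GRing.unit ->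
    x ^+ (k * 2) = 1 \/ x ^+ (k * 2) = -1 ->
  exists E, pv_cover ((0, 0) : CPMbar k 2 x) 2 E.
  move=> k2 t4 ux xk; have t3 : (3 <= t)%N by rewrite t4.
  exists (@lmvs0 k 2 t x k_gt0 isT t3 ux false).
  apply: pv_cover_2mod4 => //; first by right.
  exact: unit_Z4_sqr.
split; last first.
  move=> s2 n4 m1; subst s m.
  have [E0 c0] := cover4 1%N isT n r isT n4 r_unit r_ms.
  have [E1 c1] := cover4 1%N isT 4%N 1 isT erefl (GRing.unitr1 _) (or_introl (GRing.expr1n _ _)).
  have [E2 c2] := cover4 2%N isT 4%N 1 isT erefl (GRing.unitr1 _) (or_introl (GRing.expr1n _ _)).
  by split; [exact: pv_cover_isomorphic c0 c1 | exact: pv_cover_isomorphic c1 c2].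
split; first exact: two_arc_transitive_cases.
case=> s2 [[n4 m1]|[nm on r2]|[nm m4 r2]].
- subst s m; have [E c] := cover4 1%N isT n r isT n4 r_unit r_ms.
  exact: pv_cover_two_arc_transitive c.
- have [kappa t1] : exists kappa, tau r kappa = 1.
    case: r2 => r2; [exists true|exists false]; rewrite /tau r2.
      by rewrite GRing.mulr1.
    by rewrite GRing.mulrN1 GRing.opprK.
  exact: pv_cover_two_arc_transitive (pv_cover_odd m_gt0 s_ge2 n_ge3 r_unit r_ms s2 nm on t1).
exact: pv_cover_two_arc_transitive (pv_cover_2mod4 m_gt0 s_ge2 n_ge3 r_unit r_ms s2 nm m4 (or_introl erefl) r2).
Qed.
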